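(* Let $A$ be a C$^*$-algebra and $T(A)$ the cone of lower semicontinuous traces. (a) Equipped with the topology $\tau_{iv}^*$, $T(A)$ is an ordered compact topological cone, that is, $T(A)$ is a compact ordered space and addition and scalar multiplication are order preserving and jointly continuous, where $\mathbb R_{>0}$ is endowed with the usual Hausdorff topology. (b) Equipped with the weak$^*$upper topology $\tau^*_{up}$, $T(A)$ is a stably compact topological cone, that is, it is a stably compact space and addition and scalar multiplication are continuous, where $\mathbb R_{>0}$ is endowed with the upper topology. (c) Equipped with the lower topology $\tau_{lo}^*$, $T(A)$ is a stably compact topological cone, that is, it is a stably compact space and addition and scalar multiplication are continuous, where $\mathbb R_{>0}$ is endowed with the lower topology.
   Context: $A_+=\{xx^*: x\in A\}$ is the positive cone of $A$, with order $a\le b$ iff $b-a\in A_+$. $\overline{\mathbb R}_+=[0,+\infty]$. A lower semicontinuous trace is a map $t:A_+\to\overline{\mathbb R}_+$ that is lower semicontinuous for the norm topology, satisfies $t(0)=0$, $t(a+b)=t(a)+t(b)$, and $t(xx^* )=t(x^*x)$ for all $x\in A$. $T(A)$ is the set of these, with pointwise order, addition and multiplication by reals $r>0$. For $a\in A_+$ and $\varepsilon>0$, $(a-\varepsilon)_+$ is defined by continuous functional calculus with $s\mapsto\max(s-\varepsilon,0)$. For $a,a'\in A_+$: $a\sim a'$ (Cuntz-Pedersen equivalence) if there is a sequence $(x_n)$ in $A$ with $a=\sum_n x_nx_n^*$ and $a'=\sum_n x_n^*x_n$ (norm convergent); $a\precsim b$ if there is $a'\in A_+$ with $a\sim a'\le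 b$; and $a\prec b$ if $a\precsim(b-\varepsilon)_+$ for some $\varepsilon>0$. The c-space topology on $A_+$ has as open sets the sets $U\subseteq A_+$ with $U=\{x:\exists z\in U,\ z\prec x\}$. $\mathrm{LSC}(A_+)$ is the set of all functions $A_+\to\overline{\mathbb R}_+$ that are lower semicontinuous for the c-space topology, ordered pointwise; $T(A)$ is regarded as a subset of $\mathrm{LSC}(A_+)$ (lower semicontinuous traces are lower semicontinuous for the c-space topology). On a poset $L$: the upper topology has the sets $\{y: y\le b\}$, $b\in L$, as a subbasis for the closed sets; the lower topology has the sets $\{y: y\ge a\}$, $a\in L$, as a subbasis for the closed sets; the interval topology is generated by both. $\tau^*_{up},\tau^*_{lo},\tau^*_{iv}$ are the subspace topologies on $T(A)$ induced by the upper, lower and interval topology of $\mathrm{LSC}(A_+)$, respectively. A compact ordered space is a compact space $X$ with a partial order whose graph is closed in $X\times X$. A space is stably compact if it is compact, locally compact (each point has a neighbourhood basis of compact sets), sober, and coherent (the intersection of two compact saturated subsets is compact; saturated means an intersection of open sets). Scalar multiplication is the map $\mathbb R_{>0}\times T(A)\to T(A)$; continuity of addition and scalar multiplication is joint continuity. *)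

(* Defs.v *)
From HB Require Import structures.
From mathcomp Require Import all_boot all_order all_algebra.
From mathcomp Require Import complex.
From mathcomp Require Import all_classical all_reals all_analysis.

Set Implicit Arguments.
Unset Strict Implicit.
Unset Printing Implicit Defensive.

Import Order.TTheory GRing.Theory Num.Theory.
Import numFieldNormedType.Exports.

Local Open Scope classical_set_scope.
Local Open Scope ring_scope.

(* Neither compactness nor local compactness includes separation here, so the
   library's [locally_compact] (closed compact neighbourhoods) is not used. *)
Definition locally_compact_nbhs (X : topologicalType) : Prop :=
  forall (x : X) (U : set X), nbhs x U ->
    exists K : set X, [/\ compact K, nbhs x K & K `<=` U].

Definition irreducible_closed (X : topologicalType) (C : set X) : Prop :=
  [/\ closed C, C !=set0 &
      forall D E : set X, closed D -> closed E ->
        C `<=` D `|` E -> C `<=` D \/ C `<=` E].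

Definition sober_space (X : topologicalType) : Prop :=
  forall C : set X, irreducible_closed C ->
    exists! x : X, C = closure [set x].

Definition saturated (X : topologicalType) (K : set X) : Prop :=
  exists2 F : set (set X), F `<=` open & K = \bigcap_(U in F) U.

Definition coherent_space (X : topologicalType) : Prop :=
  forall K L : set X, compact K -> saturated K -> compact L -> saturated L ->
    compact (K `&` L).

Definition stably_compact (X : topologicalType) : Prop :=
  [/\ compact [set: X], locally_compact_nbhs X, sober_space X
    & coherent_space X].

Definition compact_ordered_space (X : topologicalType) (le : rel X) : Prop :=
  [/\ compact [set: X], reflexive le, antisymmetric le, transitive le
    & closed [set p : X * X | le p.1 p.2]].

Definition generated_topology (T : Type) (S : set (set T)) : Type := T.

HB.instance Definition _ (T : choiceType) (S : set (set T)) :=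
  Choice.on (generated_topology S).
HB.instance Definition _ (T : choiceType) (S : set (set T)) :=
  @isSubBaseTopological.Build (generated_topology S) (set T) S id.

Section order_topologies.
Context {d : Order.disp_t} (L : porderType d).
Local Open Scope order_scope.

Definition upper_subbase : set (set L) :=
  [set ~` [set y | y <= b] | b in [set: L]].
Definition lower_subbase : set (set L) :=
  [set ~` [set y | a <= y] | a in [set: L]].

Definition upper_topology : Type := generated_topology upper_subbase.
Definition lower_topology : Type := generated_topology lower_subbase.
Definition interval_topology : Type :=
  generated_topology (upper_subbase `|` lower_subbase).

HB.instance Definition _ := Topological.on upper_topology.
HB.instance Definition _ := Topological.on lower_topology.
HB.instance Definition _ := Topological.on interval_topology.

End order_topologies.

(* Non-unital rings are not in the hierarchy of ring structures, so that the
   product of a possibly non-unital C*-algebra is a field of the mixin. *)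
HB.mixin Record CompleteNormedModule_isCStarAlgebra (R : realType) A
    & @CompleteNormedModule R[i] A := {
  cmul : A -> A -> A;
  cstar : A -> A;
  cmulA : associative cmul;
  cmulDl : left_distributive cmul +%R;
  cmulDr : right_distributive cmul +%R;
  cmulZl : forall (k : R[i]) (x y : A), cmul (k *: x) y = k *: cmul x y;
  cmulZr : forall (k : R[i]) (x y : A), cmul x (k *: y) = k *: cmul x y;
  cnormM : forall x y : A, `|cmul x y| <= `|x| * `|y|;
  cstarK : involutive cstar;
  cstarD : {morph cstar : x y / x + y};
  cstarZ : forall (k : R[i]) (x : A), cstar (k *: x) = Num.conj k *: cstar x;
  cstarM : forall x y : A, cstar (cmul x y) = cmul (cstar y) (cstar x);
  cnorm_star : forall x : A, `|cmul (cstar x) x| = `|x| ^+ 2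
}.

#[short(type="cstarAlgType")]
HB.structure Definition CStarAlgebra (R : realType) :=
  {A of CompleteNormedModule_isCStarAlgebra R A & @CompleteNormedModule R[i] A}.

Reserved Notation "x ^⋆" (at level 2, format "x ^⋆").
Reserved Notation "x ⋅ y" (at level 40, left associativity).
Notation "x ⋅ y" := (cmul x y) : ring_scope.
Notation "x ^⋆" := (cstar x) : ring_scope.

Section cstar_algebra.
Context {R : realType} {A : cstarAlgType R}.
Implicit Types (a b x : A) (e : R) (f g : R[i]^o -> R[i]^o).

(* [1 - x] has the inverse [1 - y] in the unitization. *)
Definition quasi_invertible x : Prop :=
  exists y, x + y - x ⋅ y = 0 /\ x + y - y ⋅ x = 0.

(* The spectrum of [a] in the unitization of [A], together with 0. *)
Definition quasi_spectrum a : set R[i]^o :=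
  [set z | z = 0 \/ (z != 0 /\ ~ quasi_invertible ((z : R[i])^-1 *: a))].

Definition cfc_domain a : set (R[i]^o -> R[i]^o) :=
  [set f | {within quasi_spectrum a, continuous f} /\ f 0 = 0].

(* [Phi] is the *-homomorphism from the continuous functions on the spectrum
   that vanish at 0 to [A] that sends the identity function to [a]; functions
   on the spectrum are represented by functions on the complex numbers. *)
Record is_cfc a (Phi : (R[i]^o -> R[i]^o) -> A) : Prop := IsCfc {
  cfc_ext : forall f g, cfc_domain a f -> cfc_domain a g ->
    {in quasi_spectrum a, f =1 g} -> Phi f = Phi g;
  cfc_add : forall f g, cfc_domain a f -> cfc_domain a g ->
    Phi (fun z => f z + g z) = Phi f + Phi g;
  cfc_scale : forall (k : R[i]) f, cfc_domain a f ->
    Phi (fun z => k * f z) = k *: Phi f;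
  cfc_mul : forall f g, cfc_domain a f -> cfc_domain a g ->
    Phi (fun z => f z * g z) = Phi f ⋅ Phi g;
  cfc_star : forall f, cfc_domain a f ->
    Phi (fun z => Num.conj (f z : R[i])) = (Phi f)^⋆;
  cfc_id : Phi id = a
}.

(* f(a); meaningful for normal [a] and [f] in [cfc_domain a], where [Phi]
   exists and its value at [f] is unique. *)
Definition cfc a f : A :=
  xget 0 [set b | exists2 Phi, is_cfc a Phi & b = Phi f].

(* (a - e)_+ : the spectrum of a positive [a] is real. *)
Definition cutdown a e : A :=
  cfc a (fun z => (Num.max (complex.Re z - e) 0)%:C%C).

Definition pos_cone : set A := [set a | exists x, a = x ⋅ x^⋆].

Definition cle a b : Prop := pos_cone (b - a).

Definition cp_equiv a b : Prop :=
  exists x : nat -> A,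
    (series (fun n => x n ⋅ (x n)^⋆) @ \oo --> a) /\
    (series (fun n => (x n)^⋆ ⋅ x n) @ \oo --> b).

Definition cp_sub a b : Prop :=
  exists a', [/\ pos_cone a', cp_equiv a a' & cle a' b].

Definition cp_prec a b : Prop :=
  exists2 e, 0 < e & cp_sub a (cutdown b e).

End cstar_algebra.

Arguments pos_cone {R} A.

Section traces.
Context {R : realType} (A : cstarAlgType R).
Local Open Scope ereal_scope.

(* Seen as a type, [pos_cone A] carries the subspace topology of the norm
   topology of [A]. *)
Local Notation Apos := (pos_cone A).

Definition c_open (U : set Apos) : Prop :=
  U = [set x | exists2 z, U z & cp_prec (val z) (val x)].

(* Only levels [0 <= r] matter for functions with values in [0, +oo]. *)
Definition c_lsc_fun (f : Apos -> \bar R) : Prop :=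
  (forall x, 0 <= f x) /\
  (forall r : R, (0 <= r)%R -> c_open [set x | r%:E < f x]).

(* Additivity is stated for those [c] in the cone that are equal to [a + b],
   since the cone is only known to be closed under sums by a theorem. *)
Record lsc_trace_fun (t : Apos -> \bar R) : Prop := LscTraceFun {
  lsc_trace_ge0 : forall x, 0 <= t x;
  lsc_trace_lsc : lower_semicontinuous t;
  lsc_trace0 : forall z : Apos, val z = 0%R -> t z = 0;
  lsc_traceD : forall a b c : Apos,
    val c = (val a + val b)%R -> t c = t a + t b;
  lsc_traceC : forall (x : A) (a b : Apos),
    val a = (x ⋅ x^⋆)%R -> val b = (x^⋆ ⋅ x)%R -> t a = t b
}.

Definition LSC : Type := set_type [set f | c_lsc_fun f].
HB.instance Definition _ := SubChoice.on LSC.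

Definition TA : Type := set_type [set t | lsc_trace_fun t].
HB.instance Definition _ := SubChoice.on TA.

Lemma LSCP (f : LSC) : c_lsc_fun (val f). Proof. exact: set_valP. Qed.
Lemma TAP (t : TA) : lsc_trace_fun (val t). Proof. exact: set_valP. Qed.

Definition LSC_le (f g : LSC) : bool :=
  `[< forall x, val f x <= val g x >].
Definition TA_le (s t : TA) : bool :=
  `[< forall x, val s x <= val t x >].

Lemma LSC_le_refl : reflexive LSC_le.
Proof. by move=> f; apply/asboolP. Qed.
Lemma LSC_le_anti : antisymmetric LSC_le.
Proof.
move=> f g /andP[/asboolP fg /asboolP gf]; apply/val_inj/funext => x.
by apply/eqP; rewrite eq_le fg gf.
Qed.
Lemma LSC_le_trans : transitive LSC_le.
Proof.
move=> g f h /asboolP fg /asboolP gh; apply/asboolP => x.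
exact: le_trans (fg x) (gh x).
Qed.

Fact LSC_display : Order.disp_t. Proof. exact: Order.Disp tt tt. Qed.
HB.instance Definition _ := Order.Le_isPOrder.Build LSC_display LSC
  LSC_le_refl LSC_le_anti LSC_le_trans.

Lemma c_lsc_fun0 : [set f | c_lsc_fun f] (fun _ : Apos => 0).
Proof.
split=> // r r0; rewrite /c_open; apply/seteqP.
by split=> x /= => [|[z]]; rewrite lte_fin ltNge r0.
Qed.
Definition LSC0 : LSC := SigSub (mem_set c_lsc_fun0).

(* The inclusion of T(A) in LSC(A_+). Lower semicontinuous traces are lower
   semicontinuous for the c-space topology, so that the default value [LSC0]
   is never used. *)
Definition LSC_of_TA (t : TA) : LSC := insubd LSC0 (val t).

Definition TA_up : Type :=
  initial_topology (LSC_of_TA : TA -> upper_topology LSC).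
Definition TA_lo : Type :=
  initial_topology (LSC_of_TA : TA -> lower_topology LSC).
Definition TA_iv : Type :=
  initial_topology (LSC_of_TA : TA -> interval_topology LSC).

HB.instance Definition _ := Topological.on TA_up.
HB.instance Definition _ := Topological.on TA_lo.
HB.instance Definition _ := Topological.on TA_iv.

Lemma lsc_trace_fun_add (s t : TA) :
  [set t | lsc_trace_fun t] (fun x => val s x + val t x).
Proof.
case: (TAP s) (TAP t) => s0 sl sz sD sC [t0 tl tz tD tC]; split.
- by move=> x; exact: adde_ge0.
- move=> x a axy.
  have [p [q [ps qt apq]]] : exists p q : R,
      [/\ p%:E < val s x, q%:E < val t x & (a <= p + q)%R].
    move: axy (s0 x) (t0 x).
    case: (val s x) => [u||] //; case: (val t x) => [v||] //.
    + rewrite -EFinD lte_fin => auv _ _.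
      exists (u - (u + v - a) / 2)%R, (v - (u + v - a) / 2)%R.
      have d0 : (0 < (u + v - a) / 2)%R by rewrite divr_gt0 ?subr_gt0.
      rewrite !lte_fin !ltrBlDr !ltrDl d0; split => //.
      by rewrite addrACA -opprD -splitr opprB addrC subrK.
    + move=> _ _ _; exists (u - 1)%R, (a - (u - 1))%R.
      by rewrite lte_fin ltrBlDr ltrDl ltr01 ltry addrC subrK.
    + move=> _ _ _; exists (a - (v - 1))%R, (v - 1)%R.
      by rewrite lte_fin ltrBlDr ltrDl ltr01 ltry subrK.
    + by move=> _ _ _; exists a, 0%R; rewrite !ltry addr0.
  have [V xV Vp] := sl _ _ ps; have [W xW Wq] := tl _ _ qt.
  exists (V `&` W) => [|y [Vy Wy]]; first exact: filterI.
  rewrite (@le_lt_trans _ _ (p%:E + q%:E)) // ?lee_fin //.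
  by apply: lteD; [exact: Vp|exact: Wq].
- by move=> z z0; rewrite sz // tz // adde0.
- by move=> a b c abc; rewrite (sD _ _ _ abc) (tD _ _ _ abc) addeACA.
- by move=> x a b ha hb; rewrite (sC _ _ _ ha hb) (tC _ _ _ ha hb).
Qed.

Lemma lsc_trace_fun_scale (r : {posnum R}) (t : TA) :
  [set t | lsc_trace_fun t] (fun x => r%:num%:E * val t x).
Proof.
case: (TAP t) => t0 tl tz tD tC; split.
- by move=> x; rewrite mule_ge0.
- move=> x a ax; have [|V xV Va] := tl x (r%:num^-1 * a)%R.
    by rewrite EFinM lte_pdivrMl.
  by exists V => // y /Va; rewrite EFinM lte_pdivrMl.
- by move=> z z0; rewrite tz // mule0.
- by move=> a b c abc; rewrite (tD _ _ _ abc) ge0_muleDr.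
- by move=> x a b ha hb; rewrite (tC _ _ _ ha hb).
Qed.

Definition TA_add (s t : TA) : TA := SigSub (mem_set (lsc_trace_fun_add s t)).
Definition TA_scale (r : {posnum R}) (t : TA) : TA :=
  SigSub (mem_set (lsc_trace_fun_scale r t)).

End traces.

Definition posnum_usual (R : realType) : Type :=
  initial_topology (fun r : {posnum R} => r%:num : R).
HB.instance Definition _ (R : realType) := Topological.on (posnum_usual R).
Definition posnum_up (R : realType) : Type := upper_topology {posnum R}.
HB.instance Definition _ (R : realType) := Topological.on (posnum_up R).
Definition posnum_lo (R : realType) : Type := lower_topology {posnum R}.
HB.instance Definition _ (R : realType) := Topological.on (posnum_lo R).

(* Main.v *)
(* On T(A), the neighbourhoods of t for the upper topology are generated by the
   sets {t' : t'(a) > r} with t(a) > r, and those for the lower topology by the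
   sets {t' : t'((a - e)_+) < p} with e > 0 and t(a) < p.

   Compactness of the interval topology: along an ultrafilter on T(A) the
   pointwise limit l of the traces is additive and tracial, but possibly not
   lower semicontinuous; t(a) = sup_{e > 0} l((a - e)_+) is, and it is the limit
   of the ultrafilter.  That t is an additive trace follows from three facts
   about an algebraic trace l: l((a - e)_+) <= l(b) when |a - b| < e, the
   invariance l((x x^* - e)_+) = l((x^* x - e)_+), and the comparison of
   (a + b - e)_+ with (a - d)_+ and (b - d)_+.

   If s(a) > t(a), the inequalities s((a - e)_+) > p and t((a - e)_+) < p
   separate s and t by an upper open and a lower open set, hence the order is
   closed; and the open upper (or lower) sets of a compact ordered space
   separated in this way form a stably compact topology.

   The functional calculus rests on the equality of norm and spectral radius
   for a = a^*, |a| = 1.  If the spectrum lay inside the open unit disc, the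
   resolvents (1 - l a)^-1 and (1 - r l a)^-1 with |l| <= 1 would be uniformly
   close for some r < 1.  Averaging over l and -l, so would be those of a^(2^n),
   with r^(2^n) instead of r, although |a^(2^n)| = 1. *)

Require Import Defs.
From HB Require Import structures.
From mathcomp Require Import all_boot all_order all_algebra.
From mathcomp Require Import complex ring lra.
From mathcomp Require Import all_classical all_reals all_analysis.
Import Order.TTheory GRing.Theory Num.Theory.
Import numFieldNormedType.Exports.
Set Implicit Arguments.
Unset Strict Implicit.
Unset Printing Implicit Defensive.
Local Open Scope classical_set_scope.
Local Open Scope ring_scope.

(** * Topologies given by subbases *)

(** The unitization carries no norm, so operator bounds are stated inside [A]: that k + a has norm
    at most L reads |k x + a x| <= L |x| for all x. Positivity takes this form too: for self-adjoint
    a and M >= |a|, the spectrum of a is nonnegative exactly when |M x - a x| <= M |x| for all x, a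
    condition that passes to sums and limits. Averaging resolvents takes the place of holomorphic
    functions in the spectral radius formula; the analysis it needs is the compactness of the disc.

    [cfc] picks a *-homomorphism that is not assumed continuous, so nothing about [cutdown] can be
    computed until every candidate is shown to be contractive, hence a limit of polynomials.

    The cutdown in the lower neighbourhoods comes from the c-space: a c-lower semicontinuous f with
    f(a) > p already exceeds p at some b that is Cuntz-Pedersen below some (a - e)_+. This is the
    margin by which the pointwise limit l and its regularization t may differ: l((a - e)_+) <= t(a)
    <= l(a). *)

Lemma generated_nbhs (T : choiceType) (S : set (set T))
    (p : generated_topology S) (B : set T) :
  S B -> B p -> nbhs p B.
Proof.
move=> SB Bp; apply: open_nbhs_nbhs; split=> //.
exists [set B]; last by rewrite bigcup_set1.
by move=> _ ->; exact: (@finI_from1 _ _ S id).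
Qed.

Lemma generated_cvg (T : choiceType) (S : set (set T))
    (F : set_system (generated_topology S)) (p : generated_topology S) :
  Filter F -> (forall B, S B -> B p -> F B) -> F --> p.
Proof.
move=> FF FS V; rewrite nbhsE => -[_ [[E ES <-] [W EW Wp]] EV].
apply: filterS EV _; apply: filterS (bigcup_sup EW) _.
have [D DS WE] := ES _ EW; move: Wp; rewrite -WE => Wp.
apply: filter_bigI => B DB; apply: FS; last exact: Wp.
by have := DS _ DB; rewrite inE.
Qed.

Section initial_generated.
Context (T U : choiceType) (S : set (set T)) (f : U -> T).
Let W : topologicalType := initial_topology (f : U -> generated_topology S).

Lemma initial_generated_nbhs (p : W) (B : set T) :
  S B -> B (f p) -> nbhs p (f @^-1` B).
Proof.
move=> SB Bp; apply: (@initial_continuous _ _ (f : U -> generated_topology S) p).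
exact: generated_nbhs.
Qed.

Lemma initial_generated_cvg (F : set_system U) (p : W) :
  Filter F -> (forall B, S B -> B (f p) -> F (f @^-1` B)) -> F --> p.
Proof.
move=> FF FS A; rewrite nbhsE => -[_ [[B Bo <-] Bp] BA].
apply: filterS BA _.
apply: (@generated_cvg _ S (f @ F) (f p : generated_topology S)) => //.
by apply: open_nbhs_nbhs; split.
Qed.

End initial_generated.

(** * Stably compact spaces from compact ordered spaces *)

(* A Nachbin-type duality: [X1] carries the open upper sets of the compact
   ordered space [X]. *)
Section stably_compact_upper.
Context (X X1 : topologicalType) (f : X -> X1) (g : X1 -> X) (le : X -> X -> Prop).
Hypotheses (fK : cancel f g) (gK : cancel g f).
Hypothesis compactX : compact [set: X].
Hypothesis continuous_f : continuous f.
Hypothesis le_refl : forall x, le x x.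
Hypothesis le_anti : forall x y, le x y -> le y x -> x = y.
Hypothesis open_upper : forall (U : set X1) x y,
  open U -> le x y -> U (f x) -> U (f y).
Hypothesis le_sep : forall x y, ~ le x y ->
  exists (U : set X1) (V : set X), [/\ nbhs (f x) U, nbhs y V
    & forall u v, U (f u) -> V v -> ~ le u v].

Let g_cont_compact (K : set X) : compact K -> compact (f @` K).
Proof.
move=> Kc; apply: continuous_compact => //.
exact: continuous_subspaceT.
Qed.

(** Saturated sets are upper sets, so a point [t] outside [K] lies above no point of [K]. Separating
    [t] from each point of [K], compactness of [K] yields one neighbourhood of [t] that misses
    [K]. *)
Lemma compact_saturated_closed (K : set X1) :
  compact K -> saturated K -> closed (f @^-1` K).
Proof.
move=> Kc [F Fo KE].
have Kup x y : le x y -> K (f x) -> K (f y).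
  by move=> xy; rewrite KE => Kx U FU; apply: (open_upper (Fo _ FU) xy); exact: Kx.
rewrite -openC openE => t /= nKt.
have : \forall i \near t, K `<=` (fun x => ~ le (g x) i).
  apply: (compact_near_coveringP K).1 => // x Kx.
  have : ~ le (g x) t by move=> /Kup; rewrite gK => /(_ Kx).
  move=> /le_sep[U [V [Ux Vt UV]]]; exists (U, V) => /=.
    by rewrite gK in Ux.
  by move=> [u v] /= [Uu Vv]; apply: UV => //; rewrite gK.
by apply: filterS => s Ws Ks; apply: (Ws _ Ks); rewrite fK.
Qed.

Lemma coherent_upper : coherent_space X1.
Proof.
move=> K L Kc Ks Lc Ls.
have -> : K `&` L = f @` (f @^-1` K `&` f @^-1` L).
  apply/seteqP; split=> [x [Kx Lx]|_ [x [Kx Lx] <-]]; last by split.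
  by exists (g x); rewrite /= ?gK.
apply: g_cont_compact; apply: (subclosed_compact _ compactX) => //.
by apply: closedI; exact: compact_saturated_closed.
Qed.

Lemma locally_compact_upper : locally_compact_nbhs X1.
Proof.
move=> x U0 U0x.
have [U [Uo Ux] UU0] : exists2 U, open_nbhs x U & U `<=` U0 by rewrite nbhsE in U0x.
have cU : compact (~` (f @^-1` U)).
  apply: (subclosed_compact _ compactX) => //; apply: open_closedC.
  exact: open_comp.
(* The covering is indexed by ever smaller neighbourhoods [W] of [x]: for some [W], the closure in
   [X] misses the compact complement of [U]. The image of that closure is the compact neighbourhood
   sought. *)
have [] := (compact_near_coveringP _).1 cU (set X1)
  (powerset_filter_from (nbhs x)) (fun W t => ~ closure (f @^-1` W) t).
- move=> t nUt; have : ~ le (g x) t.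
    by move=> /(open_upper Uo); rewrite gK => /(_ Ux).
  move=> /le_sep[V [W [Vx Wt VW]]]; rewrite gK in Vx.
  exists (W^°, [set V' | V' `<=` V]).
    split => /=; first by apply: nbhs_interior.
    exact: small_set_sub.
  move=> [y V'] /= [Wy V'V] /(_ _ Wy)[z [/V'V Vz Wz]].
  exact: (VW z z).
- move=> G [Gx Gs [W GW]] GU.
  exists (f @` closure (f @^-1` W)); split.
  + apply: g_cont_compact; apply: (subclosed_compact _ compactX) => //.
    exact: closed_closure.
  + have := Gx _ GW; apply: filterS => y Wy; exists (g y); rewrite ?gK //.
    by apply: subset_closure; rewrite /= gK.
  + move=> _ [y cy <-]; apply: UU0; apply: contrapT => nU.
    exact: (GU W GW y nU).
Qed.

Lemma sober_upper : sober_space X1.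
Proof.
move=> C [Cc [c0 Cc0] Cirr].
have cC : compact (f @^-1` C).
  apply: (subclosed_compact _ compactX) => //.
  by move: continuous_f => /continuous_closedP; apply.
(* The filter on [C] generated by the open sets that meet [C]; its stability under intersection is
   the irreducibility of [C]. *)
pose F : set_system X := [set S | exists U : set X1,
  [/\ open U, U `&` C !=set0 & f @^-1` (U `&` C) `<=` S]].
have FF : Filter F.
  split.
  - by exists setT; split => //; [exact: openT|exists c0].
  - move=> S S' [U [Uo [u [Uu Cu]] US]] [U' [Uo' [u' [Uu' Cu']] US']].
    exists (U `&` U'); split; first exact: openI.
      apply: contrapT => /set0P/negP/negPn/eqP UUC.
      have [|/(_ u Cu)//|/(_ u' Cu')//] := Cirr (~` U) (~` U') (open_closedC Uo) (open_closedC Uo').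
      move=> y Cy; have [Uy|] := pselect (U y); last by left.
      by right=> U'y; suff : set0 y by []; rewrite -UUC.
    by move=> y [[Uy U'y] Cy]; split; [exact: US|exact: US'].
  - by move=> S S' SS' [U [Uo Uu US]]; exists U; split=> //; exact: subset_trans SS'.
(* If [C] had no greatest element, every [x] in [C] could be separated from some [s] in [C] with [s]
   not below [x]. By compactness some open [U] meeting [C] would have no point of [U] and [C] below
   any point of [C], not even below itself. *)
have [x [Cx xmax]] : exists x, C (f x) /\ forall s, C (f s) -> le s x.
  apply: contrapT => nmax.
  have [] := (compact_near_coveringP _).1 cC X F (fun i x => ~ le i x).
  + move=> x Cx; have [s [Cs sx]] : exists s, C (f s) /\ ~ le s x.
      apply: contrapT => nex; apply: nmax; exists x; split=> // s Cs.
      by apply: contrapT => sx; apply: nex; exists s.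
    have [U [V [Us Vx UV]]] := le_sep sx.
    exists (V, f @^-1` U `&` f @^-1` C).
      split=> //=; exists (U^°); split; first exact: open_interior.
        by exists (f s); split.
      by move=> y [Uy Cy]; split=> //; exact: interior_subset Uy.
    by move=> [u v] /= [Vu [Uv _]]; exact: UV.
  + move=> U [Uo [u [Uu Cu]] UF].
    by apply: (UF (g u) _ (g u)); rewrite /= ?gK.
have CE : C = closure [set f x].
  apply/seteqP; split.
    move=> s Cs W; rewrite nbhsE => -[W' [Wo Ws] W'W].
    exists (f x); split => //; apply: W'W.
    by apply: (open_upper Wo (xmax (g s) _)); rewrite gK.
  by rewrite closureE => y; apply; split=> // _ ->.
exists (f x); split => // y CEy.
have yle : le (g y) x.
  by apply: xmax; rewrite gK CEy; exact: subset_closure.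
have xle : le x (g y).
  apply: contrapT => /le_sep[U [V [Ux Vy UV]]].
  have : closure [set y] (f x) by rewrite -CEy.
  move=> /(_ _ Ux)[_ [-> Uy]].
  by apply: (UV (g y) (g y)); [rewrite gK|exact: nbhs_singleton|exact: le_refl].
by rewrite (le_anti xle yle) gK.
Qed.

Lemma stably_compact_upper : stably_compact X1.
Proof.
split; [|exact: locally_compact_upper|exact: sober_upper|exact: coherent_upper].
rewrite (_ : setT = f @` setT); first exact: g_cont_compact.
by apply/seteqP; split=> // x _; exists (g x); rewrite ?gK.
Qed.

End stably_compact_upper.

(** * Real-valued norms *)

Section nrm.
Context {R : realType}.
Implicit Types (V : normedZmodType R[i]).

(** Norms over [R[i]] are complex numbers; their real parts live in a totally ordered field, where
    [lra] and [nra] apply. *)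
Definition nrm V (x : V) : R := complex.Re `|x|.

Lemma nrmE V (x : V) : `|x| = (nrm x)%:C%C.
Proof. by rewrite /nrm RRe_real// ger0_real. Qed.

Lemma nrm_ge0 V (x : V) : 0 <= nrm x.
Proof. by have := normr_ge0 x; rewrite nrmE lecR. Qed.

Lemma nrm0 V : nrm (0 : V) = 0.
Proof. by rewrite /nrm normr0. Qed.

Lemma nrm_le0 V (x : V) : nrm x <= 0 -> x = 0.
Proof. by rewrite -lecR -nrmE normr_le0 => /eqP. Qed.

Lemma nrm_gt0 V (x : V) : x != 0 -> 0 < nrm x.
Proof.
by move=> x0; rewrite lt_neqAle nrm_ge0 andbT; apply: contra_neq x0 => x0; apply: nrm_le0; rewrite -x0.
Qed.

Lemma nrmN V (x : V) : nrm (- x) = nrm x.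
Proof. by rewrite /nrm normrN. Qed.

Lemma nrmD V (x y : V) : nrm (x + y) <= nrm x + nrm y.
Proof. by rewrite -lecR rmorphD /= -!nrmE ler_normD. Qed.

Lemma nrmB V (x y : V) : nrm (x - y) <= nrm x + nrm y.
Proof. by rewrite -(nrmN y) nrmD. Qed.

Lemma nrmBC V (x y : V) : nrm (x - y) = nrm (y - x).
Proof. by rewrite -nrmN opprB. Qed.

Lemma nrm_tri V (y x z : V) : nrm (x - z) <= nrm (x - y) + nrm (y - z).
Proof. by rewrite (le_trans _ (nrmD _ _)) // addrA subrK. Qed.

Lemma nrmZ (V : normedModType R[i]) (k : R[i]) (x : V) :
  nrm (k *: x) = nrm k * nrm x.
Proof. by apply: complexI; rewrite rmorphM /= -!nrmE normrZ. Qed.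

Lemma nrmCM (k l : R[i]) : nrm (k * l) = nrm k * nrm l.
Proof. by apply: complexI; rewrite rmorphM /= -!nrmE normrM. Qed.

Lemma nrmCX (k : R[i]) n : nrm (k ^+ n) = nrm k ^+ n.
Proof. by apply: complexI; rewrite rmorphXn /= -!nrmE normrX. Qed.

Lemma nrmCV (k : R[i]) : nrm k^-1 = (nrm k)^-1.
Proof. by apply: complexI; rewrite fmorphV /= -!nrmE normfV. Qed.

Lemma nrmC1 : nrm (1 : R[i]) = 1.
Proof. by rewrite /nrm normr1. Qed.

Lemma nrmC_real (r : R) : nrm (r%:C%C : R[i]) = `|r|.
Proof. by rewrite /nrm normc_def /= expr0n addr0 sqrtr_sqr. Qed.

Lemma nrmC_sqr (z : R[i]) : nrm z ^+ 2 = complex.Re z ^+ 2 + complex.Im z ^+ 2.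
Proof. by apply: complexI; rewrite rmorphXn /= -nrmE add_Re2_Im2. Qed.

Lemma nrmC_conj (z : R[i]) : nrm (Num.conj z) = nrm z.
Proof. by rewrite /nrm norm_conjC. Qed.

Lemma nrmC_Re (z : R[i]) : `|complex.Re z| <= nrm z.
Proof. by rewrite -lecR -nrmE normc_ge_Re. Qed.

Lemma nrmC_Im (z : R[i]) : `|complex.Im z| <= nrm z.
Proof.
rewrite -[leLHS]ger0_norm // -(@ler_pXn2r _ 2) ?nnegrE ?nrm_ge0 //.
by rewrite nrmC_sqr !normr_id real_normK ?num_real // lerDr sqr_ge0.
Qed.

Lemma nrmC_le (z : R[i]) : nrm z <= `|complex.Re z| + `|complex.Im z|.
Proof.
rewrite {1}[z]complexE (le_trans (nrmD _ _)) // nrmCM !nrmC_real.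
by rewrite (_ : nrm 'i%C = 1) ?mul1r // /nrm normc_def /= expr0n add0r expr1n sqrtr1.
Qed.

Lemma conjC_real (r : R) : Num.conj (r%:C%C : R[i]) = r%:C%C.
Proof. by apply/CrealP/complex_realP; exists r. Qed.

Lemma nrm_cvgP (V : normedModType R[i]) (u : nat -> V) (l : V) :
  u @ \oo --> l <-> forall e : R, 0 < e -> exists N, forall n, (N <= n)%N -> nrm (l - u n) <= e.
Proof.
split=> [/cvgrPdist_lt ul e e0|ul].
  have e0' : 0 < e%:C%C :> R[i] by rewrite ltcR.
  have [N _ Nu] := ul _ e0'; exists N => n /Nu.
  by rewrite nrmE ltcR => /ltW.
apply/cvgrPdist_le => e e0.
have -> : e = (complex.Re e)%:C%C by rewrite RRe_real // gtr0_real.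
have re0 : 0 < complex.Re e by move: e0; rewrite ltcE => /andP[].
have [N Nu] := ul _ re0; exists N => // n /Nu.
by rewrite nrmE lecR.
Qed.

Lemma nrm_nbhsP (V : normedModType R[i]) (x : V) (B : set V) :
  nbhs x B <-> exists2 e : R, 0 < e & forall y, nrm (x - y) < e -> B y.
Proof.
split=> [/nbhs_ballP[e /= e0 eB]|[e e0 eB]].
  have E : e = (complex.Re e)%:C%C by rewrite RRe_real // gtr0_real.
  exists (complex.Re e); first by move: e0; rewrite ltcE => /andP[].
  by move=> y xy; apply: eB; rewrite -ball_normE /= E nrmE ltcR.
apply/nbhs_ballP; exists e%:C%C => /=; first by rewrite ltcR.
by move=> y; rewrite -ball_normE /= nrmE ltcR; exact: eB.
Qed.

Lemma geo_small (q e : R) : 0 <= q -> q < 1 -> 0 < e ->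
  exists N, forall n, (N <= n)%N -> q ^+ n <= e.
Proof.
move=> q0 q1 e0; have : (fun n => q ^+ n) @ \oo --> (0 : R).
  by apply: cvg_expr; rewrite ger0_norm.
move=> /cvgrPdist_le/(_ _ e0)[N _ Nq]; exists N => n /Nq.
by rewrite sub0r normrN ger0_norm // exprn_ge0.
Qed.

(** Roots of order [phi n] make the constants [c] and [D] disappear in the limit. In the uses, [phi]
    is the identity or [2 ^ n]. *)
Lemma geo_le (phi : nat -> nat) (c D t L : R) : (forall n, (n <= phi n)%N) ->
  0 < c -> 0 <= t -> 0 <= L ->
  (forall n, c * t ^+ phi n <= D * L ^+ phi n) -> t <= L.
Proof.
move=> phin c0 t0 L0 H; rewrite leNgt; apply/negP => Lt.
have tp : 0 < t by exact: le_lt_trans Lt.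
have D0 : 0 <= D.
  have := H 0%N; have [L00|Lp] := eqVneq L 0; last first.
    move=> HH; rewrite -(@pmulr_lge0 _ (L ^+ phi 0%N)).
      by apply: le_trans HH; rewrite mulr_ge0 ?exprn_ge0 // ltW.
    by rewrite exprn_gt0 // lt_neqAle eq_sym Lp.
  have := H 1%N; rewrite L00 expr0n; have := phin 1%N; case: (phi 1%N) => // m _ /=.
  by rewrite mulr0 leNgt mulr_gt0 // exprn_gt0.
have q0 : 0 <= L / t by rewrite divr_ge0.
have q1 : L / t < 1 by rewrite ltr_pdivrMr ?mul1r.
have e0 : 0 < c / (2 * (D + 1)) by rewrite divr_gt0 // mulr_gt0 // ltr_wpDl.
have [N HN] := geo_small q0 q1 e0.
have := HN _ (phin N); rewrite expr_div_n ler_pdivrMr ?exprn_gt0 // mulrAC ler_pdivlMr ?mulr_gt0 ?ltr_wpDl //.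
move=> HL; have := H N; have tN : 0 < t ^+ phi N by rewrite exprn_gt0.
have ct : 0 < c * t ^+ phi N by rewrite mulr_gt0.
have LN : 0 <= L ^+ phi N by rewrite exprn_ge0.
nra.
Qed.

Lemma geo_cauchy_cvg (V : completeNormedModType R[i]) (u : nat -> V) (c q : R) :
  0 <= q -> q < 1 -> (forall n, nrm (u n.+1 - u n) <= c * q ^+ n) ->
  exists l : V, u @ \oo --> l.
Proof.
move=> q0 q1 uq; have q1' : 0 < 1 - q by rewrite subr_gt0.
have c0 : 0 <= c by have := uq 0%N; rewrite expr0 mulr1; apply: le_trans; exact: nrm_ge0.
have dist n k : nrm (u (n + k)%N - u n) <= c / (1 - q) * q ^+ n.
  have : nrm (u (n + k)%N - u n) <= c * q ^+ n * ((1 - q ^+ k) / (1 - q)).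
    elim: k => [|k IH]; first by rewrite addn0 subrr nrm0 expr0 subrr mul0r mulr0.
    rewrite addnS (le_trans (nrm_tri (u (n + k)%N) _ _)) //.
    apply: (le_trans (lerD (uq _) IH)); rewrite exprD exprS le_eqVlt; apply/orP; left; apply/eqP.
    by field; rewrite gt_eqF.
  move=> /le_trans; apply; rewrite [leRHS]mulrAC.
  apply: ler_wpM2l; first by rewrite mulr_ge0 // exprn_ge0.
  by rewrite ler_pdivrMr // mulVf ?gt_eqF // lerBlDr lerDl exprn_ge0.
suff : cvg (u @ \oo) by move=> /cvg_ex.
apply/cauchy_cvgP/cauchyP => e e0.
have E : e = (complex.Re e)%:C%C by rewrite RRe_real // gtr0_real.
have re0 : 0 < complex.Re e by move: e0; rewrite ltcE => /andP[].
have e1 : 0 < complex.Re e / (c / (1 - q) + 1) / 2.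
  by rewrite !divr_gt0 // ltr_wpDl // divr_ge0 // ltW.
have [N HN] := geo_small q0 q1 e1.
exists (u N); exists N => // n /= Nn; rewrite -ball_normE /= E nrmE ltcR nrmBC -(subnKC Nn).
apply: (le_lt_trans (dist _ _)); have := HN N (leqnn _).
have cq : 0 <= c / (1 - q) by rewrite divr_ge0 // ltW.
move: cq; set d := c / (1 - q) => d0 HqN.
have d1 : 0 < d + 1 by rewrite ltr_wpDl.
rewrite (@le_lt_trans _ _ (d * (complex.Re e / (d + 1) / 2))) ?ler_wpM2l //.
have w0 : 0 < complex.Re e / (d + 1) by rewrite divr_gt0.
have wE : complex.Re e / (d + 1) * (d + 1) = complex.Re e by rewrite divfK ?gt_eqF.
move: w0 wE; set w := _ / (d + 1) => w0 wE; have dw : 0 <= d * w by rewrite mulr_ge0 // ltW.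
rewrite -wE; lra.
Qed.

Lemma cauchy_cvg_seq (V : completeNormedModType R[i]) (u : nat -> V) :
  (forall m n, nrm (u m - u n) <= m.+1%:R^-1 + n.+1%:R^-1) ->
  exists l : V, u @ \oo --> l.
Proof.
move=> H; suff : cvg (u @ \oo) by move=> /cvg_ex.
apply/cauchy_cvgP/cauchyP => e e0.
have E : e = (complex.Re e)%:C%C by rewrite RRe_real // gtr0_real.
have re0 : 0 < complex.Re e by move: e0; rewrite ltcE => /andP[].
have e1 : 0 < complex.Re e / 2 by rewrite divr_gt0.
have [N HN] : exists N, N.+1%:R^-1 < complex.Re e / 2.
  have [N _ HN] := @cvg_harmonic R [set x | x < complex.Re e / 2] (lt_nbhsl e1).
  by exists N; apply: HN => /=.
exists (u N); exists N => // n /= Nn; rewrite -ball_normE /= E nrmE ltcR.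
apply: (le_lt_trans (H _ _)); rewrite [ltRHS]splitr ltr_leD //.
by apply: le_trans (ltW HN); rewrite lef_pV2 ?posrE // ler_nat.
Qed.

End nrm.

(** * Unitization *)

Section cstar_basics.
Context {R : realType} {A : cstarAlgType R}.
Implicit Types (a b x y z : A) (k l : R[i]).

Lemma cmul0l x : 0 ⋅ x = 0.
Proof. by apply: (@addrI _ (0 ⋅ x)); rewrite -cmulDl !addr0. Qed.

Lemma cmul0r x : x ⋅ 0 = 0.
Proof. by apply: (@addrI _ (x ⋅ 0)); rewrite -cmulDr !addr0. Qed.

Lemma cmulNl x y : (- x) ⋅ y = - (x ⋅ y).
Proof. by apply/eqP; rewrite -addr_eq0 -cmulDl addNr cmul0l. Qed.

Lemma cmulNr x y : x ⋅ (- y) = - (x ⋅ y).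
Proof. by apply/eqP; rewrite -addr_eq0 -cmulDr addNr cmul0r. Qed.

Lemma cmulBl x y z : (x - y) ⋅ z = x ⋅ z - y ⋅ z.
Proof. by rewrite cmulDl cmulNl. Qed.

Lemma cmulBr x y z : x ⋅ (y - z) = x ⋅ y - x ⋅ z.
Proof. by rewrite cmulDr cmulNr. Qed.

Lemma cstar0 : 0^⋆ = 0 :> A.
Proof. by apply: (@addrI _ (0^⋆)); rewrite -cstarD !addr0. Qed.

Lemma cstarN x : (- x)^⋆ = - x^⋆.
Proof. by apply/eqP; rewrite -addr_eq0 -cstarD addNr cstar0. Qed.

Lemma cstarB x y : (x - y)^⋆ = x^⋆ - y^⋆.
Proof. by rewrite cstarD cstarN. Qed.

Lemma nrmM x y : nrm (x ⋅ y) <= nrm x * nrm y.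
Proof. by rewrite -lecR rmorphM /= -!nrmE cnormM. Qed.

Lemma nrm_starM x : nrm (x^⋆ ⋅ x) = nrm x ^+ 2.
Proof. by apply: complexI; rewrite rmorphXn /= -!nrmE cnorm_star. Qed.

Lemma nrm_star x : nrm x^⋆ = nrm x.
Proof.
suff H y : nrm y <= nrm y^⋆ by apply/eqP; rewrite eq_le H -{2}[x]cstarK H.
have [->|y0] := eqVneq y 0; first by rewrite cstar0.
have := nrm_gt0 y0; rewrite -(ler_pM2r (nrm_gt0 y0)) => _.
by rewrite -expr2 -nrm_starM nrmM.
Qed.

Lemma nrm_Mstar x : nrm (x ⋅ x^⋆) = nrm x ^+ 2.
Proof. by rewrite -{1}[x]cstarK nrm_starM nrm_star. Qed.

Lemma starM_eq0 x : x^⋆ ⋅ x = 0 -> x = 0.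
Proof.
move=> x0; apply: nrm_le0; have := nrm_starM x; rewrite x0 nrm0 => /esym/eqP.
by rewrite sqrf_eq0 => /eqP ->.
Qed.

(* Only the ring structure of the unitization is used: it is given no norm. *)
Definition unitization : Type := (A * R[i]^o)%type.
End cstar_basics.
Arguments unitization {R} A.

HB.instance Definition _ (R : realType) (A : cstarAlgType R) :=
  GRing.Lmodule.copy (unitization A) (A * R[i]^o)%type.

Section unitization_ring.
Context {R : realType} {A : cstarAlgType R}.
Local Notation U := (unitization A).
Implicit Types (u v w : U) (x y : A) (k : R[i]).

Lemma uaddE u v : u + v = (u.1 + v.1, u.2 + v.2). Proof. by []. Qed.
Lemma uoppE u : - u = (- u.1, - u.2). Proof. by []. Qed.
Lemma uscaleE k u : k *: u = (k *: u.1, k * u.2). Proof. by []. Qed.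

Definition umul u v : U :=
  (u.1 ⋅ v.1 + u.2 *: v.1 + v.2 *: u.1, u.2 * v.2).
Definition uone : U := (0, 1).

Lemma umulA : associative umul.
Proof.
move=> [x k] [y l] [z m]; rewrite /umul /=; congr pair; last by rewrite mulrA.
rewrite !(cmulDl, cmulDr, cmulZl, cmulZr, scalerDr, scalerA, cmulA) -!addrA.
congr (_ + _); rewrite [m * k]mulrC [m * l]mulrC.
by rewrite [RHS]addrCA; congr (_ + _); rewrite addrCA; congr (_ + _); rewrite addrCA.
Qed.
Lemma umul1l : left_id uone umul.
Proof. by move=> [x k]; rewrite /umul /= cmul0l scale1r scaler0 add0r addr0 mul1r. Qed.
Lemma umul1r : right_id uone umul.
Proof. by move=> [x k]; rewrite /umul /= cmul0r scale1r scaler0 !add0r mulr1. Qed.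
Lemma umulDl : left_distributive umul +%R.
Proof.
move=> [x k] [y l] [z m]; rewrite /umul /=; congr pair; last by rewrite mulrDl.
by rewrite cmulDl scalerDr scalerDl [RHS]addrACA; congr (_ + _); rewrite addrACA.
Qed.
Lemma umulDr : right_distributive umul +%R.
Proof.
move=> [x k] [y l] [z m]; rewrite /umul /=; congr pair; last by rewrite mulrDr.
by rewrite cmulDr scalerDr scalerDl [RHS]addrACA; congr (_ + _); rewrite addrACA.
Qed.
Lemma uone_neq0 : uone != 0.
Proof. by apply/eqP => -[/eqP]; rewrite oner_eq0. Qed.

HB.instance Definition _ := GRing.Zmodule_isNzRing.Build U
  umulA umul1l umul1r umulDl umulDr uone_neq0.

Lemma uscaleAl (k : R[i]) u v : k *: (u * v) = (k *: u) * v.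
Proof.
case: u v => [x l] [y m]; rewrite !uscaleE [_ * _]/(umul _ _) [RHS]/(umul _ _) /umul /=.
congr pair; last by rewrite mulrA.
by rewrite !scalerDr cmulZl !scalerA [m * k]mulrC.
Qed.
HB.instance Definition _ := GRing.Lmodule_isLalgebra.Build R[i] U uscaleAl.

Lemma uscaleAr (k : R[i]) u v : k *: (u * v) = u * (k *: v).
Proof.
case: u v => [x l] [y m]; rewrite !uscaleE [_ * _]/(umul _ _) [RHS]/(umul _ _) /umul /=.
congr pair; last by rewrite mulrCA.
by rewrite !scalerDr cmulZr !scalerA [k * l]mulrC.
Qed.
HB.instance Definition _ := GRing.Lalgebra_isAlgebra.Build R[i] U uscaleAr.

Definition uinj x : U := (x, 0).

Lemma uinjD x y : uinj (x + y) = uinj x + uinj y.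
Proof. by rewrite uaddE /= addr0. Qed.
Lemma uinjN x : uinj (- x) = - uinj x.
Proof. by rewrite uoppE /= oppr0. Qed.
Lemma uinjB x y : uinj (x - y) = uinj x - uinj y.
Proof. by rewrite uinjD uinjN. Qed.
Lemma uinjZ k x : uinj (k *: x) = k *: uinj x.
Proof. by rewrite uscaleE /= mulr0. Qed.
Lemma uinjM x y : uinj (x ⋅ y) = uinj x * uinj y.
Proof. by rewrite /uinj [RHS]/GRing.mul /= /umul /= !scale0r !addr0 mulr0. Qed.
Lemma uinj0 : uinj 0 = 0. Proof. by []. Qed.
Lemma uinj_inj x y : uinj x = uinj y -> x = y.
Proof. by case. Qed.

Lemma uE u : u = uinj u.1 + u.2%:A.
Proof.
case: u => x k; rewrite uaddE uscaleE /= scaler0 addr0 add0r.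
by congr pair; rewrite mulr1.
Qed.

Lemma u2M u v : (u * v).2 = u.2 * v.2. Proof. by []. Qed.
Lemma u21 : (1 : U).2 = 1. Proof. by []. Qed.

Definition uinv u := exists v, u * v = 1 /\ v * u = 1.

Lemma uinv_M u v : uinv u -> uinv v -> uinv (u * v).
Proof.
move=> [u' [uu' u'u]] [v' [vv' v'v]]; exists (v' * u'); split.
  by rewrite mulrA -(mulrA u) vv' mulr1.
by rewrite mulrA -(mulrA v') u'u mulr1.
Qed.

Lemma uinv1 : uinv 1.
Proof. by exists 1; rewrite mulr1. Qed.

Lemma uinv_Z k u : k != 0 -> uinv u -> uinv (k *: u).
Proof.
move=> k0 [v [uv vu]]; exists (k^-1 *: v); split.
  by rewrite -uscaleAl -uscaleAr scalerA divff // scale1r.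
by rewrite -uscaleAl -uscaleAr scalerA mulVf // scale1r.
Qed.

Lemma uinv_Zr k u : k != 0 -> uinv (k *: u) <-> uinv u.
Proof.
move=> k0; split=> [|/(uinv_Z k0)//] /(@uinv_Z k^-1).
by rewrite invr_eq0 scalerA mulVf // scale1r; apply.
Qed.

Lemma uinv_comm_Ml u v : u * v = v * u -> uinv (u * v) -> uinv u.
Proof.
move=> uv [w [uvw wuv]]; exists (v * w); split; first by rewrite mulrA.
have -> : v * w = w * v; last by rewrite -mulrA -uv.
rewrite -[LHS]mul1r -{1}wuv {1}uv -[RHS]mulr1 -{1}uvw !mulrA //.
Qed.

(** Jacobson's formula: if [w] inverts [1 - u * v], then [1 + v * w * u] inverts [1 - v * u]. *)
Lemma uinv_1B u v : uinv (1 - u * v) -> uinv (1 - v * u).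
Proof.
move=> [w [H1 H2]]; exists (1 + v * w * u).
have E1 : u * v * w = w - 1 by rewrite -[in RHS]H1 mulrBl mul1r opprB addrC subrK.
have E2 : w * (u * v) = w - 1 by rewrite -[in RHS]H2 mulrBr mulr1 opprB addrC subrK.
split.
  rewrite mulrBl mul1r mulrDr mulr1 -!mulrA (mulrA u) (mulrA (u * v)) E1.
  by rewrite mulrBl mul1r mulrBr [v * u + _]addrC subrK addrK.
rewrite mulrBr mulr1 mulrDl mul1r -!mulrA (mulrA u v u) (mulrA w) E2.
by rewrite mulrBl mul1r mulrBr [v * u + _]addrC subrK addrK.
Qed.

Lemma qinvE x y : x + y - x ⋅ y = 0 <-> (1 - uinj x) * (1 - uinj y) = 1.
Proof.
have -> : (1 - uinj x) * (1 - uinj y) = 1 - uinj (x + y - x ⋅ y).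
  rewrite uinjB uinjD uinjM mulrBl mul1r mulrBr mulr1.
  by rewrite -addrA -opprD addrA [uinj y + _]addrC.
split=> [->|/eqP]; first by rewrite subr0.
by rewrite -subr_eq0 addrAC subrr sub0r oppr_eq0 => /eqP/uinj_inj.
Qed.

Definition qinv x y :=
  (1 - uinj x) * (1 - uinj y) = 1 /\ (1 - uinj y) * (1 - uinj x) = 1.

Lemma quasi_invertibleP x : quasi_invertible x <-> exists y, qinv x y.
Proof.
split=> -[y [xy yx]]; exists y.
  by split; apply/qinvE => //; rewrite addrC addrC [y + x]addrC.
by split; [exact/qinvE|rewrite [x + y]addrC; exact/qinvE].
Qed.

(** Scalar components multiply, so an inverse of [1 - uinj x] has scalar component 1 and is again of
    the form [1 - uinj y]. *)
Lemma uinv_qinv x : uinv (1 - uinj x) <-> exists y, qinv x y.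
Proof.
split=> [[v [xv vx]]|[y [xy yx]]]; last by exists (1 - uinj y).
have v2 : v.2 = 1 by have := congr1 snd xv; rewrite u2M /= oppr0 addr0 mul1r.
have vE : v = 1 - uinj (- v.1).
  by rewrite [LHS]uE v2 scale1r uinjN opprK addrC.
by exists (- v.1); split; rewrite -vE.
Qed.

Lemma qinv_eq x y : qinv x y -> x + y = x ⋅ y.
Proof. by move=> [/qinvE/eqP]; rewrite subr_eq0 => /eqP. Qed.

Lemma uinv_nz u : uinv u -> u.2 != 0.
Proof.
move=> [v [uv _]]; apply/eqP => u0; have := congr1 snd uv.
by rewrite u2M u0 mul0r u21 => /esym/eqP; rewrite oner_eq0.
Qed.

(** At [z = 0] both sides hold, since an element of [A] has scalar component 0 and is never
    invertible in the unitization; elsewhere the factor [- z] can be pulled out. *)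
Lemma spectrumP a z : quasi_spectrum a z <-> ~ uinv (uinj a - z%:A).
Proof.
have [->|z0] := eqVneq z 0.
  split=> [_ /uinv_nz|_]; last by left.
  by rewrite /= scale0r oppr0 addr0 eqxx.
have E : uinj a - z%:A = (- z) *: (1 - uinj (z^-1 *: a)).
  by rewrite scalerBr uinjZ scalerA mulNr divff // !scaleNr opprK scale1r addrC.
have zN : - z != 0 by rewrite oppr_eq0.
split=> [[/eqP|[_ nq]]|nu]; first by rewrite (negbTE z0).
  by rewrite E => /(uinv_Zr _ zN)/uinv_qinv/quasi_invertibleP.
right; split=> // /quasi_invertibleP/uinv_qinv => H; apply: nu.
by rewrite E; apply/(uinv_Zr _ zN).
Qed.

Lemma spectrum0 (a : A) : quasi_spectrum a 0.
Proof. by left. Qed.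

Lemma quasi_inverse_nrm x y : qinv x y ->
  nrm y * (1 - nrm x) <= nrm x.
Proof.
move=> /qinv_eq xy; have -> : nrm y * (1 - nrm x) = nrm y - nrm x * nrm y.
  by rewrite mulrBr mulr1 [nrm y * _]mulrC.
have E : nrm y = nrm (x ⋅ y - x) by rewrite -xy addrAC subrr add0r.
by rewrite lerBlDr {1}E (le_trans (nrmB _ _)) // addrC lerD2l nrmM.
Qed.

(** The partial sums x + x^2 + ... + x^n of the geometric series, in Horner form. The quasi-inverse
    of [x] is minus their limit. *)
Fixpoint neumann x n := if n is m.+1 then x + x ⋅ neumann x m else 0.

Lemma cmul_cvgr x (f : nat -> A) l :
  f @ \oo --> l -> (fun n => x ⋅ f n) @ \oo --> x ⋅ l.
Proof.
move=> /nrm_cvgP fl; apply/nrm_cvgP => e e0.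
have x1 : 0 < nrm x + 1 by rewrite ltr_wpDl ?nrm_ge0.
have [N HN] := fl _ (divr_gt0 e0 x1); exists N => n Nn.
rewrite -cmulBr (le_trans (nrmM _ _)) //.
have := HN n Nn; rewrite ler_pdivlMr //; have := nrm_ge0 x; have := nrm_ge0 (l - f n).
nra.
Qed.

Lemma star_cvg (f : nat -> A) l :
  f @ \oo --> l -> (fun n => (f n)^⋆) @ \oo --> l^⋆.
Proof.
move=> /nrm_cvgP fl; apply/nrm_cvgP => e e0.
have [N HN] := fl _ e0; exists N => n Nn.
by rewrite -cstarB nrm_star HN.
Qed.

Lemma cmul_cvgl x (f : nat -> A) l :
  f @ \oo --> l -> (fun n => f n ⋅ x) @ \oo --> l ⋅ x.
Proof.
move=> /star_cvg/(@cmul_cvgr x^⋆)/star_cvg.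
rewrite cstarM !cstarK; apply: cvg_trans; apply: near_eq_cvg.
by near=> n; rewrite cstarM !cstarK.
Unshelve. all: end_near. Qed.

Lemma neumann_cvg x : nrm x < 1 -> exists y, qinv x y.
Proof.
move=> x1; have x0 := nrm_ge0 x.
have stepD n : neumann x n.+2 - neumann x n.+1 = x ⋅ (neumann x n.+1 - neumann x n).
  by rewrite /= -/(neumann x n) cmulBr opprD addrACA subrr add0r.
have comm n : x ⋅ neumann x n = neumann x n ⋅ x.
  by elim: n => [|n IH] /=; rewrite ?cmul0l ?cmul0r // cmulDr cmulDl -cmulA IH.
have [|l Hl] := @geo_cauchy_cvg _ A (neumann x) (nrm x) (nrm x) x0 x1.
  elim=> [|n IH]; first by rewrite /= cmul0r addr0 subr0 expr0 mulr1.
  rewrite stepD (le_trans (nrmM _ _)) // exprS; apply: ler_wpM2l => //.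
have Hl1 : (fun n => neumann x n.+1) @ \oo --> l by rewrite -cvg_shiftS in Hl.
have lE : l = x + x ⋅ l.
  apply: (cvg_unique _ Hl1); first exact: norm_hausdorff.
  by rewrite /=; apply: cvgD; [exact: cvg_cst|exact: cmul_cvgr].
have lx : x ⋅ l = l ⋅ x.
  have := @cmul_cvgr x _ _ Hl; rewrite (_ : (fun n => _) = (fun n => neumann x n ⋅ x)).
    by move=> /(cvg_unique (@norm_hausdorff _ _)); apply; exact: cmul_cvgl.
  exact/funext.
exists (- l); split; apply/qinvE.
  by rewrite cmulNr opprK addrAC -lE subrr.
by rewrite cmulNl opprK -lx -addrA -lE addNr.
Qed.

(** With [c = (1 - y0) a], one has [1 - l a = (1 - l0 a) (1 - (l - l0) c)], and a Neumann series
    inverts the second factor. The norm bound makes the resolvent locally bounded, which compactness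
    of the disc later turns into a uniform bound. *)
Lemma qinv_local (a y0 : A) (l0 : R[i]) : qinv (l0 *: a) y0 ->
  exists2 d : R, 0 < d & forall l : R[i], nrm (l - l0) < d ->
    exists2 y, qinv (l *: a) y & nrm y <= 1 + 2 * nrm y0.
Proof.
move=> [H1 H2]; set c := a - y0 ⋅ a.
have c1 : 0 < nrm c + 1 by rewrite ltr_wpDl ?nrm_ge0.
(* This radius keeps [(l - l0) c] of norm at most 1/2, so that its quasi-inverse [w] has norm at
   most 1. *)
exists (2^-1 / (nrm c + 1)); first by rewrite divr_gt0.
move=> l ld.
have nc : nrm ((l - l0) *: c) <= 2^-1.
  rewrite nrmZ; move: ld; rewrite ltr_pdivlMr //.
  have := nrm_ge0 c; have := nrm_ge0 (l - l0); nra.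
have [|w qw] := @neumann_cvg ((l - l0) *: c); first lra.
have w1 : nrm w <= 1.
  have := quasi_inverse_nrm qw; have := nrm_ge0 w; have := nrm_ge0 ((l - l0) *: c); nra.
case: qw => w1' w2'.
have E : 1 - uinj (l *: a) = (1 - uinj (l0 *: a)) * (1 - uinj ((l - l0) *: c)).
  have -> : uinj ((l - l0) *: c) = (1 - uinj y0) * uinj ((l - l0) *: a).
    by rewrite mulrBl mul1r -uinjM -uinjB cmulZr -scalerBr.
  by rewrite mulrBr mulr1 mulrA H1 mul1r -addrA -opprD -uinjD -scalerDl [l0 + _]addrC subrK.
have E' : (1 - uinj w) * (1 - uinj y0) = 1 - uinj (w + y0 - w ⋅ y0).
  rewrite uinjB uinjD uinjM mulrBl mul1r mulrBr mulr1.
  by rewrite -addrA -opprD addrA [uinj y0 + _]addrC.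
exists (w + y0 - w ⋅ y0).
  rewrite /qinv -E' E; split.
    by rewrite mulrA -(mulrA (1 - uinj (l0 *: a))) w1' mulr1.
  by rewrite mulrA -(mulrA (1 - uinj w)) H2 mulr1.
apply: (le_trans (nrmB _ _)); apply: (le_trans (lerD (nrmD _ _) (nrmM _ _))).
have := nrm_ge0 y0; have := nrm_ge0 w; nra.
Qed.

End unitization_ring.

(** * Polynomial calculus and the spectral radius *)

Section polynomial_calculus.
Context {R : realType} {A : cstarAlgType R}.
Local Notation U := (unitization A).
Implicit Types (u v w : U) (a x y : A) (k l z : R[i]) (p q : {poly R[i]}).

Definition pev a p : U := locked (horner_alg (uinj a : U)) p.
Definition pa a p : A := (pev a p).1.

Lemma pevD a p q : pev a (p + q) = pev a p + pev a q. Proof. by rewrite /pev -lock rmorphD. Qed.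
Lemma pevB a p q : pev a (p - q) = pev a p - pev a q. Proof. by rewrite /pev -lock rmorphB. Qed.
Lemma pevM a p q : pev a (p * q) = pev a p * pev a q. Proof. by rewrite /pev -lock rmorphM. Qed.
Lemma pevX a p n : pev a (p ^+ n) = pev a p ^+ n. Proof. by rewrite /pev -lock rmorphXn. Qed.
Lemma pevC a k : pev a k%:P = k%:A. Proof. by rewrite /pev -lock horner_algC. Qed.
Lemma pevZ a k p : pev a (k *: p) = k *: pev a p.
Proof. by rewrite -mul_polyC pevM pevC -scalerAl mul1r. Qed.
Lemma pev_id a : pev a 'X = uinj a. Proof. by rewrite /pev -lock horner_algX. Qed.
Lemma pev0 a : pev a 0 = 0. Proof. by rewrite /pev -lock rmorph0. Qed.
Lemma pev1 a : pev a 1 = 1. Proof. by rewrite /pev -lock rmorph1. Qed.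

Lemma pev2 a p : (pev a p).2 = p.[0].
Proof.
elim/poly_ind: p => [|p c IH]; first by rewrite pev0 horner0.
rewrite pevD pevM pev_id pevC uaddE u2M IH !hornerE /=.
exact: mulr1.
Qed.

Lemma pevE a p : p.[0] = 0 -> pev a p = uinj (pa a p).
Proof. by move=> p0; rewrite [LHS]uE pev2 p0 scale0r addr0. Qed.

Lemma paD a p q : pa a (p + q) = pa a p + pa a q.
Proof. by rewrite /pa pevD. Qed.
Lemma paB a p q : pa a (p - q) = pa a p - pa a q.
Proof. by rewrite /pa pevB. Qed.
Lemma paZ a k p : pa a (k *: p) = k *: pa a p.
Proof. by rewrite /pa pevZ. Qed.
Lemma paX a : pa a 'X = a.
Proof. by rewrite /pa pev_id. Qed.
Lemma paM a p q : p.[0] = 0 -> q.[0] = 0 -> pa a (p * q) = pa a p ⋅ pa a q.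
Proof.
move=> p0 q0; have pq0 : (p * q).[0] = 0 by rewrite hornerM p0 mul0r.
by apply: uinj_inj; rewrite uinjM -(pevE a p0) -(pevE a q0) -(pevE a pq0) pevM.
Qed.

(** The element p(z) - p(a) is divisible by z - a. If |p(z)| exceeded |p(a)|, a Neumann series would
    invert it, and then z - a as well. *)
Lemma spectrum_nrm_le a p z : quasi_spectrum a z -> p.[0] = 0 ->
  nrm p.[z] <= nrm (pa a p).
Proof.
move=> az p0; rewrite leNgt; apply/negP => pz.
have [pz0|pz0] := eqVneq p.[z] 0.
  by move: pz; rewrite pz0 nrm0 ltNge nrm_ge0.
move/spectrumP: az; apply.
have /factor_theorem[q Eq] : root (p.[z]%:P - p) z.
  by rewrite rootE !hornerE subrr.
have H : uinv (pev a ('X - z%:P) * pev a q).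
  rewrite -pevM mulrC -Eq pevB pevC pevE //.
  have -> : (p.[z])%:A - uinj (pa a p) = p.[z] *: (1 - uinj ((p.[z])^-1 *: pa a p)).
    by rewrite scalerBr uinjZ scalerA divff // scale1r.
  apply/(uinv_Zr _ pz0)/uinv_qinv/neumann_cvg.
  by rewrite nrmZ nrmCV mulrC ltr_pdivrMr ?mul1r // nrm_gt0.
have := uinv_comm_Ml _ H; rewrite pevB pev_id pevC; apply.
by rewrite -(pev_id a) -(pevC a) -pevB -pevM mulrC pevM.
Qed.

Lemma uinv_prod a (s : seq R[i]) :
  (forall r, r \in s -> ~ quasi_spectrum a r) ->
  uinv (pev a (\prod_(r <- s) ('X - r%:P))).
Proof.
elim: s => [|r s IH] H; first by rewrite big_nil pev1; exact: uinv1.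
rewrite big_cons pevM; apply: uinv_M; last first.
  by apply: IH => r' r's; apply: H; rewrite inE r's orbT.
rewrite pevB pev_id pevC; apply: contrapT => /spectrumP.
by apply: H; rewrite inE eqxx.
Qed.

(** Over the algebraically closed field [R[i]], p - z splits into linear factors; if no root were in
    the spectrum of [a], all factors and their product would be invertible at [a]. *)
Lemma spectrum_poly a p z : p.[0] = 0 -> quasi_spectrum (pa a p) z ->
  exists2 w, quasi_spectrum a w & p.[w] = z.
Proof.
move=> p0 /spectrumP pz; have [r0|r0] := eqVneq (p - z%:P) 0.
  exists 0; first exact: spectrum0.
  have := congr1 (horner^~ 0) r0; rewrite /= !hornerE p0 sub0r => /eqP.
  by rewrite oppr_eq0 => /eqP ->.
have [s Es] := closed_field_poly_normal (p - z%:P).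
apply: contrapT => nw; apply: pz.
rewrite -(pevE a p0) -(pevC a) -pevB Es pevZ; apply: uinv_Z; first by rewrite lead_coef_eq0.
apply: uinv_prod => r rs ar; apply: nw; exists r => //.
have : root (p - z%:P) r.
  by rewrite Es rootZ ?lead_coef_eq0 // root_prod_XsubC.
by rewrite rootE !hornerE subr_eq0 => /eqP.
Qed.

(* [z (k + z)^n] is in the spectrum of [a (k + a)^n], of norm at most
   [L^n |a|]. *)
Lemma spectrum_opnorm k a (L : R) z : 0 <= L ->
  (forall x, nrm (k *: x + a ⋅ x) <= L * nrm x) ->
  quasi_spectrum a z -> z != 0 -> nrm (k + z) <= L.
Proof.
move=> L0 H az z0.
apply: (@geo_le _ id (nrm z) (nrm a)) => //; rewrite ?nrm_gt0 ?nrm_ge0 // => n.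
have p0 : ((k%:P + 'X) ^+ n * 'X).[0] = 0 by rewrite hornerM hornerX mulr0.
have pz : ((k%:P + 'X) ^+ n * 'X).[z] = z * (k + z) ^+ n.
  by rewrite mulrC hornerM hornerX horner_exp hornerD hornerC hornerX.
have := spectrum_nrm_le az p0; rewrite pz nrmCM nrmCX => /le_trans; apply.
have -> : pa a ((k%:P + 'X) ^+ n * 'X) = iter n (fun x => k *: x + a ⋅ x) a.
  apply: uinj_inj; rewrite -(pevE _ p0).
  rewrite pevM pev_id pevX pevD pevC pev_id; clear p0 pz.
  elim: n => [|n IH]; first by rewrite mul1r.
  by rewrite iterS exprS -mulrA IH mulrDl uinjD uinjZ uinjM -scalerAl mul1r.
elim: n {p0 pz} => [|n IH]; first by rewrite expr0 mulr1.
by rewrite iterS (le_trans (H _)) // exprS mulrCA ler_wpM2l.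
Qed.

(* Arens' trick: [|i t + z|^2 <= |a|^2 + t^2] for all real [t]. *)
Lemma spectrum_real a z : a^⋆ = a -> quasi_spectrum a z -> complex.Im z = 0.
Proof.
move=> sa az; have [->//|z0] := eqVneq z 0.
have H (t : R) : nrm ('i%C * t%:C%C + z) ^+ 2 <= nrm a ^+ 2 + t ^+ 2.
  have rt : 0 <= nrm a ^+ 2 + t ^+ 2 by rewrite addr_ge0 ?sqr_ge0.
  rewrite -(sqr_sqrtr rt) ler_pXn2r ?nnegrE ?nrm_ge0 ?sqrtr_ge0 //.
  apply: (@spectrum_opnorm _ a) => // x.
  rewrite -(@ler_pXn2r _ 2) ?nnegrE ?nrm_ge0 ?mulr_ge0 ?sqrtr_ge0 ?nrm_ge0 //.
  rewrite exprMn sqr_sqrtr //.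
  set k := 'i%C * t%:C%C; rewrite -(nrm_starM (k *: x + a ⋅ x)).
  have kc : Num.conj k = - k by rewrite /k /Num.conj; simpc.
  (* As [k] is purely imaginary and [a] self-adjoint, the cross terms cancel. *)
  have -> : (k *: x + a ⋅ x)^⋆ ⋅ (k *: x + a ⋅ x) =
      x^⋆ ⋅ a ⋅ (a ⋅ x) + (t ^+ 2)%:C%C *: (x^⋆ ⋅ x).
    rewrite cstarD cstarM cstarZ sa kc cmulDl !cmulDr !(cmulZl, cmulZr) scalerA.
    have -> : - k * k = (t ^+ 2)%:C%C by rewrite /k; simpc; rewrite expr2.
    rewrite -!cmulA -addrA [- k *: _ + _]addrA -scalerDl addNr scale0r add0r addrC.
    by [].
  rewrite mulrDl (le_trans (nrmD _ _)) // lerD //.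
    have -> : x^⋆ ⋅ a ⋅ (a ⋅ x) = (a ⋅ x)^⋆ ⋅ (a ⋅ x) by rewrite cstarM sa.
    rewrite nrm_starM -exprMn ler_pXn2r ?nnegrE ?nrm_ge0 ?mulr_ge0 ?nrm_ge0 //.
    exact: nrmM.
  by rewrite nrmZ nrm_starM nrmC_real ger0_norm ?sqr_ge0.
have H2 (t : R) : 2 * t * complex.Im z <= nrm a ^+ 2.
  have := H t; rewrite nrmC_sqr; case: z {az z0 H} => s r; simpc => /=.
  have := sqr_ge0 s; have := sqr_ge0 r; nra.
(* For Im z nonzero, this [t] turns the left side of [H2] into |a|^2 + 1, a contradiction. *)
have := H2 ((nrm a ^+ 2 + 1) / (2 * complex.Im z)); apply: contra_leP => /eqP i0.
have -> : 2 * ((nrm a ^+ 2 + 1) / (2 * complex.Im z)) * complex.Im z = nrm a ^+ 2 + 1.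
  by field.
by rewrite ltrDl.
Qed.

(** Compactness is applied to the square [-1, 1]^2, a product of real segments. Its points outside
    the disc have a neighbourhood that misses the disc, where any bound will do. *)
Lemma disc_bounded (P : R[i] -> R -> Prop) :
  (forall z K K', K <= K' -> P z K -> P z K') ->
  (forall z, nrm z <= 1 -> exists2 d : R, 0 < d &
     exists K, forall z', nrm (z' - z) < d -> P z' K) ->
  exists K, forall z, nrm z <= 1 -> P z K.
Proof.
move=> Pmono Ploc.
pose S := `[(-1 : R), 1]%classic `*` `[(-1 : R), 1]%classic.
have cS : compact S by apply: compact_setX; exact: segment_compact.
suff [K HK] : exists K, S `<=` (fun st => nrm (st.1 +i* st.2)%C <= 1 -> P (st.1 +i* st.2)%C K).
  exists K => z z1; have := HK (complex.Re z, complex.Im z).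
  case: z z1 => s t st1 /=; apply => //; split; rewrite /= in_itv /= -ler_norml.
    by apply: le_trans st1; exact: (nrmC_Re (s +i* t)%C).
  by apply: le_trans st1; exact: (nrmC_Im (s +i* t)%C).
have : \forall K \near +oo, S `<=`
  (fun st => nrm (st.1 +i* st.2)%C <= 1 -> P (st.1 +i* st.2)%C K).
  apply: (compact_near_coveringP S).1 => // -[s t] _.
  have [d d0 [K HK]] : exists2 d : R, 0 < d & exists K, forall z,
      nrm (z - (s +i* t)%C) < d -> nrm z <= 1 -> P z K.
    have [st1|st1] := leP (nrm (s +i* t)%C) 1.
      have [d d0 [K HK]] := Ploc _ st1; exists d => //; exists K => w wd _.
      exact: HK.
    exists (nrm (s +i* t)%C - 1); first by rewrite subr_gt0.
    exists 0 => w wd w1; exfalso; have := nrm_tri w (s +i* t)%C 0.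
    rewrite !subr0 nrmBC; move: (nrm (w - _)) wd w1 => c; lra.
  have d2 : 0 < d / 2 by rewrite divr_gt0.
  exists ([set st | ball s (d / 2) st.1 /\ ball t (d / 2) st.2], [set K' | K <= K']).
    split => /=; last by apply: nbhs_pinfty_ge; rewrite num_real.
    by exists (ball s (d / 2), ball t (d / 2)) => //=; split; exact: nbhsx_ballx.
  move=> [[s' t'] K'] /= [[Bs Bt] KK'] st1; apply: (Pmono _ _ _ KK'); apply: HK => //.
  apply: (le_lt_trans (nrmC_le _)); rewrite /= distrC [X in _ + X]distrC [d]splitr.
  by apply: ltrD; [exact: Bs|exact: Bt].
move=> /(@filter_ex _ _ _)[K HK]; by exists K.
Qed.

(* [qinv (l *: a) y] says that [1 - y] is the resolvent [(1 - l a)^-1]. *)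
Definition resolvent_lip a (r d : R) := forall l, nrm l <= 1 ->
  exists y y', [/\ qinv (l *: a) y, qinv ((r%:C%C * l) *: a) y' & nrm (y - y') <= d].

(** The partial fraction 1/(1 - l^2 a^2) = (1/(1 - l a) + 1/(1 + l a))/2. *)
Lemma qinv_average a l y y' : qinv (l *: a) y -> qinv (- l *: a) y' ->
  qinv (l ^+ 2 *: (a ⋅ a)) (2^-1 *: (y + y')).
Proof.
move=> [y1 y2] [y1' y2'].
have two : (2 : R[i]) != 0 by rewrite pnatr_eq0.
have half u : 2^-1 *: (u + u) = u.
  by rewrite -mulr2n -(scaler_nat 2 u) scalerA mulVf // scale1r.
have Ey : 1 - uinj (2^-1 *: (y + y')) = 2^-1 *: ((1 - uinj y) + (1 - uinj y')).
  rewrite addrACA -opprD -uinjD scalerBr -uinjZ; congr (_ - _).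
  by rewrite half.
rewrite scaleNr uinjN opprK in y1' y2'.
have Ea : 1 - uinj (l ^+ 2 *: (a ⋅ a)) =
    (1 + uinj (l *: a)) * (1 - uinj (l *: a)).
  rewrite mulrBr mulr1 mulrDl mul1r opprD addrA addrK -uinjM cmulZl cmulZr scalerA expr2.
  by [].
have Ea' : 1 - uinj (l ^+ 2 *: (a ⋅ a)) =
    (1 - uinj (l *: a)) * (1 + uinj (l *: a)).
  by rewrite mulrDr mulr1 mulrBl mul1r addrA subrK -uinjM cmulZl cmulZr scalerA expr2.
have two1 (b : U) : 2^-1 *: ((1 + b) + (1 - b)) = 1 by rewrite addrACA subrr addr0 half.
split.
  rewrite Ey -scalerAr mulrDr {1}Ea Ea' -!mulrA y1 y1' !mulr1; exact: two1.
rewrite Ey -scalerAl mulrDl {1}Ea' Ea !mulrA y2 y2' !mul1r; exact: two1.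
Qed.

(** Each [l] in the disc is a square [m ^+ 2] with [m] in the disc; averaging over [m] and [- m]
    does not increase the distance [d]. *)
Lemma resolvent_lip_sqr a r d : resolvent_lip a r d ->
  resolvent_lip (a ⋅ a) (r ^+ 2) d.
Proof.
move=> H l l1; pose m := sqrtC l.
have mE : m ^+ 2 = l by exact: sqrtCK.
have m1 : nrm m <= 1.
  by rewrite -(@expr_le1 _ 2) ?nrm_ge0 // -nrmCX mE.
have [y1 [y1' [q1 q1' d1]]] := H _ m1.
have [|y2 [y2' [q2 q2' d2]]] := H (- m); first by rewrite nrmN.
exists (2^-1 *: (y1 + y2)), (2^-1 *: (y1' + y2')); split.
- by rewrite -mE; exact: qinv_average.
- rewrite -mE rmorphXn -exprMn; apply: qinv_average => //.
  by rewrite -mulrN.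
- rewrite -scalerBr nrmZ nrmCV opprD addrACA.
  have -> : nrm (2 : R[i]) = 2 by rewrite -(rmorph_nat (real_complex R)) nrmC_real ger0_norm.
  rewrite mulrC ler_pdivrMr // mulrDr mulr1 (le_trans (nrmD _ _)) // lerD //.
Qed.

Lemma nrm_sqr_sa a : a^⋆ = a -> nrm (a ⋅ a) = nrm a ^+ 2.
Proof. by move=> sa; rewrite -{1}sa nrm_starM. Qed.

(* The resolvents of the powers [a ^ (2 ^ n)] are averages of resolvents of
   [a]; they would stay close to [1], although [a ^ (2 ^ n)] has norm 1. *)
Lemma resolvent_lip_contra a (r d : R) : a^⋆ = a -> nrm a = 1 ->
  0 <= r -> r < 1 -> d <= 4^-1 -> resolvent_lip a r d -> False.
Proof.
move=> sa a1 r0 r1 d4 H.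
have Hn n : exists b : A, [/\ b^⋆ = b, nrm b = 1 & resolvent_lip b (r ^+ (2 ^ n)) d].
  elim: n => [|n [b [sb b1 Hb]]]; first by exists a; rewrite expn0 expr1.
  exists (b ⋅ b); split; rewrite ?cstarM ?sb ?nrm_sqr_sa ?b1 ?expr1n //.
  by rewrite expnS mulnC exprM; exact: resolvent_lip_sqr.
(* With [q <= 1/10], |y'| <= q/(1 - q) <= 1/8, so |y| <= 1/4 + 1/8; but b = b y - y gives 1 = |b| <=
   2 |y| <= 3/4. *)
have [|N HN] := @geo_small _ r 10^-1 r0 r1; first by rewrite invr_gt0.
have [b [sb b1 Hb]] := Hn N.
have := HN (2 ^ N)%N (ltnW (ltn_expl _ _)); set q := r ^+ _ => /(_ isT) q10.
have q0 : 0 <= q by exact: exprn_ge0.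
have [|y [y' [qy qy' dy]]] := Hb 1; first by rewrite nrmC1.
rewrite scale1r mulr1 in qy qy'.
have nq : nrm (q%:C%C *: b) = q by rewrite nrmZ b1 mulr1 nrmC_real ger0_norm.
have := quasi_inverse_nrm qy'; rewrite -/q nq => y'q.
have y'8 : nrm y' <= 8^-1 by have := nrm_ge0 y'; nra.
have yy' : nrm y <= nrm (y - y') + nrm y' by have := nrm_tri y y' 0; rewrite !subr0 => h; apply: le_trans (nrmD _ _); rewrite subrK.
have : nrm b <= nrm y + nrm y.
  have -> : b = b ⋅ y - y by rewrite -(qinv_eq qy) addrK.
  apply: (le_trans (nrmB _ _)); rewrite lerD2r.
  by rewrite -[leRHS]mul1r -b1 nrmM.
rewrite b1; lra.
Qed.

(** If |a| > m, the normalized [b] has resolvents on the whole closed unit disc, bounded there by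
    compactness. The resolvent identity makes them vary little between [l] and [(1 - d) l], which
    [resolvent_lip_contra] excludes. *)
Lemma nrm_spectral_radius a (m : R) : a^⋆ = a -> 0 <= m ->
  (forall z, quasi_spectrum a z -> nrm z <= m) -> nrm a <= m.
Proof.
move=> sa m0 Hm; rewrite leNgt; apply/negP => ma.
have a0 : 0 < nrm a by exact: le_lt_trans ma.
pose b := (nrm a)^-1%:C%C *: a.
have sb : b^⋆ = b by rewrite cstarZ sa conjC_real.
have b1 : nrm b = 1.
  by rewrite nrmZ nrmC_real ger0_norm ?invr_ge0 ?ltW // mulVf ?gt_eqF.
have Hq l : nrm l <= 1 -> exists y, qinv (l *: b) y.
  move=> l1; have [l0|l0] := eqVneq l 0.
    by exists 0; rewrite l0 scale0r /qinv uinj0 subr0 mulr1.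
  apply/quasi_invertibleP; apply: contrapT => nq.
  (* This is |a| / l, of modulus at least |a| > m. *)
  pose z := (l * (nrm a)^-1%:C%C)^-1.
  have az : quasi_spectrum a z.
    right; split; last by rewrite /z invrK -scalerA.
    by rewrite invr_eq0 mulf_neq0 // fmorph_eq0 invr_eq0 gt_eqF.
  have zE : nrm z = (nrm l)^-1 * nrm a.
    by rewrite /z nrmCV nrmCM nrmC_real ger0_norm ?invr_ge0 ?nrm_ge0 // invfM invrK.
  have := Hm _ az; rewrite zE leNgt => /negP; apply; apply: (lt_le_trans ma).
  by rewrite -[leLHS]mul1r ler_wpM2r ?nrm_ge0 // invf_ge1 // nrm_gt0.
pose P l K := forall y, qinv (l *: b) y -> nrm y <= K.
have qinv_uniq x y y' : qinv x y -> qinv x y' -> y = y'.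
  move=> [y1 y2] [y1' y2']; have : 1 - uinj y = 1 - uinj y'.
    by rewrite -[LHS]mulr1 -[X in _ * X = _]y1' mulrA y2 mul1r.
  by move=> /addrI/oppr_inj/uinj_inj.
have [K HK] : exists K, forall l, nrm l <= 1 -> P l K.
  apply: disc_bounded => [z K K' KK' PK y qy|z z1].
    exact: le_trans (PK _ qy) KK'.
  have [y0 qy0] := Hq _ z1; have [d d0 Hd] := qinv_local qy0.
  exists d => //; exists (1 + 2 * nrm y0) => w wd y qy.
  by have [y' qy' ?] := Hd _ wd; rewrite (qinv_uniq _ _ _ qy qy').
pose K1 := `|K| + 1.
have K1p : 0 < K1 by rewrite ltr_wpDl.
(* The resolvent identity bounds the distance by d (1 + K1)^2, which is 1/4 for this [d]. *)
pose d := (4 * (1 + K1) ^+ 2)^-1.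
have K1s : 1 <= (1 + K1) ^+ 2 by rewrite expr_ge1 //; lra.
have d0 : 0 < d by rewrite invr_gt0; lra.
have d1 : d <= 4^-1 by rewrite lef_pV2 ?posrE; lra.
have r1 : 0 <= 1 - d by lra.
apply: (@resolvent_lip_contra b (1 - d) 4^-1) => //; first lra.
move=> l l1; have [y qy] := Hq _ l1.
have l1' : nrm ((1 - d)%:C%C * l) <= 1.
  by rewrite nrmCM nrmC_real ger0_norm // mulr_ile1 ?nrm_ge0 //; lra.
have [y' qy'] := Hq _ l1'; exists y, y'; split=> //.
have yK : nrm y <= K1 by rewrite (le_trans (HK _ l1 _ qy)) // (le_trans (ler_norm K)) // lerDl.
have yK' : nrm y' <= K1 by rewrite (le_trans (HK _ l1' _ qy')) // (le_trans (ler_norm K)) // lerDl.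
case: qy => y1 y2; case: qy' => y1' y2'.
have E : uinj (y - y') = (1 - uinj y) * uinj ((- (d%:C%C * l)) *: b) * (1 - uinj y').
  have -> : uinj ((- (d%:C%C * l)) *: b) = (1 - uinj (l *: b)) - (1 - uinj (((1 - d)%:C%C * l) *: b)).
    rewrite opprB addrC addrA subrK -uinjB -scalerBl; congr (uinj (_ *: _)).
    by rewrite rmorphB rmorph1 mulrBl mul1r addrAC subrr add0r.
  have E0 (f g p q : U) : f * p = 1 -> q * g = 1 -> f * (p - q) * g = g - f.
    by move=> fp qg; rewrite mulrBr fp mulrBl mul1r -mulrA qg mulr1.
  by rewrite (E0 _ _ _ _ y2 y1') uinjB opprB [RHS]addrC addrA subrK.
have E2 : (1 - uinj y) * uinj ((- (d%:C%C * l)) *: b) * (1 - uinj y') =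
    uinj (let c := (- (d%:C%C * l)) *: b in let c' := c - y ⋅ c in c' - c' ⋅ y').
  by rewrite /= mulrBl mul1r -uinjM -uinjB mulrBr mulr1 -uinjM -uinjB.
rewrite E2 in E; rewrite (uinj_inj E) /=.
set c := (- _) *: b.
have nc : nrm c <= d.
  have d0' := ltW d0.
  by rewrite nrmZ b1 mulr1 nrmN nrmCM nrmC_real ger0_norm // ler_piMr.
have nc' : nrm (c - y ⋅ c) <= d * (1 + K1).
  apply: (le_trans (nrmB _ _)); rewrite mulrDr mulr1 lerD // (le_trans (nrmM _ _)) //.
  by rewrite mulrC ler_pM ?nrm_ge0.
apply: (@le_trans _ _ (d * (1 + K1) * (1 + K1))).
  apply: (le_trans (nrmB _ _)); rewrite mulrDr mulr1 lerD // (le_trans (nrmM _ _)) //.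
  by rewrite ler_pM ?nrm_ge0.
rewrite -mulrA -expr2 /d invfM -mulrA mulVf ?mulr1 // gt_eqF //; lra.
Qed.

End polynomial_calculus.

(** * Weierstrass approximation *)

Section weierstrass.
Context {R : realType}.
Implicit Types (g : R -> R) (x s e Q : R).

(** De Casteljau's recursion: the value is the expectation of h(k + B) for B binomial with
    parameters [n] and [x]. *)
Fixpoint bernstein n (h : nat -> R) x k : R :=
  if n is m.+1 then (1 - x) * bernstein m h x k + x * bernstein m h x k.+1
  else h k.

Fixpoint bernstein_poly n (h : nat -> R) k : {poly R} :=
  if n is m.+1 then (1 - 'X) * bernstein_poly m h k + 'X * bernstein_poly m h k.+1
  else (h k)%:P.

Lemma bernstein_polyE n h k x : (bernstein_poly n h k).[x] = bernstein n h x k.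
Proof.
elim: n k => [|n IH] k /=; first by rewrite hornerC.
by rewrite hornerD !hornerM hornerD hornerN hornerC hornerX !IH.
Qed.

Lemma bernstein_le n (h h' : nat -> R) x k : 0 <= x -> x <= 1 ->
  (forall j, (j <= k + n)%N -> h j <= h' j) ->
  bernstein n h x k <= bernstein n h' x k.
Proof.
move=> x0 x1; elim: n k => [|n IH] k H /=; first by apply: H; rewrite addn0.
apply: lerD; apply: ler_wpM2l; rewrite ?subr_ge0 //; apply: IH => j jk; apply: H.
  by rewrite (leq_trans jk) // leq_add2l.
by rewrite -addSnnS.
Qed.

(* The mean and variance of the binomial law. *)
Lemma bernstein_square n c Q d x k :
  bernstein n (fun j => c + Q * (j%:R - d) ^+ 2) x k =
  c + Q * ((k%:R + n%:R * x - d) ^+ 2 + n%:R * x * (1 - x)).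
Proof.
elim: n k => [|n IH] k /=; first by ring.
by rewrite !IH -[k.+1]addn1 -[n.+1]addn1 !natrD; ring.
Qed.

(** Near the diagonal continuity gives the bound [e]; away from it (s - x)^2 is bounded below and a
    large [Q] absorbs the variation of [g]. In this form the mean and the variance of the binomial
    law suffice for Bernstein's theorem. *)
Lemma continuous_quadratic_modulus g e : continuous g -> 0 < e ->
  exists2 Q, 0 <= Q & forall s x, s \in `[0, 1] -> x \in `[0, 1] ->
    `|g s - g x| <= e + Q * (s - x) ^+ 2.
Proof.
move=> gc e0; pose S := `[(0 : R), 1]%classic `*` `[(0 : R), 1]%classic.
have cS : compact S by apply: compact_setX; exact: segment_compact.
have : \forall Q \near +oo, S `<=`
    (fun p => 0 <= Q /\ `|g p.1 - g p.2| <= e + Q * (p.1 - p.2) ^+ 2).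
  apply: (compact_near_coveringP S).1 => // -[s0 x0] _.
  have [<-{x0}|sx] := eqVneq s0 x0.
    have e2 : 0 < e / 2 by rewrite divr_gt0.
    have := gc s0 => /cvgrPdist_lt/(_ _ e2) gs0.
    exists ([set p | `|g s0 - g p.1| < e / 2 /\ `|g s0 - g p.2| < e / 2], [set Q | 0 <= Q]).
      split => /=; last by apply: nbhs_pinfty_ge; rewrite num_real.
      by exists ([set s | `|g s0 - g s| < e / 2], [set s | `|g s0 - g s| < e / 2]).
    move=> [[s x] Q] /= [[Hs Hx] Q0]; split=> //.
    have : `|g s - g x| <= e.
      have -> : g s - g x = (g s0 - g x) - (g s0 - g s) by ring.
      by rewrite [e]splitr (le_trans (ler_normB _ _)) // addrC lerD // ltW.
    by move=> /le_trans; apply; rewrite lerDl mulr_ge0 ?sqr_ge0.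
  pose c := `|s0 - x0| / 4.
  have c0 : 0 < c by rewrite divr_gt0 // normr_gt0 subr_eq0.
  have /cvgrPdist_lt/(_ _ ltr01) gs0 := gc s0.
  have /cvgrPdist_lt/(_ _ ltr01) gx0 := gc x0.
  exists ([set p | (`|g s0 - g p.1| < 1 /\ `|s0 - p.1| < c) /\ (`|g x0 - g p.2| < 1 /\ `|x0 - p.2| < c)],
     [set Q | 0 <= Q /\ (`|g s0| + `|g x0| + 2) / c ^+ 2 <= Q]).
    split => /=.
      exists ([set s | `|g s0 - g s| < 1 /\ `|s0 - s| < c], [set s | `|g x0 - g s| < 1 /\ `|x0 - s| < c]) => //=.
      split; apply: filterI => //; exact: nbhsx_ballx.
    by apply: filterI; apply: nbhs_pinfty_ge; rewrite num_real.
  move=> [[s x] Q] /= [[[Hs sc] [Hx xc]] [Q0 HQ]]; split=> //.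
  have sx2 : c <= `|s - x|.
    have : `|s0 - x0| <= `|s0 - s| + `|s - x| + `|x0 - x|.
      have -> : s0 - x0 = (s0 - s) + (s - x) - (x0 - x) by ring.
      by rewrite (le_trans (ler_normB _ _)) // lerD2r ler_normD.
    have -> : `|s0 - x0| = 4 * c by rewrite /c mulrC divfK.
    by move: c0 sc xc; lra.
  have sq : c ^+ 2 <= (s - x) ^+ 2.
    by rewrite -[leRHS]real_normK ?num_real // ler_pXn2r ?nnegrE ?normr_ge0 // ltW.
  have : `|g s - g x| <= `|g s0| + `|g x0| + 2.
    have -> : g s - g x = (g s0 - g x0) + ((g x0 - g x) - (g s0 - g s)) by ring.
    apply: (le_trans (ler_normD _ _)); apply: lerD; first exact: ler_normB.
    apply: (le_trans (ler_normB _ _)); lra.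
  move=> /le_trans; apply; apply: ler_wpDl; first exact: ltW.
  rewrite ler_pdivrMr ?exprn_gt0 // in HQ; apply: (le_trans HQ).
  by rewrite ler_wpM2l.
move=> /(@filter_ex _ _ _)[Q HQ].
have [Q0 _] : 0 <= Q /\ `|g 0 - g 0| <= e + Q * (0 - 0) ^+ 2.
  by apply: (HQ (0, 0)); split; rewrite /= in_itv /= lexx ler01.
exists Q => // s x s01 x01.
by have [] := HQ (s, x) (conj s01 x01).
Qed.

(** The Bernstein operator is monotone, and the quadratic modulus encloses [g] between two
    quadratics on which the operator is explicit; the error beyond e/2 is Q x (1 - x)/n. *)
Lemma weierstrass01 g e : continuous g -> 0 < e ->
  exists p : {poly R}, forall x, x \in `[0, 1] -> `|p.[x] - g x| <= e.
Proof.
move=> gc e0; have e2 : 0 < e / 2 by rewrite divr_gt0.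
have [Q Q0 HQ] := continuous_quadratic_modulus gc e2.
have [n n0 nQ] : exists2 n, (0 < n)%N & Q / n%:R <= e / 2.
  exists (Num.truncn (Q / (e / 2))).+1 => //.
  rewrite ler_pdivrMr ?ltr0n // -ler_pdivrMl // mulrC.
  by apply/ltW; rewrite truncnS_gt.
have nR : (0 : R) < n%:R by rewrite ltr0n.
exists (bernstein_poly n (fun j => g (j%:R / n%:R)) 0) => x.
rewrite bernstein_polyE in_itv /= => /andP[x0 x1].
have node j : (j <= 0 + n)%N -> `|g (j%:R / n%:R) - g x| <= e / 2 + Q / n%:R ^+ 2 * (j%:R - n%:R * x) ^+ 2.
  move=> jn; have -> : Q / n%:R ^+ 2 * (j%:R - n%:R * x) ^+ 2 = Q * (j%:R / n%:R - x) ^+ 2.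
    by field; rewrite gt_eqF.
  apply: HQ; rewrite in_itv /= ?x0 ?x1 // divr_ge0 //=.
  by rewrite ler_pdivrMr // mul1r ler_nat.
have E c q : bernstein n (fun j => c + q * (j%:R - n%:R * x) ^+ 2) x 0 = c + q * (n%:R * x * (1 - x)).
  by rewrite bernstein_square; ring.
have small : Q / n%:R ^+ 2 * (n%:R * x * (1 - x)) <= e / 2.
  apply: le_trans nQ; rewrite (_ : _ * _ = Q / n%:R * (x * (1 - x))); last by field; rewrite gt_eqF.
  rewrite ler_piMr ?divr_ge0 //.
  by rewrite mulr_ile1 ?subr_ge0 // gerBl.
rewrite ler_norml; apply/andP; split.
  rewrite lerBrDr addrC.
  apply: (@le_trans _ _ (bernstein n (fun j => (g x - e / 2) + - (Q / n%:R ^+ 2) * (j%:R - n%:R * x) ^+ 2) x 0)).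
    by rewrite E mulNr; move: small; set q := Q / _ * _; lra.
  apply: bernstein_le => // j /node; rewrite ler_norml mulNr => /andP[+ _].
  by set q := Q / _ * _; lra.
rewrite lerBlDr; apply: (@le_trans _ _ (bernstein n (fun j => (g x + e / 2) + Q / n%:R ^+ 2 * (j%:R - n%:R * x) ^+ 2) x 0)).
  apply: bernstein_le => // j /node; rewrite ler_norml => /andP[_].
  by set q := Q / _ * _; lra.
by rewrite E; move: small; set q := Q / _ * _; lra.
Qed.

Lemma weierstrass g M e : continuous g -> 0 < M -> 0 < e ->
  exists p : {poly R}, forall x, `|x| <= M -> `|p.[x] - g x| <= e.
Proof.
move=> gc M0 e0; have [||p Hp] := @weierstrass01 (g \o (fun x => (x *+ 2 - 1) * M)) e => //.
  move=> x; apply: continuous_comp; last exact: gc.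
  apply: cvgMl; apply: cvgB; last exact: cvg_cst.
  by apply: cvgMn.
exists (p \Po ((2 * M)^-1 *: 'X + 2^-1%:P)) => x xM.
rewrite horner_comp hornerD hornerZ hornerX hornerC.
have := Hp ((2 * M)^-1 * x + 2^-1).
rewrite /= (_ : ((2 * M)^-1 * x + 2^-1) *+ 2 - 1 = x / M); last by field; rewrite gt_eqF.
rewrite divfK ?gt_eqF //; apply; move: xM; rewrite ler_norml in_itv /= => /andP[x1 x2].
have -> : (2 * M)^-1 * x + 2^-1 = (x / M + 1) / 2 by field; rewrite gt_eqF.
have h1 : x / M <= 1 by rewrite ler_pdivrMr ?mul1r.
have h2 : -1 <= x / M by rewrite ler_pdivlMr ?mulN1r.
by apply/andP; split; lra.
Qed.

End weierstrass.

(** * Continuous functional calculus *)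

Section cfc_construction.
Context {R : realType} {A : cstarAlgType R}.
Implicit Types (a b c x y : A) (k l z : R[i]) (p q : {poly R[i]}).
Implicit Types (f g h : R[i]^o -> R[i]^o).

Lemma within_nrmP (S : set R[i]^o) f : {within S, continuous f} <->
  forall z, S z -> forall e : R, 0 < e -> exists2 d : R, 0 < d &
    forall w, S w -> nrm (z - w) < d -> nrm (f z - f w) < e.
Proof.
split=> [/subspace_continuousP H z Sz e e0|H].
  have e0' : 0 < e%:C%C :> R[i] by rewrite ltcR.
  have /cvgrPdist_lt/(_ _ e0') := H z Sz.
  rewrite /within /= => /nrm_nbhsP[d d0 Hd]; exists d => // w Sw zw.
  by have := Hd w zw Sw; rewrite nrmE ltcR.
apply/subspace_continuousP => z Sz; apply/cvgrPdist_lt => e e0.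
have E : e = (complex.Re e)%:C%C by rewrite RRe_real // gtr0_real.
have re0 : 0 < complex.Re e by move: e0; rewrite ltcE => /andP[].
have [d d0 Hd] := H z Sz _ re0.
rewrite /within /=; apply/nrm_nbhsP; exists d => // w zw Sw.
by rewrite nrmE E ltcR; exact: Hd.
Qed.

Lemma paXr a p (c : R[i]) : pa a (p * 'X + c%:P) = pa a p ⋅ a + p.[0] *: a.
Proof.
rewrite paD [pa a c%:P]/pa pevC [X in _ + X]scaler0 addr0.
rewrite /pa pevM pev_id -(pev2 a).
by rewrite [_ * _]/(umul _ _) /umul /= scale0r addr0.
Qed.

Lemma pa_comm a p : a ⋅ pa a p = pa a p ⋅ a.
Proof.
have : uinj a * pev a p = pev a p * uinj a by rewrite -(pev_id a) -pevM mulrC pevM.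
move=> /(congr1 fst); rewrite [uinj a * _]/(umul _ _) [_ * uinj a]/(umul _ _) /umul /=.
by rewrite scale0r !addr0; apply: addIr.
Qed.

Lemma pa_star a p : a^⋆ = a -> (pa a p)^⋆ = pa a (map_poly (@Num.conj R[i]) p).
Proof.
move=> sa; elim/poly_ind: p => [|p k IH].
  by rewrite map_poly0 /pa pev0 cstar0.
rewrite rmorphD rmorphM /= map_polyX map_polyC /= !paXr cstarD cstarM cstarZ sa IH.
rewrite pa_comm; congr (_ + _ *: _).
by rewrite -[0 in RHS](rmorph0 (@Num.conj R[i])) horner_map.
Qed.

Lemma spectrum_bound a z : quasi_spectrum a z -> nrm z <= nrm a.
Proof.
by move=> az; have := spectrum_nrm_le az (hornerX 0); rewrite hornerX paX.
Qed.

(** By the C*-identity |p(a)|^2 is the norm of the self-adjoint element (p' p)(a), where p' has the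
    conjugate coefficients, and hence its spectral radius. The spectrum of [a] is real, so p' p
    takes there the values |p(w)|^2. *)
Lemma pa_bound a p (m : R) : a^⋆ = a -> 0 <= m -> p.[0] = 0 ->
  (forall z, quasi_spectrum a z -> nrm p.[z] <= m) -> nrm (pa a p) <= m.
Proof.
move=> sa m0 p0 H; rewrite -(@ler_pXn2r _ 2) ?nnegrE ?nrm_ge0 //.
pose p' := map_poly (@Num.conj R[i]) p.
have p'0 : p'.[0] = 0 by rewrite -(rmorph0 (@Num.conj R[i])) horner_map p0 rmorph0.
rewrite -nrm_starM pa_star // -paM // -/p'.
have pp0 : (p' * p).[0] = 0 by rewrite hornerM p'0 mul0r.
apply: nrm_spectral_radius; rewrite ?sqr_ge0 //.
  by rewrite paM // -/p' {1}/p' -(pa_star _ sa) cstarM cstarK (pa_star _ sa).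
move=> z /(spectrum_poly pp0)[w aw <-]; rewrite hornerM.
have -> : p'.[w] = Num.conj p.[w].
  have wr : Num.conj w = w.
    apply/CrealP/complex_realP; exists (complex.Re w).
    by rewrite [LHS]complexE (spectrum_real sa aw) mulr0 addr0.
  by rewrite -{1}wr horner_map.
by rewrite nrmCM nrmC_conj -expr2 ler_pXn2r ?nnegrE ?nrm_ge0 // H.
Qed.

Lemma closed_real_spectrum a : closed [set s : R | quasi_spectrum a s%:C%C].
Proof.
rewrite -openC openE => s /= ns; rewrite /interior.
have s0 : s != 0 by apply/eqP => s0; apply: ns; rewrite s0; exact: spectrum0.
have qs : quasi_invertible ((s%:C%C : R[i])^-1 *: a).
  apply: contrapT => nq; apply: ns; right; split => //.
  by rewrite fmorph_eq0.
have [y qy] := (quasi_invertibleP _).1 qs.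
have [d d0 Hd] := qinv_local qy.
have /cvgrPdist_lt/(_ _ d0) vc : (fun t : R => t^-1) @ s --> s^-1 by exact: inv_continuous.
have : \forall t \near s, `|s^-1 - t^-1| < d by [].
move=> H; have : \forall t \near s, `|s - t| < `|s|.
  by apply: nbhsx_ballx; rewrite normr_gt0.
move=> /(filterI H); apply: filterS => t [td ts] [/eqP|[t0 nt]].
  by rewrite fmorph_eq0 => /eqP t0; move: ts; rewrite t0 subr0 ltxx.
apply: nt; apply/quasi_invertibleP.
have [|y' qy' _] := Hd (t%:C%C)^-1; last by exists y'.
by rewrite -!fmorphV -rmorphB nrmC_real distrC.
Qed.

(** The spectrum is a compact set of reals: the real and imaginary parts of [f] extend to the line
    by Tietze's theorem and Weierstrass applies. Removing the constant term costs little, as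
    [f 0 = 0] and 0 lies in the spectrum. *)
Lemma cfc_domain_poly_approx a f (e : R) : a^⋆ = a -> cfc_domain a f -> 0 < e ->
  exists p, p.[0] = 0 /\ forall z, quasi_spectrum a z -> nrm (p.[z] - f z) <= e.
Proof.
move=> sa [/within_nrmP fc f0] e0.
pose K := [set s : R | quasi_spectrum a s%:C%C].
pose M := nrm a + 1.
have M0 : 0 < M by rewrite ltr_wpDl ?nrm_ge0.
have KM s : K s -> `|s| <= nrm a by move=> /spectrum_bound; rewrite nrmC_real.
have cK : compact K.
  apply: (subclosed_compact _ (@segment_compact _ (- nrm a) (nrm a))).
    exact: closed_real_spectrum.
  by move=> s /KM; rewrite /= in_itv /= ler_norml.
have part (r : R[i] -> R) : (forall w, `|r w| <= nrm w) -> {morph r : x y / x - y} ->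
    exists p : {poly R}, forall s, K s -> `|p.[s] - r (f s%:C%C)| <= e / 4.
  move=> rn rB; pose u s : R^o := r (f s%:C%C).
  have uc : {within K, continuous u}.
    apply/subspace_continuousP => s Ks; apply/cvgrPdist_lt => e1 e10.
    have [d d0 Hd] := fc _ Ks _ e10.
    rewrite near_withinE; have := nbhsx_ballx s d d0; apply: filterS => t st Kt.
    by rewrite /from_subspace /u -rB (le_lt_trans (rn _)) // Hd // -rmorphB nrmC_real.
  have [B B0 HB] : exists2 B : R, 0 < B & forall s, K s -> `|u s| <= B.
    have /compact_bounded[B [_ HB]] := continuous_compact uc cK.
    exists (`|B| + 1); first by rewrite ltr_wpDl.
    move=> s Ks; apply: (HB (`|B| + 1)); last by exists s.
    by rewrite (le_lt_trans (ler_norm B)) // ltrDl.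
  have [v [Ev vc _]] := continuous_bounded_extension (@pseudometric_normal R R) (closed_real_spectrum (a := a)) B0 uc HB.
  have [|p Hp] := @weierstrass R v M (e / 4) vc M0; first by rewrite divr_gt0.
  exists p => s Ks; rewrite -/(u s) Ev ?inE //; apply: Hp.
  by rewrite (le_trans (KM _ Ks)) // lerDl.
have [pu Hu] := part _ (@nrmC_Re R) (raddfB (@complex.Re R : Rcomplex R -> R)).
have [pv Hv] := part _ (@nrmC_Im R) (raddfB (@complex.Im R : Rcomplex R -> R)).
pose p : {poly R[i]} := map_poly (real_complex R) pu + 'i%C *: map_poly (real_complex R) pv.
have Hp s : K s -> nrm (p.[s%:C%C] - f s%:C%C) <= e / 2.
  move=> Ks; rewrite /p hornerD hornerZ !horner_map.
  apply: (le_trans (nrmC_le _)); rewrite [e](_ : _ = (e / 2) * 2); last by rewrite divfK // pnatr_eq0.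
  have := Hu _ Ks; have := Hv _ Ks; case: (f s%:C%C) => r i /=; simpc => /=.
  lra.
have p0 : nrm p.[0] <= e / 2.
  by have := Hp 0 (@spectrum0 _ _ a); rewrite f0 subr0.
exists (p - p.[0]%:P); split; first by rewrite !hornerE subrr.
move=> z az; have zE : z = (complex.Re z)%:C%C.
  by rewrite {1}[z]complexE (spectrum_real sa az) mulr0 addr0.
rewrite hornerD hornerN hornerC addrAC (le_trans (nrmB _ _)) // [e]splitr lerD //.
by rewrite zE; apply: Hp; rewrite /K /= -zE.
Qed.

(* [b] is [f(a)], as a limit of polynomials in [a]. *)
Definition is_cfc_value a f b := forall e : R, 0 < e ->
  exists p, [/\ p.[0] = 0, forall z, quasi_spectrum a z -> nrm (p.[z] - f z) <= e
    & nrm (pa a p - b) <= e].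

Lemma nrm_eps0 (C : R) x : (forall e : R, 0 < e -> nrm x <= C * e) -> x = 0.
Proof.
move=> H; apply: nrm_le0; rewrite leNgt; apply/negP => x0.
have C1 : 0 < `|C| + 1 by rewrite ltr_wpDl.
have C2 : C <= `|C| by exact: ler_norm.
have d0 : 0 < nrm x / (2 * (`|C| + 1)) by rewrite divr_gt0 // mulr_gt0.
have := H _ d0; have E : (`|C| + 1) * (nrm x / (2 * (`|C| + 1))) = nrm x / 2.
  by field; rewrite gt_eqF.
move: E d0; set d := nrm x / (2 * _) => E d0.
have : C * d <= `|C| * d by rewrite ler_wpM2r // ltW.
lra.
Qed.

Lemma is_cfc_value_exists a f : a^⋆ = a -> cfc_domain a f ->
  exists b, is_cfc_value a f b.
Proof.
move=> sa df.
have H n : exists p, p.[0] = 0 /\ forall z, quasi_spectrum a z -> nrm (p.[z] - f z) <= n.+1%:R^-1.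
  by apply: cfc_domain_poly_approx => //; rewrite invr_gt0.
have [p Hp] := choice H.
have [|b Hb] := @cauchy_cvg_seq _ A (fun n => pa a (p n)).
  move=> m n; rewrite -paB; apply: pa_bound => //.
    by rewrite hornerD hornerN (Hp m).1 (Hp n).1 subrr.
  move=> z az; rewrite hornerD hornerN (le_trans (nrm_tri (f z) _ _)) //.
  by rewrite lerD ?(Hp m).2 // nrmBC (Hp n).2.
exists b => e e0; have /nrm_cvgP/(_ e e0)[N HN] := Hb.
have [N' _ HN'] := @cvg_harmonic R [set x | x < e] (lt_nbhsl e0).
pose n := maxn N N'.
exists (p n); split; [exact: (Hp n).1| |].
  move=> z az; rewrite (le_trans ((Hp n).2 z az)) // ltW //.
  by apply: (HN' n); rewrite /= leq_maxr.
by rewrite nrmBC HN // leq_maxl.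
Qed.

Lemma is_cfc_value_nrm a f b (m : R) : a^⋆ = a -> 0 <= m -> is_cfc_value a f b ->
  (forall z, quasi_spectrum a z -> nrm (f z) <= m) -> nrm b <= m.
Proof.
move=> sa m0 fb H; apply/ler_addgt0Pr => e e0.
have e2 : 0 < e / 2 by rewrite divr_gt0.
have [p [p0 pf pb]] := fb _ e2.
have : nrm (pa a p) <= m + e / 2.
  apply: pa_bound => //; first by rewrite addr_ge0 // ltW.
  move=> z az; rewrite -[p.[z]](subrK (f z)) (le_trans (nrmD _ _)) // addrC lerD //.
    exact: H.
  exact: pf.
have : nrm b <= nrm (pa a p - b) + nrm (pa a p).
  by rewrite nrmBC (le_trans _ (nrmD _ _)) // subrK.
lra.
Qed.

Lemma is_cfc_value_ge a f b z : is_cfc_value a f b -> quasi_spectrum a z ->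
  nrm (f z) <= nrm b.
Proof.
move=> fb az; apply/ler_addgt0Pr => e e0.
have e2 : 0 < e / 2 by rewrite divr_gt0.
have [p [p0 pf pb]] := fb _ e2.
have h1 := spectrum_nrm_le az p0; have h2 := pf _ az.
have h3 : nrm (f z) <= nrm (p.[z] - f z) + nrm p.[z].
  by rewrite nrmBC (le_trans _ (nrmD _ _)) // subrK.
have h4 : nrm (pa a p) <= nrm (pa a p - b) + nrm b.
  by rewrite (le_trans _ (nrmD _ _)) // subrK.
lra.
Qed.

Lemma is_cfc_value_add a f g b c : is_cfc_value a f b -> is_cfc_value a g c ->
  is_cfc_value a (fun z => f z + g z) (b + c).
Proof.
move=> fb gc e e0; have e2 : 0 < e / 2 by rewrite divr_gt0.
have [p [p0 pf pb]] := fb _ e2; have [q [q0 qg qc]] := gc _ e2.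
exists (p + q); split.
- by rewrite hornerD p0 q0 addr0.
- move=> z az; rewrite hornerD opprD addrACA [e]splitr (le_trans (nrmD _ _)) // lerD //.
    exact: pf.
  exact: qg.
- by rewrite paD opprD addrACA [e]splitr (le_trans (nrmD _ _)) // lerD.
Qed.

Lemma is_cfc_value_scale a k f b : is_cfc_value a f b ->
  is_cfc_value a (fun z => k * f z) (k *: b).
Proof.
move=> fb e e0; have k1 : 0 < nrm k + 1 by rewrite ltr_wpDl ?nrm_ge0.
have [p [p0 pf pb]] := fb _ (divr_gt0 e0 k1).
have small (V : normedModType R[i]) (v : V) : nrm v <= e / (nrm k + 1) -> nrm (k *: v) <= e.
  rewrite nrmZ ler_pdivlMr // => h; have := nrm_ge0 v; have := nrm_ge0 k; nra.
exists (k *: p); split.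
- by rewrite hornerZ p0 mulr0.
- by move=> z az; rewrite hornerZ -mulrBr; exact: (small R[i]^o _ (pf _ az)).
- by rewrite paZ -scalerBr; exact: small.
Qed.

Lemma is_cfc_value_mul a f g b c : is_cfc_value a f b -> is_cfc_value a g c ->
  is_cfc_value a (fun z => f z * g z) (b ⋅ c).
Proof.
move=> fb gc e e0; pose D := nrm b + nrm c + 3.
have b0 := nrm_ge0 b; have c0 := nrm_ge0 c.
have D0 : 0 < D by rewrite /D; lra.
pose d := Num.min 1 (e / D).
have d0 : 0 < d by rewrite lt_min ltr01 divr_gt0.
have d1 : d <= 1 by rewrite ge_min lexx.
have dD : d * D <= e by rewrite -ler_pdivlMr // ge_min lexx orbT.
have [p [p0 pf pb]] := fb _ d0; have [q [q0 qg qc]] := gc _ d0.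
have pb' : nrm (pa a p) <= nrm b + 1.
  by rewrite -[pa a p](subrK b) addrC (le_trans (nrmD _ _)) // lerD2l (le_trans pb).
exists (p * q); split.
- by rewrite hornerM p0 mul0r.
- move=> z az; rewrite hornerM.
  have -> : p.[z] * q.[z] - f z * g z = p.[z] * (q.[z] - g z) + (p.[z] - f z) * g z.
    by rewrite mulrBr mulrBl addrA subrK.
  apply: (le_trans (nrmD _ _)); rewrite !nrmCM.
  have h1 := le_trans (spectrum_nrm_le az p0) pb'; have h2 := is_cfc_value_ge gc az.
  have h3 := pf _ az; have h4 := qg _ az.
  have h5 := nrm_ge0 p.[z]; have h6 := nrm_ge0 (q.[z] - g z); have h7 := nrm_ge0 (g z).
  have h8 := nrm_ge0 (p.[z] - f z).
  rewrite /D in dD; nra.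
- rewrite paM //; have -> : pa a p ⋅ pa a q - b ⋅ c = pa a p ⋅ (pa a q - c) + (pa a p - b) ⋅ c.
    by rewrite cmulBr cmulBl addrA subrK.
  apply: (le_trans (nrmD _ _)); apply: (le_trans (lerD (nrmM _ _) (nrmM _ _))).
  have h5 := nrm_ge0 (pa a p); have h6 := nrm_ge0 (pa a q - c).
  have h8 := nrm_ge0 (pa a p - b).
  rewrite /D in dD; nra.
Qed.

Lemma is_cfc_value_star a f b : a^⋆ = a -> is_cfc_value a f b ->
  is_cfc_value a (fun z => Num.conj (f z : R[i])) b^⋆.
Proof.
move=> sa fb e e0; have [p [p0 pf pb]] := fb _ e0.
exists (map_poly (@Num.conj R[i]) p); split.
- by rewrite -(rmorph0 (@Num.conj R[i])) horner_map p0 rmorph0.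
- move=> z az; have wr : Num.conj (z : R[i]) = z.
    apply/CrealP/complex_realP; exists (complex.Re z).
    by rewrite [LHS]complexE (spectrum_real sa az) mulr0 addr0.
  by rewrite -{1}wr horner_map /= -rmorphB nrmC_conj pf.
- by rewrite -pa_star // -cstarB nrm_star.
Qed.

Lemma is_cfc_value_id a : is_cfc_value a id a.
Proof.
move=> e e0; exists 'X; split; rewrite ?hornerX // ?paX ?subrr ?nrm0 ?ltW //.
by move=> z _; rewrite hornerX subrr nrm0 ltW.
Qed.

Lemma is_cfc_value_ext a f g b : {in quasi_spectrum a, f =1 g} ->
  is_cfc_value a f b -> is_cfc_value a g b.
Proof.
move=> fg fb e e0; have [p [p0 pf pb]] := fb _ e0; exists p; split=> // z az.
by rewrite -fg ?inE // pf.
Qed.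

Lemma is_cfc_value_uniq a f b c : a^⋆ = a ->
  is_cfc_value a f b -> is_cfc_value a f c -> b = c.
Proof.
move=> sa fb fc; apply/eqP; rewrite -subr_eq0; apply/eqP/nrm_le0.
have fN := is_cfc_value_add fb (is_cfc_value_scale (-1) fc).
rewrite scaleN1r in fN; apply: (is_cfc_value_nrm sa (lexx 0) fN) => z _.
by rewrite mulN1r subrr nrm0.
Qed.

End cfc_construction.

(** * Existence and uniqueness of the continuous functional calculus *)

Section cfc_theory.
Context {R : realType} {A : cstarAlgType R}.
Implicit Types (a b c x y : A) (k l z : R[i]) (p q : {poly R[i]}).
Implicit Types (f g h : R[i]^o -> R[i]^o).

Lemma cfc_domainD a f g : cfc_domain a f -> cfc_domain a g ->
  cfc_domain a (fun z => f z + g z).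
Proof.
move=> [fc f0] [gc g0]; split; last by rewrite f0 g0 addr0.
by move=> x; apply: cvgD; [exact: fc|exact: gc].
Qed.

Lemma cfc_domainZ a k f : cfc_domain a f -> cfc_domain a (fun z => k * f z).
Proof.
move=> [fc f0]; split; last by rewrite f0 mulr0.
by move=> x; apply: cvgMr; exact: fc.
Qed.

Lemma cfc_domainM a f g : cfc_domain a f -> cfc_domain a g ->
  cfc_domain a (fun z => f z * g z).
Proof.
move=> [fc f0] [gc g0]; split; last by rewrite f0 mul0r.
by move=> x; apply: cvgM; [exact: fc|exact: gc].
Qed.

Lemma cfc_domain_conj a f : cfc_domain a f ->
  cfc_domain a (fun z => Num.conj (f z : R[i])).
Proof.
move=> [/within_nrmP fc f0]; split; last by rewrite f0 rmorph0.
apply/within_nrmP => z az e e0; have [d d0 Hd] := fc z az e e0.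
exists d => // w aw zw; rewrite -rmorphB nrmC_conj; exact: Hd.
Qed.

Lemma cfc_domain_id a : cfc_domain a id.
Proof.
split=> //; apply/within_nrmP => z az e e0; exists e => //.
Qed.

Lemma is_cfc_limit a : a^⋆ = a -> is_cfc a (fun f => xget 0 (is_cfc_value a f)).
Proof.
move=> sa; have H f : cfc_domain a f -> is_cfc_value a f (xget 0 (is_cfc_value a f)).
  by move=> /(is_cfc_value_exists sa); exact: xgetPex.
have U f b : cfc_domain a f -> is_cfc_value a f b -> xget 0 (is_cfc_value a f) = b.
  by move=> df; apply: is_cfc_value_uniq => //; exact: H.
split.
- by move=> f g df dg fg; apply: U => //; apply: is_cfc_value_ext (H _ dg) => z az; rewrite fg.
- move=> f g df dg; apply: U; first exact: cfc_domainD.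
  by apply: is_cfc_value_add; exact: H.
- move=> k f df; apply: U; first exact: cfc_domainZ.
  by apply: is_cfc_value_scale; exact: H.
- move=> f g df dg; apply: U; first exact: cfc_domainM.
  by apply: is_cfc_value_mul; exact: H.
- move=> f df; apply: U; first exact: cfc_domain_conj.
  by apply: is_cfc_value_star => //; exact: H.
- apply: U; first exact: cfc_domain_id.
  exact: is_cfc_value_id.
Qed.

Section uniqueness.
Context (a : A) (Phi : (R[i]^o -> R[i]^o) -> A).
Hypothesis PhiP : is_cfc a Phi.

Lemma is_cfc0 f : cfc_domain a f -> {in quasi_spectrum a, f =1 fun=> 0} -> Phi f = 0.
Proof.
move=> df f0; rewrite (_ : Phi f = Phi (fun z => 0 * f z)).
  by rewrite (cfc_scale PhiP) // scale0r.
apply: (cfc_ext PhiP) => //; first exact: cfc_domainZ.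
by move=> z az; rewrite mul0r f0.
Qed.

(** [Phi] is constrained only on functions that vanish at 0, so a polynomial in [f] is written
    [f * q(f)], without constants. *)
Lemma is_cfc_poly f q : cfc_domain a f ->
  cfc_domain a (fun z => f z * q.[f z]) /\
  Phi (fun z => f z * q.[f z]) = pa (Phi f) (q * 'X).
Proof.
move=> df; elim/poly_ind: q => [|q c [dq Eq]].
  have E : (fun z : R[i]^o => f z * (0 : {poly R[i]}).[f z]) = (fun z => 0 * f z).
    by apply/funext => z; rewrite horner0 mulr0 mul0r.
  rewrite E; split; first exact: cfc_domainZ.
  by rewrite (cfc_scale PhiP _ df) scale0r mul0r /pa pev0.
have E : (fun z : R[i]^o => f z * (q * 'X + c%:P).[f z]) =
    (fun z => (f z * q.[f z]) * f z + c * f z).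
  by apply/funext => z; rewrite !hornerE mulrDr mulrA [c * f z]mulrC.
rewrite E; split.
  apply: cfc_domainD; last exact: cfc_domainZ.
  exact: cfc_domainM.
rewrite (cfc_add PhiP) //; [|exact: cfc_domainM|exact: cfc_domainZ].
rewrite (cfc_mul PhiP _ df) // (cfc_scale PhiP _ df) Eq.
have q0 : (q * 'X).[0] = 0 by rewrite hornerM hornerX mulr0.
by rewrite mulrDl mul_polyC paD paZ (paM _ q0 (hornerX 0)) paX.
Qed.

(** Contractivity follows from the algebraic axioms: the C*-identity reduces it to [h], the square
    of the modulus of [g], and [Phi] carries quasi-inverses of functions to quasi-inverses in [A],
    which bounds the spectrum of [Phi h]. *)
Lemma is_cfc_nrm g (e : R) : cfc_domain a g -> 0 <= e ->
  (forall z, quasi_spectrum a z -> nrm (g z) <= e) -> nrm (Phi g) <= e.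
Proof.
move=> dg e0 ge; rewrite -(@ler_pXn2r _ 2) ?nnegrE ?nrm_ge0 // -nrm_starM.
rewrite -(cfc_star PhiP) // -(cfc_mul PhiP) //; last exact: cfc_domain_conj.
have dc := cfc_domain_conj dg.
pose h z : R[i]^o := Num.conj (g z : R[i]) * g z; rewrite -/h.
have dh : cfc_domain a h by exact: cfc_domainM.
have sh : (Phi h)^⋆ = Phi h.
  rewrite -(cfc_star PhiP) //; congr Phi; apply/funext => z.
  by rewrite rmorphM /= conjCK mulrC.
have hE z : quasi_spectrum a z -> nrm (h z) <= e ^+ 2.
  by move=> az; rewrite nrmCM nrmC_conj -expr2 ler_pXn2r ?nnegrE ?nrm_ge0 // ge.
apply: nrm_spectral_radius; rewrite ?sqr_ge0 // => z [->|[z0 nz]].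
  by rewrite nrm0 sqr_ge0.
rewrite leNgt; apply/negP => zh; apply: nz.
have hz w : quasi_spectrum a w -> h w - z != 0.
  move=> aw; rewrite subr_eq0; apply/eqP => hwz.
  by have := hE w aw; rewrite hwz leNgt zh.
(* The pointwise quasi-inverse of h/z: (1 - h/z) (1 - k) = 1. *)
pose k w : R[i]^o := h w / (h w - z).
have dk : cfc_domain a k.
  case: dh => hc h0; split; last by rewrite /k h0 mul0r.
  apply/subspace_continuousP => w aw; apply: cvgM.
    exact: ((subspace_continuousP _ _).1 hc).
  apply: cvgV; first exact: hz.
  by apply: cvgB; [exact: ((subspace_continuousP _ _).1 hc)|exact: cvg_cst].
have dzh := cfc_domainZ z^-1 dh.
have Ezh : z^-1 *: Phi h = Phi (fun w => z^-1 * h w) by rewrite (cfc_scale PhiP).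
have sum_dom := cfc_domainD dzh dk.
have mul_dom := cfc_domainM dzh dk.
have E : Phi (fun w => (z^-1 * h w + k w) + (-1) * (z^-1 * h w * k w)) = 0.
  apply: is_cfc0; first by apply: cfc_domainD => //; exact: cfc_domainZ.
  move=> w; rewrite inE => aw; rewrite /k; have := hz w aw; move: (h w) => t tz.
  by field; rewrite tz z0.
have E1 : z^-1 *: Phi h + Phi k - (z^-1 *: Phi h) ⋅ Phi k = 0.
  rewrite -E (cfc_add PhiP) //; last exact: cfc_domainZ.
  by rewrite (cfc_scale PhiP (-1) mul_dom) scaleN1r (cfc_add PhiP dzh dk) (cfc_mul PhiP dzh dk) Ezh.
have comm : (z^-1 *: Phi h) ⋅ Phi k = Phi k ⋅ (z^-1 *: Phi h).
  rewrite Ezh -!(cfc_mul PhiP) //; congr Phi; apply/funext => w; exact: mulrC.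
by exists (Phi k); split=> //; rewrite -comm.
Qed.

Lemma is_cfc_poly_dist f g p (e : R) : cfc_domain a f -> cfc_domain a g ->
  p.[0] = 0 -> 0 <= e ->
  (forall z, quasi_spectrum a z -> nrm (p.[f z] - g z) <= e) ->
  nrm (pa (Phi f) p - Phi g) <= e.
Proof.
move=> df dg p0 e0 H; have /factor_theorem[q Eq] : root p 0 by rewrite rootE p0.
rewrite subr0 in Eq.
have [dq Phiq] := is_cfc_poly q df.
have -> : pa (Phi f) p - Phi g = Phi (fun z => f z * q.[f z] + (-1) * g z).
  rewrite (cfc_add PhiP) //; last exact: cfc_domainZ.
  by rewrite (cfc_scale PhiP) // scaleN1r Phiq Eq.
apply: is_cfc_nrm => //.
  by apply: cfc_domainD => //; exact: cfc_domainZ.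
by move=> z az; rewrite mulN1r; have := H z az; rewrite Eq hornerM hornerX mulrC.
Qed.

Lemma is_cfc_is_value f : a^⋆ = a -> cfc_domain a f -> is_cfc_value a f (Phi f).
Proof.
move=> sa df e e0; have [p [p0 pf]] := cfc_domain_poly_approx sa df e0.
exists p; split=> //; rewrite -[a in pa a p](cfc_id PhiP).
by apply: is_cfc_poly_dist => //; [exact: cfc_domain_id|exact: ltW].
Qed.

End uniqueness.

Lemma cfc_is_value a f : a^⋆ = a -> cfc_domain a f -> is_cfc_value a f (cfc a f).
Proof.
move=> sa df; rewrite /cfc.
have [|Phi PhiP ->] := @xgetPex _ 0 [set b | exists2 Phi, is_cfc a Phi & b = Phi f].
  by eexists; exists (fun f => xget 0 (is_cfc_value a f)); [exact: is_cfc_limit|].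
exact: is_cfc_is_value.
Qed.

(** In [cfc] the homomorphism may be chosen anew for each [f]. Every choice gives the same limit of
    polynomials, so the values do form one homomorphism. *)
Lemma cfcP a : a^⋆ = a -> is_cfc a (cfc a).
Proof.
move=> sa; have P := is_cfc_limit sa.
have E f : cfc_domain a f -> cfc a f = xget 0 (is_cfc_value a f).
  move=> df; apply: (is_cfc_value_uniq sa (cfc_is_value sa df)).
  exact: (is_cfc_is_value P sa df).
split.
- by move=> f g df dg fg; rewrite !E //; exact: (cfc_ext P).
- by move=> f g df dg; rewrite !E; [exact: (cfc_add P)|exact: dg|exact: df|exact: cfc_domainD].
- by move=> k f df; rewrite !E; [exact: (cfc_scale P)|exact: df|exact: cfc_domainZ].
- by move=> f g df dg; rewrite !E; [exact: (cfc_mul P)|exact: dg|exact: df|exact: cfc_domainM].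
- by move=> f df; rewrite !E; [exact: (cfc_star P)|exact: df|exact: cfc_domain_conj].
- by rewrite E; [exact: (cfc_id P)|exact: cfc_domain_id].
Qed.

End cfc_theory.

(** * Real functions of a self-adjoint element *)

Section real_calculus.
Context {R : realType} {A : cstarAlgType R}.
Implicit Types (a b c x y : A) (g h : R -> R).

Lemma continuous_max0 g : continuous g -> continuous (fun s => Num.max (g s) 0).
Proof.
move=> gc s; rewrite (_ : (fun s => _) = (fun s => (g s + `|g s|) / 2)).
  apply: cvgMl; apply: cvgD; [exact: gc|apply: cvg_norm; exact: gc].
apply/funext => t; have [t0|t0] := leP (g t) 0; first by rewrite ler0_norm // subrr mul0r.
by rewrite gtr0_norm // mulrDl -splitr.
Qed.

Definition rfun g (z : R[i]^o) : R[i]^o := (g (complex.Re z))%:C%C.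

Definition rcfc a g := cfc a (rfun g).

Lemma rfun_domain a g : continuous g -> g 0 = 0 -> cfc_domain a (rfun g).
Proof.
move=> gc g0; split; last by rewrite /rfun g0.
apply/within_nrmP => z az e e0.
have /cvgrPdist_lt/(_ _ e0)/nbhs_ballP[d /= d0 Hd] := gc (complex.Re z).
exists d => // w aw zw; rewrite /rfun -rmorphB nrmC_real; apply: Hd.
by rewrite /ball /= -raddfB (le_lt_trans (nrmC_Re _)).
Qed.

Lemma spectrum_realE a z : a^⋆ = a -> quasi_spectrum a z -> z = (complex.Re z)%:C%C.
Proof.
by move=> sa az; rewrite {1}[z]complexE (spectrum_real sa az) mulr0 addr0.
Qed.

Lemma rcfc_sa a g : a^⋆ = a -> continuous g -> g 0 = 0 -> (rcfc a g)^⋆ = rcfc a g.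
Proof.
move=> sa gc g0; rewrite -(cfc_star (cfcP sa)); last exact: rfun_domain.
by congr cfc; apply/funext => z; rewrite conjC_real.
Qed.

Lemma rcfc_ext a g h : a^⋆ = a -> continuous g -> g 0 = 0 -> continuous h -> h 0 = 0 ->
  (forall s, quasi_spectrum a s%:C%C -> g s = h s) -> rcfc a g = rcfc a h.
Proof.
move=> sa gc g0 hc h0 H; apply: (cfc_ext (cfcP sa)); rewrite -?/(cfc_domain _ _) //; try exact: rfun_domain.
by move=> z; rewrite inE /rfun => az; rewrite H // -(spectrum_realE sa az).
Qed.

Lemma rcfcD a g h : a^⋆ = a -> continuous g -> g 0 = 0 -> continuous h -> h 0 = 0 ->
  rcfc a (fun s => g s + h s) = rcfc a g + rcfc a h.
Proof.
move=> sa gc g0 hc h0; rewrite -(cfc_add (cfcP sa)); try exact: rfun_domain.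
by congr cfc; apply/funext => z; rewrite /rfun rmorphD.
Qed.

Lemma rcfcM a g h : a^⋆ = a -> continuous g -> g 0 = 0 -> continuous h -> h 0 = 0 ->
  rcfc a (fun s => g s * h s) = rcfc a g ⋅ rcfc a h.
Proof.
move=> sa gc g0 hc h0; rewrite -(cfc_mul (cfcP sa)); try exact: rfun_domain.
by congr cfc; apply/funext => z; rewrite /rfun rmorphM.
Qed.

Lemma rcfcZ a (k : R) g : a^⋆ = a -> continuous g -> g 0 = 0 ->
  rcfc a (fun s => k * g s) = k%:C%C *: rcfc a g.
Proof.
move=> sa gc g0; rewrite -(cfc_scale (cfcP sa)); try exact: rfun_domain.
by congr cfc; apply/funext => z; rewrite /rfun rmorphM.
Qed.

Lemma rcfc_id a : a^⋆ = a -> rcfc a id = a.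
Proof.
move=> sa; rewrite -[RHS](cfc_id (cfcP sa)); apply: (cfc_ext (cfcP sa)).
- by apply: rfun_domain => // s; exact: cvg_id.
- exact: cfc_domain_id.
- by move=> z; rewrite inE /rfun /= => /(spectrum_realE sa) <-.
Qed.

Lemma rcfcB a g h : a^⋆ = a -> continuous g -> g 0 = 0 -> continuous h -> h 0 = 0 ->
  rcfc a (fun s => g s - h s) = rcfc a g - rcfc a h.
Proof.
move=> sa gc g0 hc h0.
have hc' : continuous (fun s => -1 * h s) by move=> s; apply: cvgMr; exact: hc.
have h0' : -1 * h 0 = 0 by rewrite h0 mulr0.
rewrite (_ : (fun s => g s - h s) = (fun s => g s + -1 * h s)).
  by rewrite rcfcD // rcfcZ // rmorphN rmorph1 scaleN1r.
by apply/funext => s; rewrite mulN1r.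
Qed.

Lemma rcfc_nrm a g (m : R) : a^⋆ = a -> continuous g -> g 0 = 0 -> 0 <= m ->
  (forall s, quasi_spectrum a s%:C%C -> `|g s| <= m) -> nrm (rcfc a g) <= m.
Proof.
move=> sa gc g0 m0 H; apply: (is_cfc_nrm (cfcP sa)) => //; first exact: rfun_domain.
by move=> z az; rewrite /rfun nrmC_real H // -(spectrum_realE sa az).
Qed.

Lemma rcfc_ge a g s : a^⋆ = a -> continuous g -> g 0 = 0 ->
  quasi_spectrum a s%:C%C -> `|g s| <= nrm (rcfc a g).
Proof.
move=> sa gc g0 as_.
have := is_cfc_value_ge (cfc_is_value sa (rfun_domain a gc g0)) as_.
by rewrite /rfun /= nrmC_real.
Qed.

Lemma weierstrass_complex g (M e : R) : continuous g -> g 0 = 0 -> 0 < M -> 0 < e ->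
  exists p : {poly R[i]}, p.[0] = 0 /\
    forall s : R, `|s| <= M -> nrm (p.[s%:C%C] - (g s)%:C%C) <= e.
Proof.
move=> gc g0 M0 e0; have e2 : 0 < e / 2 by rewrite divr_gt0.
have [p Hp] := weierstrass gc M0 e2.
exists (map_poly (real_complex R) (p - p.[0]%:P)); split.
  rewrite -(rmorph0 (real_complex R)) horner_map /= !hornerE subrr.
  by [].
move=> s sM; rewrite horner_map /= -rmorphB nrmC_real hornerD hornerN hornerC addrAC.
rewrite (le_trans (ler_normB _ _)) // [e]splitr lerD ?Hp //.
by have := Hp 0; rewrite g0 subr0 normr0; apply; exact: ltW.
Qed.

Lemma rcfc_poly_dist a g (p : {poly R[i]}) (M e : R) : a^⋆ = a -> continuous g -> g 0 = 0 ->
  p.[0] = 0 -> nrm a <= M -> 0 <= e ->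
  (forall s : R, `|s| <= M -> nrm (p.[s%:C%C] - (g s)%:C%C) <= e) ->
  nrm (pa a p - rcfc a g) <= e.
Proof.
move=> sa gc g0 p0 aM e0 H; rewrite -{1}(cfc_id (cfcP sa)).
apply: (is_cfc_poly_dist (cfcP sa)) => //.
- exact: cfc_domain_id.
- exact: rfun_domain.
- move=> z az; rewrite {1}(spectrum_realE sa az) H //.
  by rewrite (le_trans _ aM) // (le_trans (nrmC_Re _)) // spectrum_bound.
Qed.

(** A polynomial close to [h] on an interval that contains all values of [g] on the spectrum of [a]
    is evaluated at g(a). That |g(s)| <= |g(a)| provides such an interval, in place of a spectral
    mapping theorem. *)
Lemma rcfc_comp a g h : a^⋆ = a -> continuous g -> g 0 = 0 -> continuous h -> h 0 = 0 ->
  rcfc (rcfc a g) h = rcfc a (h \o g).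
Proof.
move=> sa gc g0 hc h0; have sb := rcfc_sa sa gc g0; set b := rcfc a g in sb *.
have hgc : continuous (h \o g) by move=> s; apply: continuous_comp; [exact: gc|exact: hc].
have hg0 : (h \o g) 0 = 0 by rewrite /= g0.
apply: (is_cfc_value_uniq sb (cfc_is_value sb (rfun_domain _ hc h0))) => e e0.
have M0 : 0 < nrm b + 1 by rewrite ltr_wpDl ?nrm_ge0.
have [p [p0 Hp]] := weierstrass_complex hc h0 M0 e0.
exists p; split=> //.
  move=> z bz; rewrite {1}(spectrum_realE sb bz); apply: Hp.
  by rewrite (le_trans (nrmC_Re _)) // (le_trans (spectrum_bound bz)) // lerDl.
apply: (is_cfc_poly_dist (cfcP sa)); rewrite ?ltW //; try exact: rfun_domain.
move=> z az; rewrite /rfun; apply: Hp; rewrite (@le_trans _ _ (nrm b)) ?lerDl //.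
by apply: rcfc_ge => //; rewrite -(spectrum_realE sa az).
Qed.

Lemma star_sa x : (x^⋆ ⋅ x)^⋆ = x^⋆ ⋅ x. Proof. by rewrite cstarM cstarK. Qed.
Lemma sa_star x : (x ⋅ x^⋆)^⋆ = x ⋅ x^⋆. Proof. by rewrite cstarM cstarK. Qed.

Lemma pa_intertwine x (p : {poly R[i]}) : x ⋅ pa (x^⋆ ⋅ x) p = pa (x ⋅ x^⋆) p ⋅ x.
Proof.
elim/poly_ind: p => [|p c IH]; first by rewrite /pa !pev0 cmul0l cmul0r.
by rewrite !paXr cmulDr cmulDl cmulA IH cmulZr cmulZl -!cmulA.
Qed.

(** Polynomials satisfy the identity, and one polynomial approximates [g] for both elements because
    both have norm |x|^2. *)
Lemma rcfc_intertwine x g : continuous g -> g 0 = 0 ->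
  x ⋅ rcfc (x^⋆ ⋅ x) g = rcfc (x ⋅ x^⋆) g ⋅ x.
Proof.
move=> gc g0; apply/eqP; rewrite -subr_eq0; apply/eqP.
apply: (@nrm_eps0 _ _ (2 * nrm x)) => e e0.
have M0 : 0 < nrm x ^+ 2 + 1 by rewrite ltr_wpDl // sqr_ge0.
have [p [p0 Hp]] := weierstrass_complex gc g0 M0 e0.
have h1 := @rcfc_poly_dist (x^⋆ ⋅ x) g p _ _ (star_sa x) gc g0 p0 _ (ltW e0) Hp.
have h2 := @rcfc_poly_dist (x ⋅ x^⋆) g p _ _ (sa_star x) gc g0 p0 _ (ltW e0) Hp.
rewrite nrm_starM lerDl ler01 in h1; rewrite nrm_Mstar lerDl ler01 in h2.
have -> : x ⋅ rcfc (x^⋆ ⋅ x) g - rcfc (x ⋅ x^⋆) g ⋅ x =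
    (pa (x ⋅ x^⋆) p - rcfc (x ⋅ x^⋆) g) ⋅ x - x ⋅ (pa (x^⋆ ⋅ x) p - rcfc (x^⋆ ⋅ x) g).
  by rewrite cmulBl cmulBr pa_intertwine opprB [RHS]addrC addrA subrK.
apply: (le_trans (nrmB _ _)); apply: (le_trans (lerD (nrmM _ _) (nrmM _ _))).
have := h1 isT; have := h2 isT; have := nrm_ge0 x.
set u := nrm (_ - _); set v := nrm (_ - _); nra.
Qed.

End real_calculus.

(** * The positive cone *)

Section positivity.
Context {R : realType} {A : cstarAlgType R}.
Implicit Types (a b c x y : A) (g h : R -> R).

Definition psd a := a^⋆ = a /\ forall z, quasi_spectrum a z -> 0 <= complex.Re z.

Lemma opnorm_psd a (M : R) : a^⋆ = a -> 0 <= M ->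
  (forall x, nrm (M%:C%C *: x - a ⋅ x) <= M * nrm x) -> psd a.
Proof.
move=> sa M0 H; split=> // z az; have [->//|z0] := eqVneq z 0.
have : nrm ((- M)%:C%C + z) <= M.
  apply: (spectrum_opnorm M0 _ az z0) => x.
  by rewrite rmorphN scaleNr -nrmN opprD opprK.
move=> /(le_trans (nrmC_Re _)); rewrite raddfD /= ler_norml => /andP[+ _].
by rewrite lerDl.
Qed.

(* With [T y = M y - a y], the symmetry of [T] gives
   [|T^(2^n) x|^2 <= |x| |T^(2^(n+1)) x|]; this bounds [|T x|] by the growth
   rate of [T^(2^n) x], which the spectrum of [a] controls. *)
Lemma psd_opnorm a (M : R) : psd a -> nrm a <= M ->
  forall x, nrm (M%:C%C *: x - a ⋅ x) <= M * nrm x.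
Proof.
move=> [sa ap] aM x; have M0 : 0 <= M := le_trans (nrm_ge0 _) aM.
have [->|x0] := eqVneq x 0; first by rewrite cmul0r scaler0 subrr nrm0 mulr0.
pose T y := M%:C%C *: y - a ⋅ y.
have Tsym y z : (T y)^⋆ ⋅ z = y^⋆ ⋅ T z.
  rewrite /T cstarB cstarZ cstarM sa conjC_real cmulBl cmulBr cmulZl cmulZr.
  by rewrite cmulA.
have iterS' n y : iter n T (T y) = T (iter n T y) by rewrite -iterSr.
have Titer n y z : (iter n T y)^⋆ ⋅ z = y^⋆ ⋅ iter n T z.
  elim: n y z => [//|n IH] y z; rewrite iterS Tsym IH -iterSr.
  by [].
have X0 := nrm_gt0 x0; set X := nrm x in X0 *.
rewrite -/(T x) -ler_pdivrMr //.
apply: (@geo_le _ (fun n => 2 ^ n)%N X (2 * X)) => //.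
- by move=> n; exact: ltnW (ltn_expl _ _).
- by rewrite divr_ge0 ?nrm_ge0 ?ltW.
move=> n; apply: (@le_trans _ _ (nrm (iter (2 ^ n) T x))).
  elim: n => [|n IH]; first by rewrite expn0 expr1 mulrC divfK // gt_eqF.
  have : nrm (iter (2 ^ n) T x) ^+ 2 <= X * nrm (iter (2 ^ n.+1) T x).
    rewrite -nrm_starM Titer -iterD addnn -mul2n -expnS.
    by rewrite (le_trans (nrmM _ _)) // nrm_star.
  have : (X * (nrm (T x) / X) ^+ (2 ^ n)) ^+ 2 <= nrm (iter (2 ^ n) T x) ^+ 2.
    by rewrite ler_pXn2r ?nnegrE ?nrm_ge0 // mulr_ge0 ?exprn_ge0 ?divr_ge0 ?nrm_ge0 // ltW.
  move=> h1 h2; have := le_trans h1 h2.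
  by rewrite exprMn -exprM -expnSr expr2 -mulrA ler_pM2l.
move: (2 ^ n)%N => N.
(* (M - a)^N is split into the scalar M^N and p(a), where p(0) = 0 puts p(a) in [A]. Each part
   contributes at most M^N |x|; the resulting factor 2 disappears in [geo_le]. *)
pose p : {poly R[i]} := (M%:C%C%:P - 'X) ^+ N - ((M ^+ N)%:C%C)%:P.
have p0 : p.[0] = 0 by rewrite /p !(hornerE, horner_exp) subr0 rmorphXn subrr.
have -> : iter N T x = (M ^+ N)%:C%C *: x + pa a p ⋅ x.
  apply: uinj_inj; rewrite uinjD uinjM uinjZ -(pevE a p0) /p pevB pevX pevB !pevC pev_id.
  rewrite mulrBl -scalerAl mul1r addrC subrK.
  elim: N {p p0} => [|N IH]; first by rewrite mul1r.
  by rewrite iterS exprS -mulrA -IH /T uinjB uinjZ uinjM mulrBl -scalerAl mul1r.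
apply: (le_trans (nrmD _ _)); rewrite nrmZ nrmC_real ger0_norm ?exprn_ge0 //.
rewrite (_ : 2 * X * M ^+ N = M ^+ N * X + M ^+ N * X); last by ring.
rewrite lerD2l (le_trans (nrmM _ _)) // ler_wpM2r ?nrm_ge0 //.
apply: pa_bound; rewrite ?exprn_ge0 // => z az.
have s0 := ap _ az; have zE := spectrum_realE sa az.
have sM : complex.Re z <= M.
  by rewrite (le_trans _ aM) // (le_trans _ (spectrum_bound az)) // (le_trans (ler_norm _)) // nrmC_Re.
rewrite /p !(hornerE, horner_exp) zE -rmorphB -rmorphXn -rmorphB nrmC_real.
move: (complex.Re z) s0 sM => s s0 sM.
have h1 : 0 <= (M - s) ^+ N by rewrite exprn_ge0 // subr_ge0.
have h2 : (M - s) ^+ N <= M ^+ N by rewrite lerXn2r ?nnegrE ?subr_ge0 // gerBl.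
by rewrite ler_norml; apply/andP; split; lra.
Qed.

Lemma psdD a b : psd a -> psd b -> psd (a + b).
Proof.
move=> pa_ pb; apply: (@opnorm_psd _ (nrm a + nrm b)).
- by rewrite cstarD pa_.1 pb.1.
- by rewrite addr_ge0 ?nrm_ge0.
move=> x; rewrite rmorphD scalerDl cmulDl opprD addrACA mulrDl.
by rewrite (le_trans (nrmD _ _)) // lerD // psd_opnorm.
Qed.

Lemma sa_cvg (u : nat -> A) a : (forall n, (u n)^⋆ = u n) -> u @ \oo --> a -> a^⋆ = a.
Proof.
move=> us ua; have := star_cvg ua; rewrite (_ : (fun n => _) = u).
  by move=> /(cvg_unique (@norm_hausdorff _ _))/(_ ua) ->.
by apply/funext => n; rewrite us.
Qed.

Lemma psd_cvg (u : nat -> A) a : (forall n, psd (u n)) -> u @ \oo --> a -> psd a.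
Proof.
move=> us ua; apply: (@opnorm_psd _ (nrm a + 1)).
- by apply: sa_cvg ua => n; exact: (us n).1.
- by rewrite addr_ge0 ?nrm_ge0.
move=> x; apply/ler_addgt0Pr => e e0.
have x1 : 0 < nrm x + 1 by rewrite ltr_wpDl ?nrm_ge0.
have d0 : 0 < Num.min 1 (e / (nrm x + 1)) by rewrite lt_min ltr01 divr_gt0.
have /nrm_cvgP/(_ _ d0)[N /(_ N (leqnn _))] := ua.
rewrite le_min => /andP[h1]; rewrite ler_pdivlMr // => h2.
have uN : nrm (u N) <= nrm a + 1.
  rewrite -[u N](subrK a) addrC (le_trans (nrmD _ _)) // lerD2l nrmBC.
  exact: h1.
have := psd_opnorm (us N) uN x; set M := nrm a + 1 => h3.
have -> : M%:C%C *: x - a ⋅ x = (M%:C%C *: x - u N ⋅ x) - (a - u N) ⋅ x.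
  by rewrite cmulBl opprB addrA subrK.
apply: (le_trans (nrmB _ _)); rewrite lerD //.
apply: (le_trans (nrmM _ _)); apply: le_trans h2; rewrite ler_wpM2l ?nrm_ge0 // lerDl.
by [].
Qed.

Lemma psd_sqr b : b^⋆ = b -> psd (b ⋅ b).
Proof.
move=> sb; split; first by rewrite cstarM sb.
have X0 := @hornerX R[i] 0.
have E : b ⋅ b = pa b ('X * 'X) by rewrite (paM b X0 X0) paX.
move=> z; rewrite E.
have XX0 : ('X * 'X : {poly R[i]}).[0] = 0 by rewrite hornerM hornerX mulr0.
move=> /(spectrum_poly XX0)[w bw <-]; rewrite hornerM hornerX (spectrum_realE sb bw).
by rewrite -rmorphM /= -expr2 sqr_ge0.
Qed.

Lemma sqrt_cont : continuous (@Num.sqrt R).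
Proof. exact: sqrt_continuous. Qed.

Lemma psd_sqrt a : psd a -> exists2 r, r^⋆ = r & a = r ⋅ r.
Proof.
move=> [sa ap]; have s0 := @sqrtr0 R.
exists (rcfc a Num.sqrt); first exact: rcfc_sa sqrt_cont s0.
rewrite -(rcfcM sa sqrt_cont s0 sqrt_cont s0) -{1}(rcfc_id sa).
apply: rcfc_ext; rewrite ?s0 ?mulr0 //.
- by move=> s; exact: cvg_id.
- by move=> s; apply: cvgM; exact: sqrt_cont.
- by move=> s /ap /= s0'; rewrite -expr2 sqr_sqrtr.
Qed.

Lemma rcfc_psd a g : a^⋆ = a -> continuous g -> g 0 = 0 -> (forall s, 0 <= g s) ->
  psd (rcfc a g).
Proof.
move=> sa gc g0 gp.
have rc : continuous (fun s => Num.sqrt (g s)).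
  by move=> s; apply: continuous_comp; [exact: gc|exact: sqrt_cont].
have r0 : Num.sqrt (g 0) = 0 by rewrite g0 sqrtr0.
have -> : rcfc a g = rcfc a (fun s => Num.sqrt (g s)) ⋅ rcfc a (fun s => Num.sqrt (g s)).
  rewrite -(rcfcM sa rc r0 rc r0); congr rcfc; apply/funext => s.
  by rewrite -expr2 sqr_sqrtr.
exact/psd_sqr/rcfc_sa.
Qed.

Lemma psd_anti c : psd c -> psd (- c) -> c = 0.
Proof.
move=> [sc pc] [_ nc]; apply: nrm_le0; apply: nrm_spectral_radius => // z cz.
have h1 := pc _ cz; have h2 : 0 <= complex.Re (- z).
  apply: nc; apply/spectrumP => /(@uinv_Z _ _ (-1)).
  rewrite oppr_eq0 oner_eq0 => /(_ isT); rewrite scaleN1r uinjN scaleNr opprB opprK addrC.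
  by move/spectrumP: cz.
rewrite raddfN /= oppr_ge0 in h2; rewrite (spectrum_realE sc cz) nrmC_real.
by rewrite normr_le0; apply/eqP/le_anti; rewrite h1 h2.
Qed.

Lemma spectrum_comm x y z : z != 0 -> quasi_spectrum (x ⋅ y) z -> quasi_spectrum (y ⋅ x) z.
Proof.
move=> z0 /spectrumP H; apply/spectrumP => H'; apply: H.
have E u v : uinj (u ⋅ v : A) - z%:A = (- z) *: (1 - (z^-1 *: uinj u) * uinj v).
  rewrite scalerBr -scalerAl -uinjM scalerA mulNr divff // scaleN1r opprK addrC.
  by rewrite scaleNr.
have zN : - z != 0 by rewrite oppr_eq0.
rewrite E; apply/(uinv_Zr _ zN); apply: uinv_1B.
move: H'; rewrite E => /(uinv_Zr _ zN).
by rewrite -scalerAl -scalerAr.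
Qed.

(* With [y = a_- x], where [a_-] is the negative part of [a = x x^*],
   [- y y^* = a_-^3] is positive, hence so is [- y^* y]; but the sum
   [y y^* + y^* y] is a sum of squares, so that [y = 0]. *)
Lemma psd_Mstar x : psd (x ⋅ x^⋆).
Proof.
set a := x ⋅ x^⋆; have sa : a^⋆ = a by exact: sa_star.
pose f (s : R) := Num.max (- s) 0.
have fc : continuous f.
  by apply: continuous_max0 => s; apply: cvgN; exact: cvg_id.
have f0 : f 0 = 0 by rewrite /f oppr0 maxxx.
have idc : continuous (@id R) by move=> s; exact: cvg_id.
have fge s : 0 <= f s by rewrite le_max lexx orbT.
pose y := rcfc a f ⋅ x.
have sf := rcfc_sa sa fc f0.
have cMc g h : continuous g -> continuous h -> continuous (fun s : R => g s * h s).
  by move=> gc hc s; apply: cvgM; [exact: gc|exact: hc].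
have f2c := cMc _ _ fc fc; have f20 : f 0 * f 0 = 0 by rewrite f0 mulr0.
have f3c := cMc _ _ f2c fc; have f30 : f 0 * f 0 * f 0 = 0 by rewrite f0 mulr0.
have yy : y ⋅ y^⋆ = - rcfc a (fun s => f s * f s * f s).
  rewrite /y cstarM sf cmulA -(cmulA _ x) -/a -{2}(rcfc_id sa).
  rewrite -(rcfcM sa fc f0 idc erefl) -(rcfcM sa _ _ fc f0); last by rewrite mulr0.
    rewrite -scaleN1r -(rmorph1 (real_complex R)) -rmorphN -(rcfcZ _ sa f3c f30).
    congr rcfc; apply/funext => s; rewrite /f; have [s0|s0] := leP 0 (- s); first by ring.
    by rewrite !mulr0.
  exact: cMc.
have p1 : psd (- (y ⋅ y^⋆)).
  rewrite yy opprK; apply: rcfc_psd => // s.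
  by rewrite !mulr_ge0.
have p2 : psd (- (y^⋆ ⋅ y)).
  split; first by rewrite cstarN star_sa.
  move=> z yz; have [->//|z0] := eqVneq z 0.
  by apply: p1.2; rewrite -cmulNl; apply: spectrum_comm => //; rewrite cmulNr.
(* Twice the sum equals u^2 + v^2 for the self-adjoint [u = y + y^⋆] and [v = i (y - y^⋆)]. *)
have p3 : psd (y ⋅ y^⋆ + y^⋆ ⋅ y + (y ⋅ y^⋆ + y^⋆ ⋅ y)).
  have i2 : ('i%C * 'i%C : R[i]) = -1 by rewrite -expr2 sqr_i.
  have ic : Num.conj ('i%C : R[i]) = - 'i%C by rewrite /Num.conj; simpc.
  pose u := y + y^⋆; pose v := 'i%C *: (y - y^⋆).
  have su : u^⋆ = u by rewrite cstarD cstarK addrC.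
  have sv : v^⋆ = v by rewrite cstarZ cstarB cstarK ic scaleNr -scalerN opprB.
  have -> : y ⋅ y^⋆ + y^⋆ ⋅ y + (y ⋅ y^⋆ + y^⋆ ⋅ y) = u ⋅ u + v ⋅ v.
    rewrite /u /v cmulZl cmulZr scalerA i2 scaleN1r -cmulNl opprB.
    have -> : (y + y^⋆) ⋅ (y + y^⋆) = (y ⋅ y^⋆ + y^⋆ ⋅ y) + (y ⋅ y + y^⋆ ⋅ y^⋆).
      by rewrite cmulDl !cmulDr [y ⋅ y + y ⋅ y^⋆]addrC [LHS]addrACA.
    have -> : (y^⋆ - y) ⋅ (y - y^⋆) = (y ⋅ y^⋆ + y^⋆ ⋅ y) - (y ⋅ y + y^⋆ ⋅ y^⋆).
      rewrite cmulBl !cmulBr opprB addrACA [y^⋆ ⋅ y + _]addrC -opprD.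
      by rewrite [y^⋆ ⋅ y^⋆ + _]addrC.
    by rewrite [RHS]addrACA subrr addr0.
  by apply: psdD; exact: psd_sqr.
have y0 : y^⋆ ⋅ y = 0.
  have p4 : psd (y^⋆ ⋅ y + y^⋆ ⋅ y).
    have := psdD (psdD p3 p1) p1; set q := y ⋅ y^⋆; set r := y^⋆ ⋅ y.
    by rewrite -addrA -opprD [q + r + _]addrACA addrAC subrr add0r.
  have := psdD p2 p2; rewrite -opprD => /(psd_anti p4) /eqP.
  rewrite -mulr2n -(scaler_nat 2 (y^⋆ ⋅ y)) scaler_eq0 pnatr_eq0 /=.
  by move=> /eqP.
have {}y0 : y = 0 by exact: starM_eq0.
have f3z : rcfc a (fun s => f s * f s * f s) = 0.
  by apply/eqP; rewrite -oppr_eq0 -yy y0 cmul0l.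
(* From a_-^3 = 0 follows a_-^4 = 0, and two uses of the C*-identity give a_- = 0. *)
have b0 : rcfc a f = 0.
  have b4 : (rcfc a f ⋅ rcfc a f)^⋆ ⋅ (rcfc a f ⋅ rcfc a f) = 0.
    have E3 : rcfc a f ⋅ rcfc a f ⋅ rcfc a f = 0.
      by rewrite -(rcfcM sa fc f0 fc f0) -(rcfcM sa f2c f20 fc f0).
    by rewrite cstarM sf cmulA E3 cmul0l.
  have := starM_eq0 b4; rewrite -{1}sf; exact: starM_eq0.
pose f' (s : R) := Num.max s 0.
have f'c : continuous f' by apply: continuous_max0 => s; exact: cvg_id.
have f'0 : f' 0 = 0 by rewrite /f' maxxx.
suff -> : a = rcfc a f' by apply: rcfc_psd => // s; rewrite le_max lexx orbT.
rewrite -[RHS]subr0 -b0 -(rcfcB sa f'c f'0 fc f0) -{1}(rcfc_id sa); congr rcfc.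
apply/funext => s; rewrite /f /f'; case: (leP 0 s) => s0.
  by rewrite max_r ?oppr_le0 // subr0.
by rewrite max_l ?oppr_ge0 ?ltW // sub0r opprK.
Qed.

Lemma pos_coneP a : pos_cone A a <-> psd a.
Proof.
split=> [[x ->]|/psd_sqrt[r sr ->]]; first exact: psd_Mstar.
by exists r; rewrite sr.
Qed.

Lemma pos_cone_sa a : pos_cone A a -> a^⋆ = a.
Proof. by move=> /pos_coneP[]. Qed.

Lemma pos_coneD a b : pos_cone A a -> pos_cone A b -> pos_cone A (a + b).
Proof. by move=> /pos_coneP ? /pos_coneP ?; exact/pos_coneP/psdD. Qed.

Lemma pos_cone_cvg (u : nat -> A) a :
  (forall n, pos_cone A (u n)) -> u @ \oo --> a -> pos_cone A a.
Proof. by move=> Hu ua; apply/pos_coneP; apply: psd_cvg ua => n; exact/pos_coneP. Qed.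

Lemma pos_cone_Mstar x : pos_cone A (x ⋅ x^⋆). Proof. by exists x. Qed.

Lemma pos_cone_starM x : pos_cone A (x^⋆ ⋅ x).
Proof. by exists (x^⋆); rewrite cstarK. Qed.

Lemma pos_cone_conj x a : pos_cone A a -> pos_cone A (x ⋅ a ⋅ x^⋆).
Proof. by move=> [v ->]; exists (x ⋅ v); rewrite cstarM !cmulA. Qed.

Lemma pos_cone0 : pos_cone A 0.
Proof. by exists 0; rewrite cmul0l. Qed.

(** With L = |b - a|, the element L + a = b + (L - (b - a)) acts with norm at most |b| + L, since b
    - a is positive. Hence L + z <= |b| + L for every z in the spectrum of [a]. *)
Lemma cle_nrm a b : pos_cone A a -> cle a b -> nrm a <= nrm b.
Proof.
move=> a0 ab; have b0 : pos_cone A b by have := pos_coneD ab a0; rewrite subrK.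
have /pos_coneP[sa ap] := a0; have /pos_coneP abp := ab.
apply: nrm_spectral_radius; rewrite ?nrm_ge0 // => z az.
have [->|z0] := eqVneq z 0; first by rewrite nrm0 nrm_ge0.
set L := nrm (b - a).
have : nrm (L%:C%C + z) <= nrm b + L.
  apply: (@spectrum_opnorm _ _ _ a); rewrite ?addr_ge0 ?nrm_ge0 // => x.
  have -> : L%:C%C *: x + a ⋅ x = b ⋅ x + (L%:C%C *: x - (b - a) ⋅ x).
    by rewrite cmulBl opprB [RHS]addrC -addrA subrK.
  by rewrite mulrDl (le_trans (nrmD _ _)) // lerD ?nrmM // psd_opnorm.
rewrite (spectrum_realE sa az) -rmorphD !nrmC_real ger0_norm; last by rewrite addr_ge0 ?nrm_ge0 ?ap.
by rewrite ger0_norm ?ap // addrC lerD2r.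
Qed.

End positivity.

(** * Traces and cutdowns *)

Section cutdown.
Context {R : realType} {A : cstarAlgType R}.
Implicit Types (a b c x y : A) (g h : R -> R) (e d s : R).

Definition trunc e s := Num.max (s - e) 0.

Lemma cutdownE a e : cutdown a e = rcfc a (trunc e).
Proof. by []. Qed.

Lemma trunc_cont e : continuous (trunc e).
Proof. by apply: continuous_max0 => s; apply: cvgB; [exact: cvg_id|exact: cvg_cst]. Qed.

Arguments trunc_cont : clear implicits.

Lemma trunc0 e : 0 <= e -> trunc e 0 = 0.
Proof. by move=> e0; rewrite /trunc sub0r max_r // oppr_le0. Qed.

Lemma trunc_ge0 e s : 0 <= trunc e s.
Proof. by rewrite le_max lexx orbT. Qed.

Lemma trunc_le e s : s <= e -> trunc e s = 0.
Proof. by move=> se; rewrite /trunc max_r // subr_le0. Qed.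

Lemma trunc_ge e s : e <= s -> trunc e s = s - e.
Proof. by move=> se; rewrite /trunc max_l // subr_ge0. Qed.

Lemma contM g h : continuous g -> continuous h -> continuous (fun s => g s * h s).
Proof. by move=> gc hc s; apply: cvgM; [exact: gc|exact: hc]. Qed.

Lemma contB g h : continuous g -> continuous h -> continuous (fun s => g s - h s).
Proof. by move=> gc hc s; apply: cvgB; [exact: gc|exact: hc]. Qed.

Lemma contD g h : continuous g -> continuous h -> continuous (fun s => g s + h s).
Proof. by move=> gc hc s; apply: cvgD; [exact: gc|exact: hc]. Qed.

Lemma cont_sqrt g : continuous g -> continuous (fun s => Num.sqrt (g s)).
Proof. by move=> gc s; apply: continuous_comp; [exact: gc|exact: sqrt_cont]. Qed.

Lemma cont_id : continuous (@id R).
Proof. by move=> s; exact: cvg_id. Qed.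

Lemma rcfc_pos a g : a^⋆ = a -> continuous g -> g 0 = 0 ->
  (forall s, quasi_spectrum a s%:C%C -> 0 <= g s) -> pos_cone A (rcfc a g).
Proof.
move=> sa gc g0 H; rewrite (@rcfc_ext _ _ a g (fun s => Num.max (g s) 0)) //.
- apply/pos_coneP/rcfc_psd => //; first exact: continuous_max0.
    by rewrite g0 maxxx.
  by move=> s; rewrite le_max lexx orbT.
- exact: continuous_max0.
- by rewrite g0 maxxx.
- by move=> s /H s0; rewrite max_l.
Qed.

Lemma rcfc_mulr a g : a^⋆ = a -> continuous g -> g 0 = 0 ->
  rcfc a g ⋅ a = rcfc a (fun s => g s * s).
Proof. by move=> sa gc g0; rewrite -{2}(rcfc_id sa) -(rcfcM sa gc g0 cont_id erefl). Qed.

Lemma rcfc_sandwich a g : a^⋆ = a -> continuous g -> g 0 = 0 ->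
  rcfc a g ⋅ a ⋅ rcfc a g = rcfc a (fun s => g s * s * g s).
Proof.
move=> sa gc g0; rewrite rcfc_mulr //; have gid := contM gc cont_id.
by rewrite -(rcfcM sa gid _ gc g0) ?mulr0.
Qed.

Lemma pos_cone_spectrum a s : pos_cone A a -> quasi_spectrum a s%:C%C -> 0 <= s.
Proof. by move=> /pos_coneP[_ H] /H. Qed.

Lemma cutdown_pos a e : pos_cone A a -> 0 <= e -> pos_cone A (cutdown a e).
Proof.
move=> a0 e0; rewrite cutdownE; apply: (rcfc_pos (pos_cone_sa a0) (trunc_cont e) (trunc0 e0)) => s _.
exact: trunc_ge0.
Qed.

Lemma cutdown_mono a d e : pos_cone A a -> 0 <= d -> d <= e ->
  cle (cutdown a e) (cutdown a d).
Proof.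
move=> a0 d0 de; have sa := pos_cone_sa a0; have e0 := le_trans d0 de.
rewrite /cle !cutdownE -(rcfcB sa (trunc_cont d) (trunc0 d0) (trunc_cont e) (trunc0 e0)).
apply: rcfc_pos => //; first by apply: contB; exact: trunc_cont.
  by rewrite !trunc0 // subrr.
move=> s _; rewrite subr_ge0 /trunc ge_max !le_max lexx orbT andbT.
by rewrite lerD2l lerN2 de.
Qed.

Lemma cutdown0 a : pos_cone A a -> cutdown a 0 = a.
Proof.
move=> a0; have sa := pos_cone_sa a0; rewrite cutdownE -[RHS](rcfc_id sa).
apply: rcfc_ext => //; [exact: trunc_cont|exact: trunc0|exact: cont_id|].
by move=> s /(pos_cone_spectrum a0) s0; rewrite trunc_ge // subr0.
Qed.

Lemma cutdown_le a e : pos_cone A a -> 0 <= e -> cle (cutdown a e) a.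
Proof. by move=> a0 e0; rewrite -{2}(cutdown0 a0); exact: cutdown_mono. Qed.

Lemma cutdown_nrm a e : pos_cone A a -> 0 <= e -> nrm (a - cutdown a e) <= e.
Proof.
move=> a0 e0; have sa := pos_cone_sa a0; have c := trunc_cont.
rewrite cutdownE -{1}(rcfc_id sa) -(rcfcB sa cont_id erefl (c e) (trunc0 e0)).
apply: rcfc_nrm => //; first by apply: contB => //; exact: cont_id.
  by rewrite trunc0 ?subrr.
move=> s /(pos_cone_spectrum a0) s0; have [se|/ltW es] := leP s e.
  by rewrite trunc_le // subr0 ger0_norm.
by rewrite trunc_ge // opprB addrC subrK ger0_norm.
Qed.

Lemma cutdown_cutdown a d e : pos_cone A a -> 0 <= d -> 0 <= e ->
  cutdown (cutdown a d) e = cutdown a (d + e).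
Proof.
move=> a0 d0 e0; have sa := pos_cone_sa a0; rewrite !cutdownE.
rewrite (rcfc_comp sa (trunc_cont d) (trunc0 d0) (trunc_cont e) (trunc0 e0)).
congr rcfc; apply/funext => s /=; have [sd|/ltW ds] := leP s d.
  by rewrite [trunc d s]trunc_le // trunc0 // trunc_le // ler_wpDr.
by rewrite [trunc d s]trunc_ge // /trunc opprD addrA.
Qed.

Lemma cutdown_of0 e : 0 <= e -> cutdown (0 : A) e = 0.
Proof.
move=> e0; apply: nrm_le0; rewrite cutdownE; apply: rcfc_nrm => //.
- by rewrite cstar0.
- exact: trunc_cont.
- exact: trunc0.
move=> s /spectrum_bound; rewrite nrm0 nrmC_real normr_le0 => /eqP ->.
by rewrite trunc0 ?normr0.
Qed.

(* [trunc e s / (s - (e - d))], extended by 0 to [s <= e]. *)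
Definition truncq (e d s : R) := trunc e s / (trunc e s + d).

Lemma truncq_cont e d : 0 < d -> continuous (truncq e d).
Proof.
move=> d0; apply: contM; first exact: trunc_cont.
move=> s; apply: cvgV; last by apply: cvgD; [exact: trunc_cont|exact: cvg_cst].
by rewrite gt_eqF // ltr_wpDl // trunc_ge0.
Qed.

Lemma truncq_ge0 e d s : 0 < d -> 0 <= truncq e d s.
Proof. by move=> d0; rewrite divr_ge0 ?addr_ge0 ?trunc_ge0 // ltW. Qed.

Lemma truncq_le1 e d s : 0 < d -> truncq e d s <= 1.
Proof.
by move=> d0; rewrite ler_pdivrMr ?mul1r ?lerDl ?ltW // ltr_wpDl // trunc_ge0.
Qed.

Lemma truncq0 e d : 0 <= e -> truncq e d 0 = 0.
Proof. by move=> e0; rewrite /truncq trunc0 // mul0r. Qed.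

Lemma truncqM e d s : 0 < d -> truncq e d s * (s - (e - d)) = trunc e s.
Proof.
move=> d0; have [se|/ltW es] := leP s e; first by rewrite /truncq trunc_le // !mul0r.
rewrite /truncq trunc_ge // opprB [d - e]addrC addrA divfK // gt_eqF //.
by rewrite ltr_wpDl // subr_ge0.
Qed.

End cutdown.
Arguments trunc_cont {R} e.

(** * Traces without lower semicontinuity, and their values on cutdowns *)

Section algebraic_traces.
Context {R : realType} {A : cstarAlgType R}.
Implicit Types (a b c x y : A) (e d s : R) (t : A -> \bar R).

Record alg_trace t : Prop := AlgTrace {
  alg_trace_ge0 : forall a, (0 <= t a)%E;
  alg_trace0 : t 0 = 0%E;
  alg_traceD : forall a b, pos_cone A a -> pos_cone A b -> t (a + b) = (t a + t b)%E;
  alg_traceC : forall x, t (x ⋅ x^⋆) = t (x^⋆ ⋅ x)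
}.

Context (t : A -> \bar R).
Hypothesis tP : alg_trace t.

Lemma alg_trace_mono a b : pos_cone A a -> cle a b -> (t a <= t b)%E.
Proof.
move=> a0 ab; rewrite -[b](subrK a) addrC (alg_traceD tP) //.
by rewrite leeDl // (alg_trace_ge0 tP).
Qed.

(* With [h(s)^2 = (s - e)_+ / (s - d)] and [d = |a - b| < e], one has
   [(a - e)_+ = h(a) (a - d) h(a) <= h(a) b h(a)], and the latter is
   equivalent to [b^{1/2} h(a)^2 b^{1/2} <= b]. *)
Lemma alg_trace_cutdown_near a b (e d : R) : pos_cone A a -> pos_cone A b ->
  (0 <= d) -> (d < e) -> (nrm (a - b) <= d) -> (t (cutdown a e) <= t b)%E.
Proof.
move=> a0 b0 d0 de abd; have sa := pos_cone_sa a0; have sb := pos_cone_sa b0.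
have e0 : (0 <= e) := le_trans d0 (ltW de).
have ed : (0 < e - d) by rewrite subr_gt0.
pose q := truncq e (e - d).
have qc : continuous q by exact: truncq_cont.
have q0 : (q 0 = 0) by exact: truncq0.
have qge s : (0 <= q s) by exact: truncq_ge0.
have qle s : (q s <= 1) by exact: truncq_le1.
pose h s := Num.sqrt (q s).
have hc : continuous h by exact: cont_sqrt.
have h0 : (h 0 = 0) by rewrite /h q0 sqrtr0.
have hh s : (h s * h s = q s) by rewrite -expr2 sqr_sqrtr.
have hhE : (fun s => h s * h s) = q by apply/funext.
(* The square root of 1 - q in the unitization is 1 - g, and g(0) = 0 puts [G] in [A]. Then
   [1 - H^2 = (1 - G)^2]. *)
pose g (s : R) := (1 - Num.sqrt (1 - q s)).
have gc : continuous g.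
  apply: contB; first by move=> s; exact: cvg_cst.
  by apply: cont_sqrt; apply: contB => //; move=> s; exact: cvg_cst.
have g0 : (g 0 = 0) by rewrite /g q0 subr0 sqrtr1 subrr.
have gg s : (g s + g s - g s * g s = q s).
  rewrite /g; have : (Num.sqrt (1 - q s) ^+ 2 = 1 - q s).
    by rewrite sqr_sqrtr // subr_ge0.
  by move: (Num.sqrt _) => r r2; ring: r2.
set H := rcfc a h; have sH : H^⋆ = H by exact: rcfc_sa.
set G := rcfc a g; have sG : G^⋆ = G by exact: rcfc_sa.
have HH : H ⋅ H = G + G - G ⋅ G.
  rewrite -(rcfcM sa hc h0 hc h0) hhE /G -(rcfcM sa gc g0 gc g0).
  have g2c : continuous (fun s => g s + g s) by exact: contD.
  have gm : continuous (fun s => g s * g s) by exact: contM.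
  rewrite -(rcfcD sa gc g0 gc g0) -rcfcB ?g0 ?addr0 ?mulr0 //.
  by congr rcfc; apply/funext => s; rewrite gg.
have ineq1 : cle (cutdown a e) (H ⋅ b ⋅ H).
  pose c := (b - a); have sc : c^⋆ = c by rewrite cstarB sa sb.
  have cs s : quasi_spectrum c s%:C%C -> (0 <= s + d).
    move=> /spectrum_bound; rewrite nrmC_real nrmBC => /le_trans/(_ abd).
    by rewrite ler_norml => /andP[+ _]; rewrite -lerBlDr sub0r.
  (* As |c| <= d, c + d has a square root in the unitization; it is sqrt d + K with [K] in [A]. *)
  pose k s := (Num.sqrt (s + d) - Num.sqrt d).
  have kc : continuous k.
    apply: contB; last by move=> s; exact: cvg_cst.
    by apply: cont_sqrt; apply: contD; [exact: cont_id|move=> s; exact: cvg_cst].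
  have k0 : (k 0 = 0) by rewrite /k add0r subrr.
  set K := rcfc c k; have sK : K^⋆ = K by exact: rcfc_sa.
  set rd := (Num.sqrt d)%:C%C : R[i].
  have rdrd : (rd * rd = d%:C%C :> R[i]) by rewrite -rmorphM -expr2 sqr_sqrtr.
  have KE : (rd + rd) *: K + K ⋅ K = c.
    have k2 : continuous (fun s => k s * k s) by exact: contM.
    have k1 : continuous (fun s => (Num.sqrt d + Num.sqrt d) * k s).
      by apply: contM => //; move=> s; exact: cvg_cst.
    rewrite -(rcfcM sc kc k0 kc k0) -rmorphD -(rcfcZ _ sc kc k0) -rcfcD ?k0 ?mulr0 //.
    rewrite -[RHS](rcfc_id sc); apply: rcfc_ext; rewrite ?k0 ?mulr0 ?addr0 //.
    - exact: contD.
    - exact: cont_id.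
    - move=> s /cs sd; rewrite /k.
      have h1 : (Num.sqrt (s + d) ^+ 2 = s + d) by rewrite sqr_sqrtr.
      have h2 : (Num.sqrt d ^+ 2 = d) by rewrite sqr_sqrtr.
      move: (Num.sqrt (s + d)) (Num.sqrt d) h1 h2 => u v h1 h2.
      by ring: h1 h2.
  pose z := rd *: H + H ⋅ K.
  have zz : z ⋅ z^⋆ = d%:C%C *: (H ⋅ H) + H ⋅ c ⋅ H.
    have -> : H ⋅ c ⋅ H = rd *: (H ⋅ K ⋅ H) + (rd *: (H ⋅ K ⋅ H) + H ⋅ K ⋅ K ⋅ H).
      transitivity (H ⋅ ((rd + rd) *: K + K ⋅ K) ⋅ H); first by rewrite KE.
      by rewrite cmulDr cmulDl cmulZr cmulZl scalerDl -addrA !cmulA.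
    rewrite /z cstarD cstarZ conjC_real -/rd cstarM sH sK cmulDl !cmulDr.
    by rewrite !(cmulZl, cmulZr) scalerA rdrd -addrA !cmulA.
  have E : (H ⋅ b ⋅ H - cutdown a e) = z ⋅ z^⋆.
    have HaH : H ⋅ a ⋅ H = d%:C%C *: (H ⋅ H) + cutdown a e.
      rewrite (rcfc_sandwich sa hc h0) cutdownE -(rcfcM sa hc h0 hc h0) hhE.
      have dq : continuous (fun s => d * q s).
        by apply: contM => //; move=> s; exact: cvg_cst.
      have dq0 : d * q 0 = 0 by rewrite q0 mulr0.
      rewrite -(rcfcZ d sa qc q0) -(rcfcD sa dq dq0 (trunc_cont e) (trunc0 e0)).
      congr rcfc; apply/funext => s; rewrite mulrAC hh -(truncqM e s ed) -/(q s).
      by ring.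
    rewrite zz /c cmulBr cmulBl HaH opprD [RHS]addrCA.
    by rewrite (addrA (d%:C%C *: _)) subrr add0r.
  by rewrite /cle E; exact: pos_cone_Mstar.
(* Any [v] with [b = v ⋅ v^⋆] does the work of the square root of [b]: [H ⋅ b ⋅ H] is traded for
   [(H ⋅ v)^⋆ ⋅ (H ⋅ v)], which lies below [v^⋆ ⋅ v], and this is traded for [b]. *)
have [v bE] := b0.
have E1 : H ⋅ b ⋅ H = (H ⋅ v) ⋅ (H ⋅ v)^⋆ by rewrite cstarM sH bE !cmulA.
have ineq2 : cle ((H ⋅ v)^⋆ ⋅ (H ⋅ v)) (v^⋆ ⋅ v).
  pose w := (v - G ⋅ v).
  suff E : (v^⋆ ⋅ v - (H ⋅ v)^⋆ ⋅ (H ⋅ v)) = w^⋆ ⋅ w.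
    by rewrite /cle E; exact: pos_cone_starM.
  rewrite /w cstarB !cstarM sH sG -cmulA (cmulA H) HH !(cmulBl, cmulBr, cmulDl, cmulDr).
  by rewrite -!cmulA -(addrA _ _ (- _)) opprD addrA.
apply: (@le_trans _ _ (t (H ⋅ b ⋅ H))).
  by apply: alg_trace_mono => //; exact: cutdown_pos.
rewrite E1 (alg_traceC tP) bE (alg_traceC tP).
by apply: alg_trace_mono => //; exact: pos_cone_starM.
Qed.

(** With h(s)^2 s = (s - e)_+ and [y = x h(x^⋆ x)], the two cutdowns are [y ⋅ y^⋆] and [y^⋆ ⋅ y], by
    the intertwining relation. *)
Lemma alg_trace_cutdownC x (e : R) : (0 < e) ->
  t (cutdown (x ⋅ x^⋆) e) = t (cutdown (x^⋆ ⋅ x) e).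
Proof.
move=> e0; have e0' := ltW e0.
pose q := truncq e e.
have qc : continuous q by exact: truncq_cont.
have q0 : (q 0 = 0) by exact: truncq0.
have qge s : (0 <= q s) by exact: truncq_ge0.
pose h s := Num.sqrt (q s).
have hc : continuous h by exact: cont_sqrt.
have h0 : (h 0 = 0) by rewrite /h q0 sqrtr0.
have hh s : (h s * h s = q s) by rewrite -expr2 sqr_sqrtr.
have qE s : (q s * s = trunc e s).
  by have := truncqM e s e0; rewrite subrr subr0.
have cutE a : a^⋆ = a -> rcfc a (fun s => h s * h s) ⋅ a = cutdown a e.
  move=> sa; have hhc := contM hc hc.
  rewrite cutdownE -{2}(rcfc_id sa) -rcfcM ?h0 ?mulr0 //; last exact: cont_id.
  by congr rcfc; apply/funext => s; rewrite hh /= qE.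
pose y := x ⋅ rcfc (x^⋆ ⋅ x) h.
have sK := rcfc_sa (star_sa x) hc h0.
have -> : cutdown (x ⋅ x^⋆) e = y ⋅ y^⋆.
  rewrite /y cstarM sK -cutE ?sa_star // (rcfcM _ hc h0 hc h0) ?sa_star //.
  rewrite (rcfc_intertwine x hc h0) !cmulA -(cmulA _ x (rcfc (x^⋆ ⋅ x) h)).
  by rewrite (rcfc_intertwine x hc h0) !cmulA.
rewrite (alg_traceC tP); congr t.
have sx := star_sa x.
have -> : y^⋆ ⋅ y = rcfc (x^⋆ ⋅ x) h ⋅ (x^⋆ ⋅ x) ⋅ rcfc (x^⋆ ⋅ x) h.
  by rewrite /y cstarM sK !cmulA.
rewrite (rcfc_sandwich sx hc h0) cutdownE; congr rcfc; apply/funext => s.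
by rewrite mulrAC hh qE.
Qed.

(* [E = f(c)] with [f(s)^2 = (s - e)_+ / s] is an approximate unit for all
   [a <= c]: writing [a = v v^*], one has
   [|v - E v|^2 <= |(1 - E) c (1 - E)| <= e]. *)
Lemma conj_cut_near a c (d : R) : pos_cone A a -> cle a c -> (0 < d) ->
  exists2 d1 : R, (0 < d1) & forall d2 : R, (0 < d2) -> (d2 <= d1) ->
    let E := rcfc c (fun s => Num.sqrt (truncq (d2 ^+ 2) (d2 ^+ 2) s)) in
    (nrm (a - E ⋅ a ⋅ E) < d).
Proof.
move=> a0 ac d0; have c0 : pos_cone A c by have := pos_coneD ac a0; rewrite subrK.
have sa := pos_cone_sa a0; have sc := pos_cone_sa c0.
have [v aE] := a0; have [w cE] := ac.
have nv := nrm_ge0 v.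
exists (d / (2 * nrm v + 1)); first by rewrite divr_gt0 // ltr_wpDl // mulr_ge0.
move=> d2 d20; rewrite ler_pdivlMr; last by rewrite ltr_wpDl // mulr_ge0.
move=> d2d; cbv zeta; set e := d2 ^+ 2; set E := rcfc _ _.
have e0 : 0 < e by exact: exprn_gt0.
pose f s := Num.sqrt (truncq e e s).
have fc : continuous f by apply: cont_sqrt; exact: truncq_cont.
have f0 : (f 0 = 0) by rewrite /f truncq0 ?sqrtr0 // ltW.
have fge s : (0 <= f s) by exact: sqrtr_ge0.
have f2 s : (f s * f s = truncq e e s) by rewrite -expr2 sqr_sqrtr // truncq_ge0.
have f1 s : (f s <= 1).
  by rewrite -(@ler_pXn2r _ 2) ?nnegrE // expr2 f2 expr1n truncq_le1.
have sE : E^⋆ = E by exact: rcfc_sa.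
have nE : nrm (rcfc c f) <= 1.
  by apply: (rcfc_nrm sc fc f0 ler01) => s _; rewrite ger0_norm.
have nvE : (nrm (v - E ⋅ v) <= d2).
  rewrite -(@ler_pXn2r _ 2) ?nnegrE ?nrm_ge0 ?(ltW d20) // -nrm_Mstar.
  (* (1 - E) c (1 - E), written without the unit. *)
  pose F := (c - E ⋅ c - (c - E ⋅ c) ⋅ E).
  have conjE u : (u - E ⋅ u) ⋅ (u - E ⋅ u)^⋆ =
      (u ⋅ u^⋆ - E ⋅ (u ⋅ u^⋆) - (u ⋅ u^⋆ - E ⋅ (u ⋅ u^⋆)) ⋅ E).
    by rewrite cstarB cstarM sE cmulBr !cmulBl !cmulA.
  apply: (@le_trans _ _ (nrm F)).
    apply: cle_nrm; first exact: pos_cone_Mstar.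
    rewrite /cle /F; suff -> : (c - E ⋅ c - (c - E ⋅ c) ⋅ E - (v - E ⋅ v) ⋅ (v - E ⋅ v)^⋆) =
      (w - E ⋅ w) ⋅ (w - E ⋅ w)^⋆ by exact: pos_cone_Mstar.
    rewrite !conjE -aE -cE.
    pose L u := (u - E ⋅ u - (u - E ⋅ u) ⋅ E).
    have LB u u' : L (u - u') = (L u - L u').
      have DB : u - u' - E ⋅ (u - u') = (u - E ⋅ u) - (u' - E ⋅ u').
        by rewrite cmulBr opprD addrACA -opprD.
      rewrite /L DB; move: (u - E ⋅ u) (u' - E ⋅ u') => z z'.
      by rewrite cmulBl opprD addrACA -opprD.
    by rewrite -/(L c) -/(L a) -/(L (c - a)) LB.
  have -> : F = rcfc c (fun s => s * (1 - f s) ^+ 2).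
    have cid := cont_id; have fid := contM fc cont_id.
    have h1 := contB cont_id fid; have h2 := contM h1 fc.
    rewrite /F -{1 2 3 4}(rcfc_id sc).
    rewrite -(rcfcM sc fc f0 cont_id erefl) -(rcfcB sc cont_id erefl fid); last by rewrite mulr0.
    rewrite -rcfcM ?mulr0 ?subrr // -rcfcB ?mulr0 ?subrr //; last by rewrite mul0r.
    by congr rcfc; apply/funext => s; rewrite -/(f s); ring.
  apply: rcfc_nrm => //.
  - apply: contM; first exact: cont_id.
    by move=> s; apply: cvgM; (apply: contB => //; move=> ?; exact: cvg_cst).
  - by rewrite mul0r.
  - exact: ltW.
  move=> s /(pos_cone_spectrum c0) s0; rewrite ger0_norm; last by apply: mulr_ge0 => //; exact: sqr_ge0.
  have [se|es] := leP s e.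
    rewrite (_ : f s = 0) ?subr0 ?expr1n ?mulr1 //.
    by rewrite /f /truncq trunc_le // mul0r sqrtr0.
  have sp : (0 < s) by exact: lt_trans es.
  have fs : (s * (f s * f s) = s - e).
    by rewrite f2 mulrC -{2}[s]subr0 -(subrr e) truncqM // trunc_ge // ltW.
  have h1 := fge s; have h2 := f1 s; move: (f s) fs h1 h2 => u us u0 u1.
  (* With u = f(s): s (1 - u)^2 <= s (1 - u) <= s (1 - u^2) = e. *)
  have : (s * (1 - u) <= e).
    have : (s * (u * (1 - u)) >= 0) by rewrite !mulr_ge0 ?subr_ge0 // ltW.
    lra.
  have u1' : (0 <= 1 - u) by rewrite subr_ge0.
  have : (s * (1 - u) * (1 - u) <= s * (1 - u)).
    by rewrite ler_piMr ?mulr_ge0 ?gerBl // ltW.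
  by rewrite expr2 mulrA; exact: le_trans.
have n1 : (nrm (a - E ⋅ a) <= d2 * nrm v).
  have -> : (a - E ⋅ a = (v - E ⋅ v) ⋅ v^⋆) by rewrite cmulBl -cmulA -aE.
  by rewrite (le_trans (nrmM _ _)) // nrm_star ler_wpM2r.
have -> : (a - E ⋅ a ⋅ E = (a - E ⋅ a) + E ⋅ (a - E ⋅ a)^⋆).
  by rewrite cstarB cstarM sE sa cmulBr cmulA addrA subrK.
apply: (le_lt_trans (nrmD _ _)); apply: (@le_lt_trans _ _ (d2 * nrm v + d2 * nrm v)).
  rewrite lerD // (le_trans (nrmM _ _)) // nrm_star -[leRHS]mul1r.
  by rewrite ler_pM ?nrm_ge0.
by nra.
Qed.

(* With [c = a + b] and [E] as above, [(c - e)_+ = E a E + E b E]. *)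
Lemma alg_trace_cutdown_superadd a b (d : R) : pos_cone A a -> pos_cone A b -> (0 < d) ->
  exists2 e : R, (0 < e) &
    (t (cutdown a d) + t (cutdown b d) <= t (cutdown (a + b)%R e))%E.
Proof.
move=> a0 b0 d0; set c := (a + b); have c0 : pos_cone A c by exact: pos_coneD.
have ac : cle a c by rewrite /cle /c addrAC subrr add0r.
have bc : cle b c by rewrite /cle /c addrK.
have [da da0 Ha] := conj_cut_near a0 ac d0; have [db db0 Hb] := conj_cut_near b0 bc d0.
pose d2 := Num.min da db.
have d20 : (0 < d2) by rewrite lt_min da0 db0.
have d2a : d2 <= da by rewrite ge_min lexx.
have d2b : d2 <= db by rewrite ge_min lexx orbT.
have {}Ha := Ha _ d20 d2a; have {}Hb := Hb _ d20 d2b; cbv zeta in Ha, Hb.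
set e := (d2 ^+ 2) in Ha Hb; set E := rcfc c _ in Ha Hb.
have e0 : (0 < e) by exact: exprn_gt0.
exists e => //; have sc := pos_cone_sa c0.
pose f s := Num.sqrt (truncq e e s).
have fc : continuous f by apply: cont_sqrt; exact: truncq_cont.
have f0 : (f 0 = 0) by rewrite /f truncq0 ?sqrtr0 // ltW.
have sE : E^⋆ = E by exact: rcfc_sa.
have -> : cutdown c e = E ⋅ a ⋅ E + E ⋅ b ⋅ E.
  rewrite -cmulDl -cmulDr -/c cutdownE.
  rewrite (rcfc_sandwich sc fc f0); congr rcfc; apply/funext => s.
  rewrite mulrAC -expr2 sqr_sqrtr ?truncq_ge0 //.
  by have := truncqM e s e0; rewrite subrr subr0.
have posE u : pos_cone A u -> pos_cone A (E ⋅ u ⋅ E).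
  by move=> u0; rewrite -{2}sE; exact: pos_cone_conj.
rewrite (alg_traceD tP); [|exact: posE|exact: posE].
by apply: leeD; [apply: (alg_trace_cutdown_near a0 (posE _ a0) (nrm_ge0 _) Ha)|
  apply: (alg_trace_cutdown_near b0 (posE _ b0) (nrm_ge0 _) Hb)].
Qed.

Lemma alg_trace_cutdown_subadd a b (e : R) : pos_cone A a -> pos_cone A b -> (0 < e) ->
  exists2 d : R, (0 < d) &
    (t (cutdown (a + b)%R e) <= t (cutdown a d) + t (cutdown b d))%E.
Proof.
(* The two cutdowns together move the sum by at most e/2, strictly less than the [e] demanded by
   [alg_trace_cutdown_near]. *)
move=> a0 b0 e0; exists (e / 4); first by rewrite divr_gt0.
have d0 : (0 <= e / 4) by rewrite divr_ge0 // ltW.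
have pa0 := cutdown_pos a0 d0; have pb0 := cutdown_pos b0 d0.
rewrite -(alg_traceD tP) //.
apply: (@alg_trace_cutdown_near _ _ e (e / 4 + e / 4)) => //.
- exact: pos_coneD.
- exact: pos_coneD.
- exact: addr_ge0.
- lra.
by rewrite opprD addrACA (le_trans (nrmD _ _)) // lerD // cutdown_nrm.
Qed.

End algebraic_traces.

(** * Sums, suprema and strict inequalities in the extended half-line *)

Section ereal_lemmas.
Context {R : realType}.
Local Open Scope ereal_scope.
Implicit Types (x y m : \bar R) (S T : set (\bar R)).

Lemma ge0_lt_real x y : 0 <= x -> x < y -> exists2 r : R, (0 <= r)%R & x = r%:E.
Proof. by case: x => [r||] // r0; [exists r|rewrite ltNge leey]. Qed.

Lemma ge0_addl_sup_le x T m : 0 <= x -> T !=set0 -> (forall y, T y -> 0 <= y) ->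
  (forall y, T y -> x + y <= m) -> x + ereal_sup T <= m.
Proof.
move=> x0 [y0 Ty0] T0 H; case: x x0 H => [r r0 H||] //.
  rewrite addeC -leeBrDr //; apply: ub_ereal_sup => y Ty.
  by rewrite leeBrDr // addeC H.
move=> _ /(_ _ Ty0); rewrite addye; last by rewrite gt_eqF // (lt_le_trans _ (T0 _ Ty0)).
by rewrite leye_eq => /eqP ->; rewrite leey.
Qed.

Lemma ge0_sup_add_le S T m : S !=set0 -> T !=set0 ->
  (forall x, S x -> 0 <= x) -> (forall y, T y -> 0 <= y) ->
  (forall x y, S x -> T y -> x + y <= m) -> ereal_sup S + ereal_sup T <= m.
Proof.
move=> S0 T0 Sp Tp H; rewrite addeC; apply: ge0_addl_sup_le => //.
  by have [y Ty] := T0; apply: le_trans (Tp _ Ty) _; exact: ereal_sup_ubound.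
move=> x Sx; rewrite addeC; apply: ge0_addl_sup_le => //; first exact: Sp.
by move=> y Ty; exact: H.
Qed.

Lemma lt_add_split x y (r : R) : 0 <= x -> 0 <= y -> r%:E < x + y ->
  exists p q : R, [/\ p%:E < x, q%:E < y & (r <= p + q)%R].
Proof.
case: x => [u||] //; case: y => [v||] //.
- rewrite -EFinD lte_fin => _ _ auv.
  exists (u - (u + v - r) / 2)%R, (v - (u + v - r) / 2)%R.
  by rewrite !lte_fin; split; lra.
- move=> _ _ _; exists (u - 1)%R, (r - (u - 1))%R.
  by rewrite lte_fin ltry; split=> //; lra.
- move=> _ _ _; exists (r - (v - 1))%R, (v - 1)%R.
  by rewrite lte_fin ltry; split=> //; lra.
- by move=> _ _ _; exists r, 0%R; rewrite !ltry addr0.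
Qed.

Lemma gt_add_split x y (r : R) : 0 <= x -> 0 <= y -> x + y < r%:E ->
  exists p q : R, [/\ x < p%:E, y < q%:E & (p + q <= r)%R].
Proof.
case: x => [u||] //; case: y => [v||] // _ _; rewrite -EFinD lte_fin => uv.
exists (u + (r - (u + v)) / 2)%R, (v + (r - (u + v)) / 2)%R.
by rewrite !lte_fin; split; lra.
Qed.

End ereal_lemmas.

(** * The c-space topology *)

Section lsc_traces.
Context {R : realType} {A : cstarAlgType R}.
Implicit Types (a b c x y : A) (z w : pos_cone A) (e d r p : R).

Definition mkpos a (h : pos_cone A a) : pos_cone A := SigSub (mem_set h).

(** Extension by 0 off the cone, so that sums and cutdowns can be arguments of a trace without
    carrying proofs of positivity. *)
Definition ev (t : pos_cone A -> \bar R) a : \bar R :=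
  if pselect (pos_cone A a) is left h then t (mkpos h) else 0%E.

Lemma pos_cone_val z : pos_cone A (val z). Proof. exact: set_valP. Qed.

Lemma evE t z : ev t (val z) = t z.
Proof.
rewrite /ev; case: pselect => [h|]; last by case; exact: pos_cone_val.
by congr t; exact: val_inj.
Qed.

Lemma evP t a (h : pos_cone A a) : ev t a = t (mkpos h).
Proof. exact: (evE t (mkpos h)). Qed.

Lemma pos_cone_nbhsP z (V : set (pos_cone A)) : nbhs z V <->
  exists2 e, 0 < e & forall w, nrm (val z - val w) < e -> V w.
Proof.
split=> [|[e e0 H]].
  rewrite nbhsE => -[B [[W Wo <-] Wz] BV].
  have /nrm_nbhsP[e e0 H] : nbhs (val z) W by apply: open_nbhs_nbhs.
  by exists e => // w zw; apply: BV; exact: H.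
have : nbhs (val z) [set y | nrm (val z - y) < e] by apply/nrm_nbhsP; exists e.
move=> zn; have : nbhs z (val @^-1` [set y | nrm (val z - y) < e]).
  exact: (@initial_continuous _ _ (@set_val _ (pos_cone A)) z).
by apply: filterS => w; exact: H.
Qed.

Lemma lsc_alg_trace t : lsc_trace_fun t -> alg_trace (ev t).
Proof.
move=> tP; split.
- by move=> a; rewrite /ev; case: pselect => // h; exact: lsc_trace_ge0.
- by rewrite (evP t pos_cone0) (lsc_trace0 tP).
- move=> a b a0 b0; rewrite (evP t a0) (evP t b0) (evP t (pos_coneD a0 b0)).
  exact: (lsc_traceD tP).
- move=> x; rewrite (evP t (pos_cone_Mstar x)) (evP t (pos_cone_starM x)).
  exact: (lsc_traceC tP).
Qed.

Lemma ev_lsc t a r : lower_semicontinuous t -> pos_cone A a -> (r%:E < ev t a)%E ->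
  exists2 e, 0 < e & forall b, pos_cone A b -> nrm (a - b) < e -> (r%:E < ev t b)%E.
Proof.
move=> tl a0; rewrite (evP t a0) => /tl[V /pos_cone_nbhsP[e e0 H] HV].
by exists e => // b b0 ab; rewrite (evP t b0); apply/HV/H.
Qed.

Lemma ev_cutdown_lt t a r : lsc_trace_fun t -> pos_cone A a -> (r%:E < ev t a)%E ->
  exists2 e, 0 < e & (r%:E < ev t (cutdown a e))%E.
Proof.
move=> tP a0 /(ev_lsc (lsc_trace_lsc tP) a0)[e e0 H].
have e2 : 0 < e / 2 by rewrite divr_gt0.
exists (e / 2) => //; apply: H; first by apply: cutdown_pos => //; exact: ltW.
by rewrite (le_lt_trans (cutdown_nrm a0 (ltW e2))) // ltr_pdivrMr // ltr_pMr // ltr1n.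
Qed.

Lemma ev_cutdown_le t a e : lsc_trace_fun t -> pos_cone A a -> 0 <= e ->
  (ev t (cutdown a e) <= ev t a)%E.
Proof.
move=> tP a0 e0; apply: (alg_trace_mono (lsc_alg_trace tP)).
  exact: cutdown_pos.
exact: cutdown_le.
Qed.

Lemma series_pos_cone (u : nat -> A) n :
  (forall k, pos_cone A (u k)) -> pos_cone A (series u n).
Proof.
move=> u0; elim: n => [|n IH]; first by rewrite /series /= big_geq //; exact: pos_cone0.
by rewrite seriesSr; exact: pos_coneD.
Qed.

Lemma ev_series t (x : nat -> A) n : lsc_trace_fun t ->
  ev t (series (fun k => x k ⋅ (x k)^⋆) n) = ev t (series (fun k => (x k)^⋆ ⋅ x k) n).
Proof.
move=> tP; have tA := lsc_alg_trace tP.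
have p1 := @series_pos_cone (fun k => x k ⋅ (x k)^⋆) ^~ (fun k => pos_cone_Mstar _).
have p2 := @series_pos_cone (fun k => (x k)^⋆ ⋅ x k) ^~ (fun k => pos_cone_starM _).
elim: n => [|n IH]; first by rewrite /series /= !big_geq.
rewrite !seriesSr (alg_traceD tA) ?(alg_traceD tA) //; try exact: pos_cone_starM; try exact: pos_cone_Mstar.
by rewrite IH (alg_traceC tA).
Qed.

Lemma series_cle (u : nat -> A) a n : (forall k, pos_cone A (u k)) ->
  series u @ \oo --> a -> cle (series u n) a.
Proof.
move=> u0 ua; apply: (@pos_cone_cvg _ _ (fun m => series u (m + n)%N - series u n)).
  move=> m; elim: m => [|m IH]; first by rewrite add0n subrr; exact: pos_cone0.
  by rewrite addSn seriesSr addrAC; exact: pos_coneD.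
apply: cvgB; last exact: cvg_cst.
by rewrite (cvg_shiftn n (series u)).
Qed.

(** Finite partial sums of the two series have equal traces, and those on the side of [a'] lie below
    [a']. Lower semicontinuity passes the bound to the limit [a]. *)
Lemma ev_cp_sub t a b : lsc_trace_fun t -> pos_cone A a -> cp_sub a b -> (ev t a <= ev t b)%E.
Proof.
move=> tP a0 [a' [a'0 [x [xa xa']] a'b]].
have tA := lsc_alg_trace tP.
have pa := @series_pos_cone (fun k => x k ⋅ (x k)^⋆) ^~ (fun k => pos_cone_Mstar _).
have pa' := @series_pos_cone (fun k => (x k)^⋆ ⋅ x k) ^~ (fun k => pos_cone_starM _).
apply: (@le_trans _ _ (ev t a')); last exact: alg_trace_mono.
rewrite leNgt; apply/negP => ta.
have [r r0 rE] := ge0_lt_real (alg_trace_ge0 tA a') ta.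
rewrite rE in ta.
have [e e0 H] := ev_lsc (lsc_trace_lsc tP) a0 ta.
have e2 : 0 < e / 2 by rewrite divr_gt0.
have /nrm_cvgP/(_ _ e2)[N HN] := xa.
have : (r%:E < ev t (series (fun k => x k ⋅ (x k)^⋆) N))%E.
  apply: H => //; rewrite (le_lt_trans (HN N (leqnn _))) //.
  by rewrite ltr_pdivrMr // ltr_pMr // ltr1n.
rewrite ev_series // -rE ltNge => /negP; apply.
apply: alg_trace_mono => //; apply: series_cle => // k; exact: pos_cone_starM.
Qed.

Lemma ev_cp_prec t a b : lsc_trace_fun t -> pos_cone A a -> pos_cone A b ->
  cp_prec a b -> (ev t a <= ev t b)%E.
Proof.
move=> tP a0 b0 [e e0 ab]; apply: le_trans (ev_cp_sub tP a0 ab) _.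
by apply: ev_cutdown_le => //; exact: ltW.
Qed.

Lemma cp_equiv_refl a : pos_cone A a -> cp_equiv a a.
Proof.
move=> /pos_coneP/psd_sqrt[s ss aE].
pose u n : A := if n is 0%N then s else 0.
have H (v : nat -> A) : v 0%N = a -> (forall n, v n.+1 = 0) -> series v @ \oo --> a.
  move=> v0 vS; apply/nrm_cvgP => e e0; exists 1%N => -[//|n] _.
  suff -> : series v n.+1 = a by rewrite subrr nrm0 ltW.
  elim: n => [|n IH]; first by rewrite seriesSr v0 /series /= big_geq // add0r.
  by rewrite seriesSr vS IH addr0.
exists u; split; apply: H => [|n] /=; rewrite ?ss -?aE ?cmul0l ?cmul0r //.
Qed.

Lemma cle_refl a : cle a a.
Proof. by rewrite /cle subrr; exact: pos_cone0. Qed.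

Lemma cutdown_prec a e : pos_cone A a -> 0 < e -> cp_prec (cutdown a e) a.
Proof.
move=> a0 e0; exists e => //; have c0 := cutdown_pos a0 (ltW e0).
by exists (cutdown a e); split=> //; [exact: cp_equiv_refl|exact: cle_refl].
Qed.

Lemma cp_prec_cutdown a b : pos_cone A b -> cp_prec a b ->
  exists2 e, 0 < e & cp_prec a (cutdown b e).
Proof.
move=> b0 [e e0 ab]; have e2 : 0 < e / 2 by rewrite divr_gt0.
exists (e / 2) => //; exists (e / 2) => //.
by rewrite cutdown_cutdown ?ltW // -splitr.
Qed.

(* The transitive closure of [cp_prec]: using it instead of [cp_prec] avoids
   proving that the Cuntz-Pedersen relation is transitive. *)
Inductive cp_chain a : A -> Prop :=
| cp_chain1 b : cp_prec a b -> cp_chain a b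
| cp_chainS b c : pos_cone A b -> cp_chain a b -> cp_prec b c -> cp_chain a c.

Lemma ev_cp_chain t a b : lsc_trace_fun t -> pos_cone A a -> pos_cone A b ->
  cp_chain a b -> (ev t a <= ev t b)%E.
Proof.
move=> tP a0 b0 ab; elim: ab b0 => [{}b ab|b' c b'0 _ IH bc] c0; first exact: ev_cp_prec.
by apply: le_trans (IH b'0) _; exact: ev_cp_prec.
Qed.

Lemma cp_chain_cutdown a b : cp_chain a b -> pos_cone A b ->
  exists2 e, 0 < e & cp_chain a (cutdown b e).
Proof.
case=> [{}b ab|{}b c b0 ab bc] c0.
  by have [e e0 H] := cp_prec_cutdown c0 ab; exists e => //; exact: cp_chain1.
by have [e e0 H] := cp_prec_cutdown c0 bc; exists e => //; exact: cp_chainS H.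
Qed.

Lemma c_open_intro (U : set (pos_cone A)) :
  (forall z, U z -> exists2 w, U w & cp_prec (val w) (val z)) ->
  (forall w z, U w -> cp_prec (val w) (val z) -> U z) -> c_open U.
Proof.
move=> H1 H2; apply/seteqP; split=> z; first exact: H1.
by move=> [w Uw wz]; exact: H2 wz.
Qed.

Lemma c_open_up (U : set (pos_cone A)) w z :
  c_open U -> U w -> cp_prec (val w) (val z) -> U z.
Proof. by move=> Uo Uw wz; rewrite Uo; exists w. Qed.

Lemma c_open_down (U : set (pos_cone A)) z :
  c_open U -> U z -> exists2 w, U w & cp_prec (val w) (val z).
Proof. by move=> Uo; rewrite {1}Uo. Qed.

Lemma c_openT : c_open [set: pos_cone A].
Proof.
apply: c_open_intro => // z _.
have z0 := pos_cone_val z; have c0 := cutdown_pos z0 (@ler01 R).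
exists (mkpos c0) => //; exact: cutdown_prec.
Qed.

Lemma c_open0 : c_open (set0 : set (pos_cone A)).
Proof. exact: c_open_intro. Qed.

Lemma c_open_bigcup (I : Type) (P : I -> Prop) (U : I -> set (pos_cone A)) :
  (forall i, P i -> c_open (U i)) -> c_open [set z | exists2 i, P i & U i z].
Proof.
move=> H; apply: c_open_intro.
  move=> z [i Pi Uz]; have [w Uw wz] := c_open_down (H _ Pi) Uz.
  by exists w => //; exists i.
by move=> w z [i Pi Uw] wz; exists i => //; exact: c_open_up (H _ Pi) Uw wz.
Qed.

Lemma c_open_chain a : c_open [set z | cp_chain a (val z)].
Proof.
apply: c_open_intro => [z /= az|w z /= aw wz]; last first.
  by apply: cp_chainS aw wz; exact: pos_cone_val.
have z0 := pos_cone_val z; have [e e0 H] := cp_chain_cutdown az z0.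
by exists (mkpos (cutdown_pos z0 (ltW e0))) => //=; exact: cutdown_prec.
Qed.

Definition chain_step a r z : \bar R := if `[< cp_chain a (val z) >] then r%:E else 0%E.

Lemma chain_step_lsc a r : 0 <= r -> [set f | c_lsc_fun f] (chain_step a r).
Proof.
move=> r0; split=> [z|s s0]; first by rewrite /chain_step; case: ifP.
have [sr|rs] := ltP s r.
  rewrite (_ : [set z | _] = [set z | cp_chain a (val z)]); first exact: c_open_chain.
  apply/seteqP; split=> z /=; rewrite /chain_step; case: asboolP => //.
  by rewrite lte_fin ltNge s0.
rewrite (_ : [set z | _] = set0); first exact: c_open0.
apply/seteqP; split=> z //=; rewrite /chain_step; case: asboolP => _.
  by rewrite lte_fin ltNge rs.
by rewrite lte_fin ltNge s0.
Qed.

(* The value [r] on the closure of [z0] for the c-space topology, and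
   [+oo] elsewhere. *)
Definition closure_step z0 r z : \bar R :=
  if `[< exists2 U, c_open U /\ ~ U z0 & U z >] then +oo%E else r%:E.

Lemma closure_step_lsc z0 r : 0 <= r -> [set f | c_lsc_fun f] (closure_step z0 r).
Proof.
move=> r0; split=> [z|s s0]; first by rewrite /closure_step; case: ifP; rewrite ?leey.
have [sr|rs] := ltP s r.
  rewrite (_ : [set z | _] = setT); first exact: c_openT.
  apply/seteqP; split=> z //= _; rewrite /closure_step; case: asboolP; rewrite ?ltry //.
rewrite (_ : [set z | _] = [set z | exists2 U, c_open U /\ ~ U z0 & U z]).
  by apply: (@c_open_bigcup _ (fun U => c_open U /\ ~ U z0) id) => U [].
apply/seteqP; split=> z /=; rewrite /closure_step; case: asboolP; rewrite ?ltry //.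
by rewrite lte_fin ltNge rs.
Qed.

Lemma lsc_trace_c_lsc t : lsc_trace_fun t -> @c_lsc_fun R A t.
Proof.
move=> tP; split=> [|r r0]; first exact: lsc_trace_ge0.
apply: c_open_intro => [z /=|w z /= rw wz].
  have z0 := pos_cone_val z; rewrite -evE => /(ev_cutdown_lt tP z0)[e e0 re].
  exists (mkpos (cutdown_pos z0 (ltW e0))); last exact: cutdown_prec.
  by rewrite /= -evE.
apply: (lt_le_trans rw); rewrite -!evE; apply: ev_cp_prec => //; exact: pos_cone_val.
Qed.

Lemma LSC_of_TA_val (t : TA A) : val (LSC_of_TA t) = val t.
Proof. by apply: insubdK; apply: mem_set; exact/lsc_trace_c_lsc/TAP. Qed.

Lemma LSC_leP (f g : LSC A) : (f <= g)%O <-> forall z, (val f z <= val g z)%E.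
Proof. by split=> [/asboolP//|H]; apply/asboolP. Qed.

Lemma upper_subbase_TA (t : TA A) (B : set (LSC A)) : upper_subbase B -> B (LSC_of_TA t) ->
  exists z r, (r%:E < val t z)%E /\ forall t' : TA A, (r%:E < val t' z)%E -> B (LSC_of_TA t').
Proof.
move=> [b _ <-] /= /LSC_leP/existsNP[z /negP]; rewrite -ltNge LSC_of_TA_val => bz.
have [r r0 rE] := ge0_lt_real ((LSCP b).1 z) bz.
exists z, r; rewrite -rE; split=> // t' bt'.
suff : ~ (LSC_of_TA t' <= b)%O by [].
move=> /LSC_leP/(_ z).
by rewrite LSC_of_TA_val leNgt bt'.
Qed.

Lemma TA_upper_subbase (t : TA A) z r : (r%:E < val t z)%E -> 0 <= r ->
  exists2 B : set (LSC A), upper_subbase B & B (LSC_of_TA t) /\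
    forall t' : TA A, B (LSC_of_TA t') -> (r%:E < val t' z)%E.
Proof.
move=> rt r0; pose b : LSC A := SigSub (mem_set (closure_step_lsc z r0)).
exists (~` [set y | (y <= b)%O]); first by exists b.
split=> /= [/LSC_leP/(_ z)|t' /LSC_leP tb].
  rewrite LSC_of_TA_val /= /closure_step leNgt => /negP; apply.
  by case: asboolP => // -[U [_ nU] /nU].
rewrite ltNge; apply/negP => t'r; apply: tb => w; rewrite LSC_of_TA_val /= /closure_step.
case: asboolP => [_|nU]; first by rewrite leey.
rewrite leNgt; apply/negP => rw; apply: nU.
have [_ /(_ r r0) to] := lsc_trace_c_lsc (TAP t').
exists [set x | (r%:E < val t' x)%E] => //; split=> //.
by apply/negP; rewrite -leNgt.
Qed.

Lemma lower_subbase_TA (t : TA A) (B : set (LSC A)) : lower_subbase B -> B (LSC_of_TA t) ->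
  exists z e p, [/\ 0 < e, (val t z < p%:E)%E
    & forall t' : TA A, (ev (val t') (cutdown (val z) e) < p%:E)%E -> B (LSC_of_TA t')].
Proof.
move=> [f _ <-] /= /LSC_leP/existsNP[z /negP]; rewrite -ltNge LSC_of_TA_val => tf.
have [r r0 rE] := ge0_lt_real (lsc_trace_ge0 (TAP t) z) tf.
have [p rp pf] : exists2 p, r < p & (p%:E < val f z)%E.
  move: tf; rewrite rE; case: (val f z) => [u||] //.
    by rewrite lte_fin => ru; exists ((r + u) / 2); rewrite ?lte_fin; lra.
  by move=> _; exists (r + 1); rewrite ?ltry // ltrDl.
have [_ /(_ p (le_trans r0 (ltW rp))) fo] := LSCP f.
have [w fw [e e0 wz]] := c_open_down fo pf.
exists z, e, p; rewrite rE lte_fin; split=> // t' t'p.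
suff : ~ (f <= LSC_of_TA t')%O by [].
move=> /LSC_leP/(_ w).
rewrite LSC_of_TA_val leNgt => /negP; apply; apply: le_lt_trans (lt_trans t'p fw).
by rewrite -evE; apply: ev_cp_sub wz; [exact: TAP|exact: pos_cone_val].
Qed.

(** If [chain_step] at (z - e)_+ with value [p] is not below t', then t'(w) < p for some w above (z
    - e)_+ in the chain order, hence t' is below [p] at (z - e)_+. It is not below [t] because (z -
    e)_+ precedes [z]. *)
Lemma TA_lower_subbase (t : TA A) z e p : 0 < e -> (val t z < p%:E)%E ->
  exists2 B : set (LSC A), lower_subbase B & B (LSC_of_TA t) /\
    forall t' : TA A, B (LSC_of_TA t') -> (ev (val t') (cutdown (val z) e) < p%:E)%E.
Proof.
move=> e0 tp; have z0 := pos_cone_val z; have c0 := cutdown_pos z0 (ltW e0).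
have p0 : 0 <= p.
  by rewrite -lee_fin; apply: le_trans (ltW tp); exact: (lsc_trace_ge0 (TAP t)).
pose f : LSC A := SigSub (mem_set (chain_step_lsc (cutdown (val z) e) p0)).
exists (~` [set y | (f <= y)%O]); first by exists f.
split=> /= [/LSC_leP/(_ z)|t' /LSC_leP/existsNP[w /negP]].
  rewrite LSC_of_TA_val /= /chain_step asboolT ?leNgt ?tp //.
  exact/cp_chain1/cutdown_prec.
rewrite -ltNge LSC_of_TA_val /= /chain_step; case: asboolP => [cw|_].
  apply: le_lt_trans; rewrite -evE; apply: ev_cp_chain cw => //; first exact: TAP.
  exact: pos_cone_val.
by rewrite ltNge (lsc_trace_ge0 (TAP t')).
Qed.

Definition regularization (t : A -> \bar R) z : \bar R :=
  ereal_sup [set t (cutdown (val z) e) | e in [set e | 0 < e]].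

Lemma regularization_ge (t : A -> \bar R) z e : 0 < e ->
  (t (cutdown (val z) e) <= regularization t z)%E.
Proof. by move=> e0; apply: ereal_sup_ubound; exists e. Qed.

Lemma lsc_trace_regularization (t : A -> \bar R) : alg_trace t ->
  lsc_trace_fun (regularization t).
Proof.
move=> tA; have t0 := alg_trace_ge0 tA.
have mono a d e : pos_cone A a -> 0 < d -> d <= e -> (t (cutdown a e) <= t (cutdown a d))%E.
  move=> a0 d0 de; apply: (alg_trace_mono tA); last exact: (cutdown_mono a0 (ltW d0) de).
  by apply: cutdown_pos => //; rewrite (le_trans _ de) // ltW.
split.
- by move=> z; apply: le_trans (regularization_ge t z (@ltr01 R)); exact: t0.
- move=> z r /ereal_sup_gt[_ [e /= e0 <-] re]; have z0 := pos_cone_val z.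
  have e2 : 0 < e / 2 by rewrite divr_gt0.
  have e4 : 0 < e / 4 by rewrite divr_gt0.
  exists [set w | nrm (val z - val w) < e / 2]; first by apply/pos_cone_nbhsP; exists (e / 2).
  move=> w /= zw; apply: (lt_le_trans re); apply: le_trans (regularization_ge t w e4).
  have w0 := pos_cone_val w.
  (* (w - e/4)_+ is within e/2 + e/4 < e of [z], so its value dominates that of (z - e)_+. *)
  apply: (@alg_trace_cutdown_near _ _ t tA _ _ e (e / 2 + e / 4)) => //.
  + exact: cutdown_pos (ltW e4).
  + lra.
  + lra.
  + by apply: (le_trans (nrm_tri (val w) _ _)); apply: lerD; [exact: ltW|exact: cutdown_nrm (ltW e4)].
- move=> z z0; apply/eqP; rewrite eq_le; apply/andP; split; last first.
    by apply: le_trans (regularization_ge t z (@ltr01 R)); exact: t0.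
  apply: ub_ereal_sup => _ [e /= e0 <-].
  by rewrite z0 (cutdown_of0 (ltW e0)) (alg_trace0 tA).
- move=> za zb zc E; have a0 := pos_cone_val za; have b0 := pos_cone_val zb.
  apply/eqP; rewrite eq_le; apply/andP; split.
    apply: ub_ereal_sup => _ [e /= e0 <-]; rewrite E.
    have [d d0 H] := alg_trace_cutdown_subadd tA a0 b0 e0.
    by apply: (le_trans H); apply: leeD; exact: regularization_ge.
  apply: ge0_sup_add_le.
  + by exists (t (cutdown (val za) 1)); exists 1 => //=.
  + by exists (t (cutdown (val zb) 1)); exists 1 => //=.
  + by move=> _ [e _ <-].
  + by move=> _ [e _ <-].
  move=> _ _ [d /= d0 <-] [e /= e0 <-].
  have m0 : 0 < Num.min d e by rewrite lt_min d0 e0.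
  have [k k0 H] := alg_trace_cutdown_superadd tA a0 b0 m0.
  rewrite -E in H; apply: (le_trans _ (le_trans H (regularization_ge t zc k0))).
  by apply: leeD; apply: mono => //; rewrite ge_min lexx ?orbT.
- move=> x za zb Ea Eb; rewrite /regularization Ea Eb.
  by congr ereal_sup; apply/seteqP; split=> _ [e /= e0 <-]; exists e => //; rewrite alg_trace_cutdownC.
Qed.

End lsc_traces.

(** * The topologies of the cone of traces *)

Section trace_topologies.
Context {R : realType} {A : cstarAlgType R}.
Implicit Types (a b : A) (z w : pos_cone A) (e d r p : R) (s t u : TA A).

Definition tev t a : \bar R := ev (val t) a.

Lemma tev_ge0 t a : (0 <= tev t a)%E.
Proof. exact: alg_trace_ge0 (lsc_alg_trace (TAP t)) a. Qed.

Lemma tev_add s t a : tev (TA_add s t) a = (tev s a + tev t a)%E.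
Proof. by rewrite /tev /ev; case: pselect => // _; rewrite adde0. Qed.

Lemma tev_scale (k : {posnum R}) t a : tev (TA_scale k t) a = (k%:num%:E * tev t a)%E.
Proof. by rewrite /tev /ev; case: pselect => // _; rewrite mule0. Qed.

Lemma TA_leP s t : TA_le s t <-> forall z, (tev s (val z) <= tev t (val z))%E.
Proof.
split=> [/asboolP H z|H]; first by rewrite /tev !evE.
by apply/asboolP => z; have := H z; rewrite /tev !evE.
Qed.

Lemma TA_le_refl t : TA_le t t. Proof. exact/TA_leP. Qed.

Lemma TA_le_anti s t : TA_le s t -> TA_le t s -> s = t.
Proof.
move=> /asboolP st /asboolP ts; apply/val_inj/funext => z.
by apply/eqP; rewrite eq_le st ts.
Qed.

Lemma TA_le_trans s t u : TA_le s t -> TA_le t u -> TA_le s u.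
Proof. by move=> /TA_leP st /TA_leP tu; apply/TA_leP => z; exact: le_trans (st z) (tu z). Qed.

Lemma tev_mono s t a : TA_le s t -> (tev s a <= tev t a)%E.
Proof.
move=> /asboolP st; rewrite /tev /ev; case: pselect => // h; exact: st.
Qed.

(** An arbitrary filter is allowed, so that one criterion serves neighbourhood filters,
    ultrafilters, images under the cone operations and principal filters. *)
Definition up_cvg (F : set_system (TA A)) t := forall z r,
  0 <= r -> (r%:E < tev t (val z))%E -> F [set t' | (r%:E < tev t' (val z))%E].

Definition lo_cvg (F : set_system (TA A)) t := forall z e p,
  0 < e -> (tev t (val z) < p%:E)%E -> F [set t' | (tev t' (cutdown (val z) e) < p%:E)%E].

Let upper_cvg (F : set_system (TA A)) t : Filter F -> up_cvg F t ->
  forall B : set (LSC A), upper_subbase B -> B (LSC_of_TA t) -> F (@LSC_of_TA R A @^-1` B).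
Proof.
move=> FF H B Bu Bt; have [z [r [rt HB]]] := upper_subbase_TA Bu Bt.
have [r0|r0] := leP 0 r; last first.
  apply: filterS filterT => t' _; apply: HB; rewrite (@lt_le_trans _ _ 0%E) ?lte_fin //.
  exact: (lsc_trace_ge0 (TAP t')).
have := H z r r0; rewrite /tev evE => /(_ rt); apply: filterS => t' /=.
by rewrite evE; exact: HB.
Qed.

Let lower_cvg (F : set_system (TA A)) t : Filter F -> lo_cvg F t ->
  forall B : set (LSC A), lower_subbase B -> B (LSC_of_TA t) -> F (@LSC_of_TA R A @^-1` B).
Proof.
move=> FF H B Bl Bt; have [z [e [p [e0 tp HB]]]] := lower_subbase_TA Bl Bt.
by have := H z e p e0; rewrite /tev evE => /(_ tp); apply: filterS => t' /=; exact: HB.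
Qed.

Let upper_nbhs (F : set_system (TA A)) t : Filter F ->
  (forall B : set (LSC A), upper_subbase B -> B (LSC_of_TA t) -> F (@LSC_of_TA R A @^-1` B)) ->
  up_cvg F t.
Proof.
move=> FF H z r r0; rewrite /tev evE => rt.
have [B Bu [Bt HB]] := TA_upper_subbase rt r0.
by apply: filterS (H B Bu Bt) => t' /= /HB; rewrite evE.
Qed.

Let lower_nbhs (F : set_system (TA A)) t : Filter F ->
  (forall B : set (LSC A), lower_subbase B -> B (LSC_of_TA t) -> F (@LSC_of_TA R A @^-1` B)) ->
  lo_cvg F t.
Proof.
move=> FF H z e p e0; rewrite /tev evE => tp.
have [B Bl [Bt HB]] := TA_lower_subbase e0 tp.
by apply: filterS (H B Bl Bt) => t' /= /HB.
Qed.

Lemma TA_up_cvg (F : set_system (TA A)) t : Filter F -> up_cvg F t -> F --> (t : TA_up A).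
Proof.
move=> FF Ft.
apply: (@initial_generated_cvg _ _ (@upper_subbase _ (LSC A)) (@LSC_of_TA R A) F t).
by move=> B; exact: upper_cvg.
Qed.

Lemma TA_lo_cvg (F : set_system (TA A)) t : Filter F -> lo_cvg F t -> F --> (t : TA_lo A).
Proof.
move=> FF Ft.
apply: (@initial_generated_cvg _ _ (@lower_subbase _ (LSC A)) (@LSC_of_TA R A) F t).
by move=> B; exact: lower_cvg.
Qed.

Lemma TA_iv_cvg (F : set_system (TA A)) t : Filter F -> up_cvg F t -> lo_cvg F t ->
  F --> (t : TA_iv A).
Proof.
move=> FF Fu Fl.
apply: (@initial_generated_cvg _ _ (@upper_subbase _ (LSC A) `|` @lower_subbase _ (LSC A))
  (@LSC_of_TA R A) F t).
by move=> B [Bu|Bl]; [exact: upper_cvg|exact: lower_cvg].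
Qed.

Lemma TA_up_nbhs t : up_cvg (nbhs (t : TA_up A)) t.
Proof.
apply: upper_nbhs => B Bu Bt.
exact: (@initial_generated_nbhs _ _ (@upper_subbase _ (LSC A)) (@LSC_of_TA R A) t B Bu Bt).
Qed.

Lemma TA_lo_nbhs t : lo_cvg (nbhs (t : TA_lo A)) t.
Proof.
apply: lower_nbhs => B Bu Bt.
exact: (@initial_generated_nbhs _ _ (@lower_subbase _ (LSC A)) (@LSC_of_TA R A) t B Bu Bt).
Qed.

Lemma TA_iv_nbhs_up t : up_cvg (nbhs (t : TA_iv A)) t.
Proof.
apply: upper_nbhs => B Bu Bt.
exact: (@initial_generated_nbhs _ _ (@upper_subbase _ (LSC A) `|` @lower_subbase _ (LSC A))
  (@LSC_of_TA R A) t B (or_introl Bu) Bt).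
Qed.

Lemma TA_iv_nbhs_lo t : lo_cvg (nbhs (t : TA_iv A)) t.
Proof.
apply: lower_nbhs => B Bu Bt.
exact: (@initial_generated_nbhs _ _ (@upper_subbase _ (LSC A) `|` @lower_subbase _ (LSC A))
  (@LSC_of_TA R A) t B (or_intror Bu) Bt).
Qed.

Section ultrafilter_limit.
Context (F : set_system (TA A)) {FU : UltraFilter F}.

(** The pointwise limit along the ultrafilter: the supremum of the levels that [F]-almost all traces
    reach at [a]. *)
Definition ulim a : \bar R :=
  ereal_sup [set x | (0 <= x)%E /\ F [set t | (x <= tev t a)%E]].

Lemma ulim_ge a (x : \bar R) : (0 <= x)%E -> F [set t | (x <= tev t a)%E] -> (x <= ulim a)%E.
Proof. by move=> x0 Fx; apply: ereal_sup_ubound. Qed.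

Lemma ulim_gt a (x : \bar R) : (x < ulim a)%E -> F [set t | (x < tev t a)%E].
Proof.
move=> /ereal_sup_gt[y [_ Fy] xy]; apply: filterS Fy => t /=; exact: lt_le_trans.
Qed.

Lemma ulim_ge0 a : (0 <= ulim a)%E.
Proof. by apply: ulim_ge => //; apply: filterS filterT => t _; exact: tev_ge0. Qed.

Lemma ulim_lt a (x : \bar R) : (ulim a < x)%E -> F [set t | (tev t a < x)%E].
Proof.
move=> ax; have [//|H] := in_ultra_setVsetC [set t | (tev t a < x)%E] FU.
have := @ulim_ge a x (le_trans (ulim_ge0 a) (ltW ax)).
rewrite leNgt ax => absurd; suff : false by []; apply: absurd.
by apply: filterS H => t /= /negP; rewrite -leNgt.
Qed.

Lemma alg_trace_ulim : alg_trace ulim.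
Proof.
split.
- exact: ulim_ge0.
- apply/eqP; rewrite eq_le ulim_ge0 andbT; apply: ub_ereal_sup => x [_ Fx].
  have [t] := filter_ex Fx; rewrite /= /tev.
  by rewrite (alg_trace0 (lsc_alg_trace (TAP t))).
- move=> a b a0 b0.
  have tD t : tev t (a + b)%R = (tev t a + tev t b)%E.
    exact: (alg_traceD (lsc_alg_trace (TAP t))).
  apply/eqP; rewrite eq_le; apply/andP; split.
    rewrite leNgt; apply/negP => H.
    have [r r0 rE] := ge0_lt_real (adde_ge0 (ulim_ge0 a) (ulim_ge0 b)) H.
    rewrite rE in H.
    have [p' rp' pab] : exists2 p, r < p & (p%:E < ulim (a + b)%R)%E.
      move: H; case: (ulim (a + b)%R) => [v||] //.
        by rewrite lte_fin => rv; exists ((r + v) / 2); rewrite ?lte_fin; lra.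
      by move=> _; exists (r + 1); rewrite ?ltry // ltrDl.
    have : (ulim a + ulim b < p'%:E)%E by rewrite rE lte_fin.
    move=> /(gt_add_split (ulim_ge0 a) (ulim_ge0 b))[p [q [ap bq pq]]].
    have [t [[ta tb] tab]] := filter_ex (filterI (filterI (ulim_lt ap) (ulim_lt bq)) (ulim_gt pab)).
    move: tab; rewrite /= tD ltNge => /negP; apply; apply: (@le_trans _ _ (p%:E + q%:E)%E).
      by apply: leeD; exact: ltW.
    by rewrite -EFinD lee_fin.
  have S0 c : [set x | (0 <= x)%E /\ F [set t | (x <= tev t c)%E]] !=set0.
    by exists 0%E; split=> //; apply: filterS filterT => t _; exact: tev_ge0.
  apply: ge0_sup_add_le => // [x [] //|x [] //|x y [x0 Fx] [y0 Fy]].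
  apply: ulim_ge; first exact: adde_ge0.
  by apply: filterS (filterI Fx Fy) => t [/= ta tb]; rewrite tD leeD.
- move=> x; rewrite /ulim; congr ereal_sup; apply/funext => y.
  have E t : tev t (x ⋅ x^⋆) = tev t (x^⋆ ⋅ x) by exact: (alg_traceC (lsc_alg_trace (TAP t))).
  have ES : [set t | (y <= tev t (x ⋅ x^⋆))%E] = [set t | (y <= tev t (x^⋆ ⋅ x))%E].
    by apply/funext => t /=; rewrite E.
  by rewrite /= ES.
Qed.

Definition TA_ulim : TA A :=
  SigSub (mem_set (lsc_trace_regularization alg_trace_ulim)).

(** A value t(z) > r is already attained by the limit at some (z - e)_+, and traces increase from
    there to [z]. Conversely the limit at (z - e)_+ is at most t(z), which matches the cutdown in
    [lo_cvg]. *)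
Lemma TA_ulim_cvg : F --> (TA_ulim : TA_iv A).
Proof.
apply: TA_iv_cvg => z; rewrite /tev evE /=.
- move=> r r0 /ereal_sup_gt[_ [e /= e0 <-] /ulim_gt].
  apply: filterS => t /= /lt_le_trans; apply.
  by apply: ev_cutdown_le (ltW e0); [exact: TAP|exact: pos_cone_val].
- move=> e p e0 tp; apply: ulim_lt; apply: le_lt_trans tp.
  exact: regularization_ge.
Qed.

End ultrafilter_limit.

Lemma compact_TA_iv : compact [set: TA_iv A].
Proof.
rewrite compact_ultra => F FU _; exists (TA_ulim (FU := FU)); split=> //.
exact: TA_ulim_cvg.
Qed.

Lemma TA_sep s t : ~ TA_le s t -> exists U V : set (TA A),
  [/\ nbhs (s : TA_up A) U, nbhs (t : TA_lo A) V & forall u v, U u -> V v -> ~ TA_le u v].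
Proof.
move=> /TA_leP/existsNP[z /negP]; rewrite -ltNge => ts.
have z0 := pos_cone_val z.
have [r r0 rE] := ge0_lt_real (tev_ge0 t (val z)) ts.
have [p rp ps] : exists2 p, r < p & (p%:E < tev s (val z))%E.
  move: ts; rewrite rE; case: (tev s (val z)) => [v||] //.
    by rewrite lte_fin => rv; exists ((r + v) / 2); rewrite ?lte_fin; lra.
  by move=> _; exists (r + 1); rewrite ?ltry // ltrDl.
have [e e0 pse] := ev_cutdown_lt (TAP s) z0 ps.
exists [set u | (p%:E < tev u (cutdown (val z) e))%E].
exists [set v | (tev v (cutdown (val z) e) < p%:E)%E]; split.
- apply: (@TA_up_nbhs s (mkpos (cutdown_pos z0 (ltW e0)))) => //.
  exact: le_trans (ltW rp).
- by apply: TA_lo_nbhs => //; rewrite rE lte_fin.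
- move=> u v /= pu vp uv; have := lt_trans vp pu; rewrite ltNge => /negP; apply.
  exact: tev_mono.
Qed.

Lemma TA_iv_up_continuous : continuous (id : TA_iv A -> TA_up A).
Proof. by move=> t; exact: (@TA_up_cvg (nbhs (t : TA_iv A)) t _ (@TA_iv_nbhs_up t)). Qed.

Lemma TA_iv_lo_continuous : continuous (id : TA_iv A -> TA_lo A).
Proof. by move=> t; exact: (@TA_lo_cvg (nbhs (t : TA_iv A)) t _ (@TA_iv_nbhs_lo t)). Qed.

(** When [s] is below [t], the principal filter at [t] converges to [s], so [t] lies in every open
    set around [s]. *)
Lemma TA_up_open_upper (U : set (TA_up A)) s t : open U -> TA_le s t -> U s -> U t.
Proof.
move=> Uo st Us; have : globally [set t] U; last by apply.
apply: (@TA_up_cvg (globally [set t]) s _ _ U); last by apply: open_nbhs_nbhs.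
move=> z r r0 rs _ -> /=; exact: lt_le_trans rs (tev_mono _ st).
Qed.

Lemma TA_lo_open_lower (U : set (TA_lo A)) s t : open U -> TA_le t s -> U s -> U t.
Proof.
move=> Uo ts Us; have : globally [set t] U; last by apply.
apply: (@TA_lo_cvg (globally [set t]) s _ _ U); last by apply: open_nbhs_nbhs.
move=> z e p e0 sp _ -> /=; apply: le_lt_trans (tev_mono _ ts) _; apply: le_lt_trans sp.
by apply: ev_cutdown_le (ltW e0); [exact: TAP|exact: pos_cone_val].
Qed.

Lemma compact_ordered_TA : compact_ordered_space (TA_le (A := A) : rel (TA_iv A)).
Proof.
split.
- exact: compact_TA_iv.
- exact: TA_le_refl.
- by move=> s t /andP[]; exact: TA_le_anti.
- by move=> t s u; exact: TA_le_trans.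
- rewrite -openC openE => -[s t] /= /TA_sep[U [V [Us Vt UV]]].
  exists (U, V) => /=; last by move=> [u v] [/= Uu Vv]; exact: UV.
  by split; [exact: (TA_iv_up_continuous Us)|exact: (TA_iv_lo_continuous Vt)].
Qed.

Lemma stably_compact_TA_up : stably_compact (TA_up A).
Proof.
apply: (@stably_compact_upper (TA_iv A) (TA_up A) id id (@TA_le R A)) => //.
- exact: compact_TA_iv.
- exact: TA_iv_up_continuous.
- exact: TA_le_refl.
- exact: TA_le_anti.
- exact: TA_up_open_upper.
- move=> s t /TA_sep[U [V [Us Vt UV]]]; exists U, V; split=> //.
  exact: (TA_iv_lo_continuous Vt).
Qed.

Lemma stably_compact_TA_lo : stably_compact (TA_lo A).
Proof.
apply: (@stably_compact_upper (TA_iv A) (TA_lo A) id id (fun s t => @TA_le R A t s)) => //.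
- exact: compact_TA_iv.
- exact: TA_iv_lo_continuous.
- exact: TA_le_refl.
- by move=> s t ts st; exact: TA_le_anti.
- exact: TA_lo_open_lower.
- move=> s t /TA_sep[U [V [Us Vt UV]]]; exists V, U; split=> //.
    exact: (TA_iv_up_continuous Us).
  by move=> u v Vu Uv; exact: UV.
Qed.

(** * Joint continuity of the operations, for all choices of topologies at once *)

Section cone_operations.
Context (P Q : topologicalType) (f : P -> TA A) (k : Q -> {posnum R}).

(** In the uses [f] is the identity from the cone with one of its topologies. A level below the sum
    is split into levels below the summands; a negative one is harmless because traces are
    nonnegative. *)
Lemma add_up_cvg (s t : P) : up_cvg (f @ s) (f s) -> up_cvg (f @ t) (f t) ->
  up_cvg ((fun p : P * P => TA_add (f p.1) (f p.2)) @ (s, t)) (TA_add (f s) (f t)).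
Proof.
move=> fs ft z r r0; rewrite tev_add => /(lt_add_split (tev_ge0 _ _) (tev_ge0 _ _)).
have pos (u : P) (q : R) : up_cvg (f @ u) (f u) -> (q%:E < tev (f u) (val z))%E ->
    \forall u' \near u, (q%:E < tev (f u') (val z))%E.
  move=> fu; have [q0|q0 _] := leP 0 q; first exact: fu.
  by apply: filterS filterT => u' _; apply: lt_le_trans (tev_ge0 _ _); rewrite lte_fin.
move=> [p [q [/(pos _ _ fs) ps /(pos _ _ ft) qt rpq]]].
exists ([set u | (p%:E < tev (f u) (val z))%E], [set u | (q%:E < tev (f u) (val z))%E]) => //.
move=> [u v] [/= pu qv]; rewrite tev_add (@le_lt_trans _ _ (p%:E + q%:E)%E) //.
exact: lteD.
Qed.

Lemma add_lo_cvg (s t : P) : lo_cvg (f @ s) (f s) -> lo_cvg (f @ t) (f t) ->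
  lo_cvg ((fun p : P * P => TA_add (f p.1) (f p.2)) @ (s, t)) (TA_add (f s) (f t)).
Proof.
move=> fs ft z e r e0; rewrite tev_add => /(gt_add_split (tev_ge0 _ _) (tev_ge0 _ _)).
move=> [p [q [/(fs _ _ _ e0) ps /(ft _ _ _ e0) qt rpq]]].
exists ([set u | (tev (f u) (cutdown (val z) e) < p%:E)%E],
        [set u | (tev (f u) (cutdown (val z) e) < q%:E)%E]) => //.
move=> [u v] [/= pu qv]; rewrite tev_add (@lt_le_trans _ _ (p%:E + q%:E)%E) //.
exact: lteD.
Qed.

Lemma scale_up_cvg (l : Q) (t : P) :
  (forall c : R, 0 < c -> c < (k l)%:num -> \forall l' \near l, c < (k l')%:num) ->
  up_cvg (f @ t) (f t) ->
  up_cvg ((fun p : Q * P => TA_scale (k p.1) (f p.2)) @ (l, t)) (TA_scale (k l) (f t)).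
Proof.
move=> kl ft z r r0; rewrite tev_scale => rlt.
(* [p] lies strictly between r/k and t(z), and below it [c] is taken between r/p and k; then c p
   bounds [r] from above. If t(z) = +oo, r/k + 1 serves as [p]. *)
have [p [p0 pr pt]] : exists p : R, [/\ 0 < p, r < (k l)%:num * p & (p%:E < tev (f t) (val z))%E].
  move: rlt (tev_ge0 (f t) (val z)); case: (tev _ _) => [v||] //.
    rewrite -EFinM !lte_fin lee_fin => rv v0.
    exists ((r / (k l)%:num + v) / 2).
    have h : r / (k l)%:num < v by rewrite ltr_pdivrMr // mulrC.
    have h0 : 0 <= r / (k l)%:num by rewrite divr_ge0.
    split; rewrite ?lte_fin; [lra| |lra].
    by rewrite -ltr_pdivrMl // mulrC; lra.
  move=> _ _; exists (r / (k l)%:num + 1); rewrite ltry; split=> //.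
    by rewrite ltr_wpDl // divr_ge0.
  by rewrite mulrDr mulr1 mulrC divfK // ltrDl.
have c1 : r / p < (k l)%:num by rewrite ltr_pdivrMr.
have [c [c0 cr ck]] : exists c : R, [/\ 0 < c, r <= c * p & c < (k l)%:num].
  exists ((r / p + (k l)%:num) / 2).
  have rp : 0 <= r / p by rewrite divr_ge0 // ltW.
  have kp : 0 < (k l)%:num by [].
  split; [lra| |lra].
  by rewrite -ler_pdivrMr //; lra.
exists ([set l' | c < (k l')%:num], [set u | (p%:E < tev (f u) (val z))%E]) => /=.
  by split; [exact: kl|exact: (ft z p (ltW p0))].
move=> [l' u] [/= cl pu]; rewrite tev_scale (@le_lt_trans _ _ (c * p)%:E) ?lee_fin //.
apply: (@le_lt_trans _ _ ((k l')%:num * p)%:E); first by rewrite lee_fin ler_wpM2r // ltW.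
by rewrite EFinM lte_pmul2l.
Qed.

(** The scalar enters through upper bounds, which define open sets for the lower topology of the
    positive reals; [scale_up_cvg] uses lower bounds, in accordance with the upper topology. *)
Lemma scale_lo_cvg (l : Q) (t : P) :
  (forall c : R, (k l)%:num < c -> \forall l' \near l, (k l')%:num < c) ->
  lo_cvg (f @ t) (f t) ->
  lo_cvg ((fun p : Q * P => TA_scale (k p.1) (f p.2)) @ (l, t)) (TA_scale (k l) (f t)).
Proof.
move=> kl ft z e r e0; rewrite tev_scale.
have := tev_ge0 (f t) (val z); case E : (tev _ _) => [v||] //; last first.
  by rewrite gt0_muley ?lte_fin // ltNge leey.
rewrite -EFinM lte_fin lee_fin => v0 vr.
have kp : 0 < (k l)%:num by [].
have h : v < r / (k l)%:num by rewrite ltr_pdivlMr // mulrC.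
pose p := (r / (k l)%:num + v) / 2.
have p0 : 0 < p by rewrite /p; lra.
have vp : v < p by rewrite /p; lra.
have pr : p < r / (k l)%:num by rewrite /p; lra.
have kr : (k l)%:num < r / p by rewrite ltr_pdivlMr // mulrC -ltr_pdivlMr.
exists ([set l' | (k l')%:num < r / p], [set u | (tev (f u) (cutdown (val z) e) < p%:E)%E]) => /=.
  by split; [exact: kl|apply: (ft z e p e0); rewrite E lte_fin].
move=> [l' u] [/= cl pu]; rewrite tev_scale.
apply: (@lt_le_trans _ _ ((k l')%:num%:E * p%:E)%E); first by rewrite lte_pmul2l.
by rewrite -EFinM lee_fin -ler_pdivlMr // ltW.
Qed.

End cone_operations.

Lemma posnum_up_nbhs (l : posnum_up R) (c : R) : 0 < c -> c < (l : {posnum R})%:num ->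
  \forall l' \near l, c < (l' : {posnum R})%:num.
Proof.
move=> c0 cl; have S : @upper_subbase _ {posnum R} (~` [set y | (y <= PosNum c0)%O]).
  by exists (PosNum c0).
have := @generated_nbhs _ _ (l : posnum_up R) _ S.
have H (y : {posnum R}) : (~` [set y | (y <= PosNum c0)%O]) y <-> c < y%:num.
  by rewrite ltNge; split=> [/negP|/negP].
move=> /(_ ((H l).2 cl)); apply: filterS => y; exact: (H y).1.
Qed.

Lemma posnum_lo_nbhs (l : posnum_lo R) (c : R) : (l : {posnum R})%:num < c ->
  \forall l' \near l, (l' : {posnum R})%:num < c.
Proof.
move=> lc; have c0 : 0 < c by exact: lt_trans lc.
have S : @lower_subbase _ {posnum R} (~` [set y | (PosNum c0 <= y)%O]).
  by exists (PosNum c0).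
have := @generated_nbhs _ _ (l : posnum_lo R) _ S.
have H (y : {posnum R}) : (~` [set y | (PosNum c0 <= y)%O]) y <-> y%:num < c.
  by rewrite ltNge; split=> [/negP|/negP].
move=> /(_ ((H l).2 lc)); apply: filterS => y; exact: (H y).1.
Qed.

Lemma posnum_usual_continuous :
  continuous (fun l : posnum_usual R => (l : {posnum R})%:num : R).
Proof. exact: initial_continuous. Qed.

End trace_topologies.

Theorem corollary4p3 (R : realType) (A : cstarAlgType R) :
  [/\ (* (a) *)
      [/\ compact_ordered_space (TA_le (A := A) : rel (TA_iv A)),
          forall s s' t t' : TA A, TA_le s s' -> TA_le t t' ->
            TA_le (TA_add s t) (TA_add s' t'),
          forall (r r' : {posnum R}) (t t' : TA A), r%:num <= r'%:num ->
            TA_le t t' -> TA_le (TA_scale r t) (TA_scale r' t'),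
          continuous (fun p : TA_iv A * TA_iv A =>
                        TA_add p.1 p.2 : TA_iv A)
        & continuous (fun p : posnum_usual R * TA_iv A =>
                        TA_scale p.1 p.2 : TA_iv A)],
      (* (b) *)
      [/\ stably_compact (TA_up A),
          continuous (fun p : TA_up A * TA_up A =>
                        TA_add p.1 p.2 : TA_up A)
        & continuous (fun p : posnum_up R * TA_up A =>
                        TA_scale p.1 p.2 : TA_up A)]
    & (* (c) *)
      [/\ stably_compact (TA_lo A),
          continuous (fun p : TA_lo A * TA_lo A =>
                        TA_add p.1 p.2 : TA_lo A)
        & continuous (fun p : posnum_lo R * TA_lo A =>
                        TA_scale p.1 p.2 : TA_lo A)]].
Proof.
split.
- split.
  + exact: compact_ordered_TA.
  + move=> s s' t t' ss' tt'; apply/TA_leP => z; rewrite !tev_add.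
    by apply: leeD; exact: tev_mono.
  + move=> r r' t t' rr' tt'; apply/TA_leP => z; rewrite !tev_scale.
    by apply: lee_pmul; rewrite ?lee_fin ?tev_ge0 // tev_mono.
  + move=> [s t]; apply: TA_iv_cvg.
      by apply: (@add_up_cvg _ _ (TA_iv A) id); exact: TA_iv_nbhs_up.
    by apply: (@add_lo_cvg _ _ (TA_iv A) id); exact: TA_iv_nbhs_lo.
  + move=> [r t]; have rc := @posnum_usual_continuous R r.
    apply: TA_iv_cvg.
      apply: (@scale_up_cvg _ _ (TA_iv A) (posnum_usual R) id id); last exact: TA_iv_nbhs_up.
      by move=> c _ cr; exact: rc _ (lt_nbhsr cr).
    apply: (@scale_lo_cvg _ _ (TA_iv A) (posnum_usual R) id id); last exact: TA_iv_nbhs_lo.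
    by move=> c cr; exact: rc _ (lt_nbhsl cr).
- split.
  + exact: stably_compact_TA_up.
  + move=> [s t]; apply: TA_up_cvg.
    by apply: (@add_up_cvg _ _ (TA_up A) id); exact: TA_up_nbhs.
  + move=> [r t]; apply: TA_up_cvg.
    apply: (@scale_up_cvg _ _ (TA_up A) (posnum_up R) id id); last exact: TA_up_nbhs.
    by move=> c c0 cr; exact: posnum_up_nbhs.
- split.
  + exact: stably_compact_TA_lo.
  + move=> [s t]; apply: TA_lo_cvg.
    by apply: (@add_lo_cvg _ _ (TA_lo A) id); exact: TA_lo_nbhs.
  + move=> [r t]; apply: TA_lo_cvg.
    apply: (@scale_lo_cvg _ _ (TA_lo A) (posnum_lo R) id id); last exact: TA_lo_nbhs.
    by move=> c cr; exact: posnum_lo_nbhs.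
Qed.
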